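(* Let $d \ge 2$, let $T = \mathbb{Z}^d$ or $T = \mathbb{R}^d$, and let $f$ be a Gaussian field on $T$, assumed continuous if $T = \mathbb{R}^d$. Suppose that both of the following conditions hold: (1) (Uniformly bounded local suprema) $$\sup_{x \in T} \mathbb{E}\Big[\sup_{y \in (x + B(1)) \cap T} |f(y)|\Big] < \infty.$$ (2) (Polylogarithmic correlation decay) There exist constants $c, \delta > 0$ such that $$|\mathrm{Cov}[f(x),f(y)]| \le g(\|x - y\|_2), \qquad x,y \in T,$$ where $g(r) = c\,(\log(1 + r))^{-3-\delta}$. Then $\ell_c \in (-\infty,\infty)$, where $$\ell_c = \inf\Big\{\ell \in \mathbb{R} : \mathbb{P}_\ell\big[\{f \ge 0\} \text{ contains an unbounded path-connected component}\big] > 0\Big\}.$$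
   Context: $f$ is not assumed centred or stationary. For $\ell \in \mathbb{R}$, $\mathbb{P}_\ell$ denotes the law of $f + \ell$; equivalently $\mathbb{P}_\ell[\{f \ge 0\} \in \cdot\,] = \mathbb{P}[\{f + \ell \ge 0\} \in \cdot\,]$. Here $\{f \ge 0\} = \{x \in T : f(x) \ge 0\}$, and path refers to a (nearest-neighbour) lattice path if $T = \mathbb{Z}^d$ and to a continuous path if $T = \mathbb{R}^d$. $B(r)$ is the Euclidean ball of radius $r$ centred at the origin. By convention $g(0) = +\infty$, and $\inf \emptyset = +\infty$. *)

(* Defs.v *)
From HB Require Import structures.
From mathcomp Require Import all_boot all_order all_algebra.
From mathcomp Require Import all_classical all_reals all_analysis.

Set Implicit Arguments.
Unset Strict Implicit.
Unset Printing Implicit Defensive.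

Import Order.TTheory GRing.Theory Num.Theory.
Import numFieldNormedType.Exports.

Local Open Scope classical_set_scope.
Local Open Scope ring_scope.

(* T = Z^d (Lattice) or T = R^d (Continuum) *)
Inductive domain := Lattice | Continuum.

Definition site (R : realType) (d : nat) (D : domain) : Type :=
  match D with
  | Lattice => 'rV[int]_d
  | Continuum => 'rV[R]_d
  end.

Definition embed (R : realType) (d : nat) (D : domain) :
    site R d D -> 'rV[R]_d :=
  match D with
  | Lattice => fun x => map_mx intr x
  | Continuum => fun x => x
  end.

(* The norm of the library on 'rV[R]_d is the sup norm. *)
Definition eucl_norm (R : realType) (d : nat) (x : 'rV[R]_d) : R :=
  Num.sqrt (\sum_(i < d) x ord0 i ^+ 2).

Definition eucl_dist (R : realType) (d : nat) (D : domain) (x y : site R d D) : R :=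
  eucl_norm (embed x - embed y).

Definition unit_ball (R : realType) (d : nat) (D : domain) (x : site R d D) :
    set (site R d D) :=
  [set y | eucl_dist y x <= 1].

Definition nearest_neighbour (d : nat) : rel 'rV[int]_d :=
  fun x y => \sum_(i < d) `|x ord0 i - y ord0 i| == 1 :> int.

Definition lattice_path (d : nat) (A : set 'rV[int]_d) (x y : 'rV[int]_d) : Prop :=
  exists s : seq 'rV[int]_d,
    [/\ path (@nearest_neighbour d) x s, last x s = y
      & forall z, z \in x :: s -> A z].

Definition continuous_path (R : realType) (d : nat) (A : set 'rV[R]_d)
    (x y : 'rV[R]_d) : Prop :=
  exists gamma : R -> 'rV[R]_d,
    [/\ {within `[0, 1], continuous gamma}, gamma 0 = x, gamma 1 = y
      & forall t, t \in `[0, 1] -> A (gamma t)].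

Definition path_joined (R : realType) (d : nat) (D : domain) :
    set (site R d D) -> site R d D -> site R d D -> Prop :=
  match D with
  | Lattice => @lattice_path d
  | Continuum => @continuous_path R d
  end.

Definition path_component (R : realType) (d : nat) (D : domain)
    (A : set (site R d D)) (x : site R d D) : set (site R d D) :=
  [set y | path_joined A x y].

Definition has_unbounded_component (R : realType) (d : nat) (D : domain)
    (A : set (site R d D)) : Prop :=
  exists2 x, A x & ~ bounded_set (@embed R d D @` path_component A x).

(* [normal_prob m 0] is not the Dirac mass at [m], but degenerate Gaussian laws
   are Dirac masses. *)
Definition gaussian_law (R : realType) (m s : R) (B : set R) : \bar R :=
  if s == 0 then \d_m B else normal_prob m s B.

Definition gaussian_rv (disp : measure_display) (Omega : measurableType disp)
    (R : realType) (P : probability Omega R) (X : Omega -> R) : Prop :=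
  exists m s : R, forall B : set R, measurable B ->
    P (X @^-1` B) = gaussian_law m s B.

(* All finite-dimensional marginals are Gaussian vectors, that is, all their
   linear combinations are Gaussian; neither centred nor stationary. *)
Definition gaussian_field (disp : measure_display) (Omega : measurableType disp)
    (R : realType) (P : probability Omega R) (X : Type)
    (f : X -> {RV P >-> R}) : Prop :=
  forall (n : nat) (x : 'I_n -> X) (a : 'I_n -> R),
    gaussian_rv P (fun w => \sum_(i < n) a i * f (x i) w).

(* Only a condition when T = R^d; for almost every sample point. *)
Definition continuous_field (disp : measure_display)
    (Omega : measurableType disp) (R : realType) (P : probability Omega R)
    (d : nat) (D : domain) : (site R d D -> {RV P >-> R}) -> Prop :=
  match D with
  | Lattice => fun=> True
  | Continuum => fun f : 'rV[R]_d -> {RV P >-> R} =>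
      {ae P, forall w, continuous (fun x => f x w)}
  end.

Definition bounded_local_suprema (disp : measure_display)
    (Omega : measurableType disp) (R : realType) (P : probability Omega R)
    (d : nat) (D : domain) (f : site R d D -> {RV P >-> R}) : Prop :=
  (ereal_sup (range (fun x : site R d D =>
     \int[P]_w ereal_sup [set (`|f y w|%R)%:E | y in unit_ball x])) < +oo)%E.

(* g(r) = c (log (1 + r))^(-3 - delta) with g(0) = +oo; the library's
   [0 `^ (- 3 - delta)] is 0. *)
Definition polylog (R : realType) (c delta r : R) : \bar R :=
  if r == 0 then +oo%E else (c * ln (1 + r) `^ (- 3 - delta))%:E.

Definition polylog_correlation_decay (disp : measure_display)
    (Omega : measurableType disp) (R : realType) (P : probability Omega R)
    (d : nat) (D : domain) (f : site R d D -> {RV P >-> R}) : Prop :=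
  exists c delta : R, [/\ 0 < c, 0 < delta &
    forall x y : site R d D,
      (`|covariance P (f x) (f y)| <= polylog c delta (eucl_dist x y))%E].

(* The probability that {h >= 0} contains an unbounded path-connected
   component.  On R^d this event is in general only analytic, hence measurable
   for the completion of P; its probability under the completion is its outer
   measure, which is P itself on the sigma-algebra. *)
Definition percolation_probability (disp : measure_display)
    (Omega : measurableType disp) (R : realType) (P : probability Omega R)
    (d : nat) (D : domain) (h : site R d D -> Omega -> R) : \bar R :=
  (P^*)%mu [set w | has_unbounded_component [set x | 0 <= h x w]].

Definition critical_level (disp : measure_display)
    (Omega : measurableType disp) (R : realType) (P : probability Omega R)
    (d : nat) (D : domain) (f : site R d D -> {RV P >-> R}) : \bar R :=
  ereal_inf [set l%:E | l in
    [set l : R | (0 < percolation_probability P (fun x w => f x w + l)%R)%E]].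

(* Main.v *)
From HB Require Import structures.
Require Import Defs.
From mathcomp Require Import all_boot all_order all_algebra.
From mathcomp Require Import all_classical all_reals all_analysis.
From mathcomp Require Import measurable_realfun lebesgue_integral charge.
From mathcomp Require Import ring lra zify.

Set Implicit Arguments.
Unset Strict Implicit.
Unset Printing Implicit Defensive.
Import Order.TTheory GRing.Theory Num.Theory.
Import numFieldNormedType.Exports.
Local Open Scope classical_set_scope.
Local Open Scope ring_scope.

(** Both bounds on the critical level are renormalisation arguments resting on a
sprinkled decoupling inequality for Gaussian vectors.

Decoupling.  Let X and Y be the restrictions of a Gaussian field to two finite
families of points, and let kappa bound all covariances between a coordinate of
X and a coordinate of Y.  For bounded Phi and Psi, Lipschitz for the sup norm,
|Cov(Phi(X), Psi(Y))| <= kappa Lip(Phi) Lip(Psi) ([lipschitz_covariance]).  The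
number of points does not enter: this is what makes sup norms useful.  For
trigonometric sums it follows from the interpolation between Y and an
independent copy of Y, whose derivative is a sum of cross-covariances times
partial derivatives ([trig_covariance]); only one-dimensional Gaussian cosine
integrals are involved, since a product of cosines is a sum of cosines.  The
general case follows by approximating a Lipschitz function by trigonometric sums
with almost the same l1 bound on the gradient ([trig_approx]): substitute
S sin(x / S) for x and average against a positive trigonometric kernel over a
grid of the torus.  Applied to ramps of functionals T of X and U of Y that are
1-Lipschitz, it gives P(T > u, U > u) <= P(T > u - e) P(U > u - e) + kappa / e^2
([sprinkled_decoupling]).

Renormalisation.  Space is cut into cells indexed by Z^d; a cell is bad at level
u if the field exceeds u at some of its sample points, which for a continuous
field are dense in the cell.  A chain of bad cells crossing a box of size 8^n
contains two crossings of boxes of size 8^(n-1) far from each other; iterating,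
it produces an event [u < cascade K n g z] ([crossing_cascade]), where a cascade
is built from the field by maxima and minima only, hence is 1-Lipschitz.  The
probability q_n of such an event, uniform in the location, satisfies
q_(n+1)(u + e_n) <= C (q_n(u)^2 + c n^(-3-delta) / e_n^2), because the
covariances at distance 8^n are of order n^(-3-delta).  The sprinklings e_n must
be summable: with eta = delta / 4 and e_n of order n^(-1-eta), the error term is
of order n^(-1-2 eta) and the bound q_n <= n^(-1-eta) propagates
([cascade_renormalisation]).  The first scales are treated with Markov's
inequality, applied to the local suprema.

Lower bound.  If {f + l >= 0} percolates with -l large, bad cells at level about
-l form chains from some cell z to arbitrarily large distances, so that cascade
events around z occur at all scales.  Their probabilities tend to 0, and there
are countably many z.

Upper bound.  Work with -f, in a coordinate plane.  If the nearest-neighbour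
cluster of good cells of the origin is finite, it is surrounded by a chain of bad
cells joining the positive half-axis to the negative one ([planar_duality]).
Depending on the larger distance of its end points to the origin, this gives a
bad cell near the origin on the axis, or a cascade event at some scale n, around
one of 17 points of the axis.  Since q_n is summable, the probability of all this
is small for large scales and levels; otherwise the cluster is infinite and a
polygonal path along its cells stays in {f + u >= 0}.

The percolation event need not be measurable: all these estimates are made with
the outer probability. *)

(** * Integration against a density *)

Section density.
Context d (T : measurableType d) (R : realType).
Variables (nu : {finite_measure set T -> \bar R}).
Variables (mu : {sigma_finite_measure set T -> \bar R}) (rho : T -> R).
Hypothesis rho_ge0 : forall x, 0 <= rho x.
Hypothesis rho_int : mu.-integrable setT (EFin \o rho).
Hypothesis nuE : forall A, measurable A -> nu A = (\int[mu]_(x in A) (rho x)%:E)%E.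

Let numu : nu `<< mu.
Proof.
apply/null_content_dominatesP => A mA muA0; rewrite nuE//.
apply: null_set_integral => //.
by apply: measurable_funTS; exact: measurable_int rho_int.
Qed.

(** The density is a Radon-Nikodym derivative up to a null set, so the
change-of-variables formula for the latter applies. *)
Lemma ge0_integral_density (f : T -> \bar R) : measurable_fun setT f ->
  (forall x, 0 <= f x)%E ->
  (\int[nu]_x f x = \int[mu]_x (f x * (rho x)%:E))%E.
Proof.
move=> mf f0; rewrite -(Radon_Nikodym_SigmaFinite.change_of_variables numu)//.
have ig := Radon_Nikodym_SigmaFinite.f_integrable numu.
apply: ae_eq_integral => //.
- by apply: emeasurable_funM => //; exact: measurable_int ig.
- by apply: emeasurable_funM => //; exact: measurable_int rho_int.
- apply: ae_eqe_mul2l; apply: integral_ae_eq => //.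
    exact: measurable_int rho_int.
  by move=> A _ mA; rewrite -Radon_Nikodym_SigmaFinite.f_integral// nuE.
Qed.

Lemma integrable_density (f : T -> R) : measurable_fun setT f ->
  mu.-integrable setT (EFin \o (f \* rho)) ->
  nu.-integrable setT (EFin \o f).
Proof.
move=> mf /integrableP[_ fi]; apply/integrableP; split.
  exact/measurable_EFinP.
rewrite ge0_integral_density//; last first.
  by apply/measurable_EFinP/measurableT_comp.
under eq_integral do rewrite /= -EFinM.
apply: le_lt_trans fi; rewrite le_eqVlt; apply/orP; left; apply/eqP.
by apply: eq_integral => x _; rewrite /= normrM (ger0_norm (rho_ge0 x)).
Qed.

Lemma integral_density (f : T -> R) : measurable_fun setT f ->
  mu.-integrable setT (EFin \o (f \* rho)) ->
  (\int[nu]_x (f x)%:E = \int[mu]_x (f x * rho x)%:E)%E.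
Proof.
move=> mf fi; rewrite [LHS]integralE [RHS]integralE.
have mEf : measurable_fun setT (EFin \o f) by exact/measurable_EFinP.
rewrite !ge0_integral_density//; last 2 first.
- exact: measurable_funeneg.
- exact: measurable_funepos.
congr (_ - _)%E; apply: eq_integral => x _; rewrite ?funeposE ?funenegE /=.
- by rewrite maxe_pMl ?lee_fin ?rho_ge0// mul0e.
- by rewrite -mulNr EFinM maxe_pMl ?lee_fin ?rho_ge0// mul0e.
Qed.
End density.

(** * Stein's identity for the normal law *)

Lemma Rintegral_dominated_cvg d (T : measurableType d) (R : realType)
    (mu : {measure set T -> \bar R}) (f_ : nat -> T -> R) (f g : T -> R) :
  (forall n, measurable_fun setT (f_ n)) ->
  (forall x, f_ n x @[n --> \oo] --> f x) ->
  mu.-integrable setT (EFin \o g) ->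
  (forall n x, `|f_ n x| <= g x) ->
  mu.-integrable setT (EFin \o f) /\
  (\int[mu]_x f_ n x) @[n --> \oo] --> \int[mu]_x f x.
Proof.
move=> mf_ cf ig fg.
have mf : measurable_fun setT f.
  by apply: (measurable_fun_cvg (h := f_)) => // x _; exact: cf.
have [] := @dominated_convergence _ _ _ mu setT measurableT
    (fun n => EFin \o f_ n) (EFin \o f) (EFin \o g).
- by move=> n; apply/measurable_EFinP; exact: mf_.
- exact/measurable_EFinP.
- by apply: aeW => x _; apply: cvg_EFin; [exact: nearW|exact: cf].
- exact: ig.
- by apply: aeW => x n _; rewrite /= lee_fin; exact: fg.
move=> if_ _ c; split => //.
by apply: fine_cvg; rewrite fineK//; exact: integrable_fin_num if_.
Qed.

Section normal.
Variable R : realType.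
Variables m s : R.
Hypothesis s_neq0 : s != 0.
Notation mu := (@lebesgue_measure R).
Notation rho := (normal_pdf m s).
Let E (x : R) := expR (x - m) + expR (m - x).

(** Completing the square: an exponential tilt of a normal density is a shifted
normal density, up to a constant. All integrability and decay facts below come from it. *)
Lemma normal_exp_tilt (t x : R) :
  expR (t * (x - m)) * rho x = expR (s ^+ 2 * t ^+ 2 / 2) * normal_pdf (m + s ^+ 2 * t) s x.
Proof.
rewrite !normal_pdfE// /normal_fun !mulrA ![_ * normal_peak s]mulrC -!mulrA.
congr (_ * _); rewrite -!expRD; congr expR; field.
by rewrite s_neq0.
Qed.

Lemma integrable_normal_exp (t : R) :
  mu.-integrable setT (EFin \o (fun x => expR (t * (x - m)) * rho x)).
Proof.
under [X in _.-integrable _ X]eq_fun do rewrite /= normal_exp_tilt EFinM.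
by apply: integrableZl => //; exact: integrable_normal_pdf.
Qed.

Lemma normal_exp_le (t : R) : exists M, forall x, expR (t * (x - m)) * rho x <= M.
Proof.
exists (expR (s ^+ 2 * t ^+ 2 / 2) * normal_peak s) => x.
by rewrite normal_exp_tilt ler_wpM2l ?expR_ge0// normal_pdf_ub.
Qed.

Let EE x : E x = expR (1 * (x - m)) + expR (-1 * (x - m)).
Proof. by rewrite /E mul1r mulN1r opprB. Qed.

Let integrableE A : mu.-integrable setT (EFin \o (fun x => A * E x * rho x)).
Proof.
under [X in _.-integrable _ X]eq_fun do rewrite /= EE -mulrA mulrDl EFinM EFinD.
apply: integrableZl => //.
by apply: integrableD => //; exact: integrable_normal_exp.
Qed.

(** [E] grows like an exponential on both sides; domination by a multiple of it is the
growth condition of this part. *)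
Lemma integrable_normal_le (h : R -> R) A : measurable_fun setT h ->
  (forall x, `|h x| <= A * E x) ->
  mu.-integrable setT (EFin \o (fun x => h x * rho x)).
Proof.
move=> mh hA; apply: (le_integrable measurableT _ _ (integrableE A)).
  apply/measurable_EFinP; apply: measurable_funM => //.
  exact: measurable_normal_pdf.
move=> x _; rewrite lee_fin !normrM ler_wpM2r// (le_trans (hA x))//.
by rewrite -normrM ler_norm.
Qed.

Lemma is_derive_normal_pdf (x : R) :
  is_derive x (1 : R) rho (- ((x - m) / s ^+ 2) * rho x).
Proof.
have -> : rho = (fun x => normal_peak s * normal_fun m s x).
  by rewrite normal_pdfE.
pose u : R -> R := (- (s ^+ 2 *+ 2)^-1) \*: (id - cst m) ^+ 2.
have uE : (fun x => normal_peak s * normal_fun m s x) = normal_peak s \*: (expR \o u).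
  apply/funext => y; rewrite /u /normal_fun /= !fctE/= /GRing.scale /=; congr (_ * expR _).
  by rewrite mulNr mulrC mulNr.
have du : is_derive x (1 : R) u (- ((x - m) / s ^+ 2)).
  apply: is_derive_eq; rewrite !fctE /GRing.scale /= expr1 subr0.
  by field.
rewrite uE; apply: is_derive_eq.
rewrite /= [in RHS]/normal_fun /u !fctE /GRing.scale /=.
have -> : - (s ^+ 2 *+ 2)^-1 *: ((x - m) ^+ 2 : R^o) = - (x - m) ^+ 2 / (s ^+ 2 *+ 2).
  by rewrite /GRing.scale /= mulNr mulrC mulNr.
by field.
Qed.

(** The integrand is the derivative of [h * rho], which vanishes at infinity: its
integral over [m - n, m + n] is a difference of boundary values. *)
Lemma normal_stein (h h' : R -> R) A :
  (forall x : R, is_derive x (1 : R) h (h' x)) -> continuous h' ->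
  (forall x, `|h x| <= A * E x) -> (forall x, `|h' x| <= A * E x) ->
  (forall x, `|(x - m) * h x| <= A * E x) ->
  \int[mu]_x ((h' x - (x - m) / s ^+ 2 * h x) * rho x) = 0.
Proof.
move=> dh ch' hA h'A xhA.
pose G x := h x * rho x.
pose g x := (h' x - (x - m) / s ^+ 2 * h x) * rho x.
have dG (x : R) : is_derive x (1 : R) G (g x).
  have drho := is_derive_normal_pdf x.
  have -> : G = h * rho by [].
  apply: is_derive_eq; rewrite /g /GRing.scale /=; ring.
have ch : continuous h.
  by move=> x; apply/differentiable_continuous/derivable1_diffP; apply: ex_derive.
have cg : continuous g.
  move=> x; apply: cvgM; last exact: continuous_normal_pdf.
  apply: cvgB; first exact: ch'.
  apply: cvgM; last exact: ch.
  by apply: cvgM; [apply: cvgB; [exact: cvg_id|exact: cvg_cst]|exact: cvg_cst].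
have cG : continuous G.
  by move=> x; apply/differentiable_continuous/derivable1_diffP; apply: ex_derive.
have mg : measurable_fun setT g by exact: continuous_measurable_fun.
have ig : mu.-integrable setT (EFin \o g).
  apply: (@integrable_normal_le _ (A * (1 + (s ^+ 2)^-1))).
    apply: measurable_funB; first exact: continuous_measurable_fun.
    apply: measurable_funM; last exact: continuous_measurable_fun.
    by apply: measurable_funM => //; apply: measurable_funB.
  move=> x; rewrite (le_trans (ler_normB _ _))//.
  have -> : A * (1 + (s ^+ 2)^-1) * E x = A * E x + A * E x * (s ^+ 2)^-1 by ring.
  rewrite lerD// mulrAC normrM ler_pM//.
  by rewrite ger0_norm// invr_ge0 sqr_ge0.
have [M1 hM1] := normal_exp_le 1.
have [M2 hM2] := normal_exp_le (-1).
have Gle x : `|x - m| * `|G x| <= `|A| * (M1 + M2).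
  rewrite /G normrM mulrA -normrM (ger0_norm (normal_pdf_ge0 _ _ _)).
  apply: (@le_trans _ _ (`|A| * E x * rho x)).
    rewrite ler_wpM2r ?normal_pdf_ge0// (le_trans (xhA x))//.
    by rewrite ler_wpM2r ?addr_ge0 ?expR_ge0// ler_norm.
  by rewrite -mulrA ler_wpM2l// EE mulrDl lerD.
pose B (n : nat) : set R := `[m - n.+1%:R, m + n.+1%:R]%classic.
have cI : (\int[mu]_x (g \_ (B n)) x) @[n --> \oo] --> \int[mu]_x g x.
  apply: (proj2 (@Rintegral_dominated_cvg _ _ R mu (fun n => g \_ (B n)) g
    (fun x => `|g x|) _ _ _ _)).
  - move=> n; have mB : measurable (B n) by exact: measurable_itv.
    apply/(measurable_restrictT _ mB).
    exact: measurable_funTS.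
  - move=> x; apply: cvg_near_cst.
    near=> n; rewrite patchE ifT// inE /B /= in_itv /=.
    have : `|x - m| <= n.+1%:R.
      rewrite -natr1 (@le_trans _ _ n%:R)// ?lerDl//.
      near: n; exact: nbhs_infty_ger.
    by rewrite ler_norml => /andP[]; lra.
  - by have := integrable_norm ig; apply: eq_integrable => // x.
  - by move=> n x; rewrite patchE; case: ifP => // _; rewrite normr0.
have IE n : \int[mu]_x (g \_ (B n)) x = G (m + n.+1%:R) - G (m - n.+1%:R).
  have lt : m - n.+1%:R < m + n.+1%:R :> R.
    by rewrite ltrD2l (@lt_trans _ _ 0) ?oppr_lt0 ?ltr0Sn.
  rewrite -[LHS]/(Rintegral _ _ _) /Rintegral.
  have -> : (\int[mu]_x ((g \_ (B n)) x)%:E = \int[mu]_(x in B n) (g x)%:E)%E.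
    by rewrite [RHS]integral_mkcond; apply: eq_integral => x _; rewrite restrict_EFin.
  rewrite (@continuous_FTC2 _ g G)//=.
  - exact: continuous_subspaceT.
  - split; first by move=> x _; apply: ex_derive.
      by apply: cvg_at_right_filter; exact: cG.
    by apply: cvg_at_left_filter; exact: cG.
  - by move=> x _; rewrite derive1E derive_val.
have c0 : (G (m + n.+1%:R) - G (m - n.+1%:R)) @[n --> \oo] --> (0 : R).
  have -> : (0 : R) = 0 - 0 by rewrite subr0.
  have inv0 : (`|A| * (M1 + M2) * n.+1%:R^-1 : R) @[n --> \oo] --> (0 : R).
    rewrite -[X in _ --> X](mulr0 (`|A| * (M1 + M2))).
    by apply: cvgM; [exact: cvg_cst|exact: cvg_harmonic].
  apply: cvgB; apply: norm_cvg0; apply: (squeeze_cvgr _ (cvg_cst 0) inv0);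
    apply: nearW => n; rewrite normr_ge0 /= ler_pdivlMr ?ltr0Sn// mulrC.
  - by have := Gle (m + n.+1%:R); rewrite addrAC subrr add0r ger0_norm.
  - by have := Gle (m - n.+1%:R); rewrite addrAC subrr add0r normrN ger0_norm.
have -> : \int[mu]_x ((h' x - (x - m) / s ^+ 2 * h x) * rho x) = \int[mu]_x g x by [].
have cI2 : (G (m + n.+1%:R) - G (m - n.+1%:R)) @[n --> \oo] --> \int[mu]_x g x.
  by apply: cvg_trans cI; rewrite (_ : (fun n => _) = (fun n => \int[mu]_x (g \_ (B n)) x))//;
    apply/funext => n; rewrite -IE.
by rewrite -(cvg_lim (@norm_hausdorff _ _) cI2) (cvg_lim (@norm_hausdorff _ _) c0).
Unshelve. all: end_near. Qed.
End normal.

(** * Moments and cosine transform of the normal law *)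

Section normal_moments.
Variable R : realType.
Variables m s : R.
Hypothesis s_neq0 : s != 0.
Notation mu := (@lebesgue_measure R).
Notation rho := (normal_pdf m s).
Let E (x : R) := expR (x - m) + expR (m - x).

Let E_ge1 x : 1 <= E x.
Proof.
rewrite /E; have [h|h] := leP 0 (x - m).
  by rewrite (@le_trans _ _ (expR (x - m)))// ?lerDl ?expR_ge0// -expR0 ler_expR.
rewrite (@le_trans _ _ (expR (m - x)))// ?lerDr ?expR_ge0//.
by rewrite -expR0 ler_expR; lra.
Qed.

Let E_gex x : `|x - m| <= E x.
Proof.
rewrite /E; have := expR_ge1Dx (x - m); have := expR_ge1Dx (m - x).
have := expR_ge0 (x - m); have := expR_ge0 (m - x).
by move=> ? ? ? ?; rewrite ler_norml; apply/andP; split; lra.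
Qed.

Let sqr_le_expR (y : R) : 0 <= y -> y ^+ 2 <= 4 * expR y.
Proof.
move=> y0; have h := expR_ge1Dx (y / 2).
have -> : y = y / 2 + y / 2 by lra.
rewrite expRD -expr2 {1}(_ : y / 2 + y / 2 = 2 * (y / 2)); last by lra.
rewrite exprMn.
have h0 : 0 <= y / 2 by lra.
by rewrite [2 ^+ 2](_ : _ = 4); [rewrite ler_pM2l// lerXn2r ?nnegrE ?expR_ge0//; lra|ring].
Qed.

Let E_gex2 x : `|(x - m) * (x - m)| <= 4 * E x.
Proof.
rewrite -expr2 ger0_norm ?sqr_ge0// /E; have [h|h] := leP 0 (x - m).
  have := sqr_le_expR h; have := expR_ge0 (m - x); lra.
have h' : 0 <= m - x by lra.
have := sqr_le_expR h'; have := expR_ge0 (x - m).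
rewrite (_ : (m - x) ^+ 2 = (x - m) ^+ 2); last by ring.
lra.
Qed.

Let mcont (f : R -> R) : continuous f -> measurable_fun setT f.
Proof. exact: continuous_measurable_fun. Qed.

Let c_lin (t g : R) : continuous (fun x => t * (x - m) + g).
Proof.
move=> x; apply: cvgD; last exact: cvg_cst.
apply: cvgM; first exact: cvg_cst.
by apply: cvgB; [exact: cvg_id|exact: cvg_cst].
Qed.

Let c_cos t g : continuous (fun x => cos (t * (x - m) + g)).
Proof. move=> x; apply: continuous_comp; [exact: c_lin|exact: continuous_cos]. Qed.

Let c_sin t g : continuous (fun x => sin (t * (x - m) + g)).
Proof. move=> x; apply: continuous_comp; [exact: c_lin|exact: continuous_sin]. Qed.

Let c_sub : continuous (fun x => x - m).
Proof. by move=> x; apply: cvgB; [exact: cvg_id|exact: cvg_cst]. Qed.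

Let abs_cos (x : R) : `|cos x| <= 1. Proof. by rewrite ler_norml cos_geN1 cos_le1. Qed.
Let abs_sin (x : R) : `|sin x| <= 1. Proof. by rewrite ler_norml sin_geN1 sin_le1. Qed.

Let i_cos t g : mu.-integrable setT (EFin \o (fun x => cos (t * (x - m) + g) * rho x)).
Proof.
apply: (@integrable_normal_le _ _ _ s_neq0 _ 1); first by apply: mcont; exact: c_cos.
by move=> x; rewrite mul1r ?(le_trans (abs_cos _) (E_ge1 x))//.
Qed.

Let i_xsin t g : mu.-integrable setT (EFin \o (fun x => (x - m) * sin (t * (x - m) + g) * rho x)).
Proof.
apply: (@integrable_normal_le _ _ _ s_neq0 _ 1).
  by apply: measurable_funM; apply: mcont; [exact: c_sub|exact: c_sin].
move=> x; rewrite mul1r normrM -[leRHS]mulr1 ler_pM//.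
Qed.

Let i_1 : mu.-integrable setT (EFin \o rho).
Proof. exact: integrable_normal_pdf. Qed.

Lemma integrable_normal_id : mu.-integrable setT (EFin \o (fun x => (x - m) * rho x)).
Proof.
apply: (@integrable_normal_le _ _ _ s_neq0 _ 1); first by apply: mcont; exact: c_sub.
by move=> x; rewrite mul1r.
Qed.

Lemma integrable_normal_sqr :
  mu.-integrable setT (EFin \o (fun x => (x - m) ^+ 2 * rho x)).
Proof.
apply: (@integrable_normal_le _ _ _ s_neq0 _ 4).
  by apply: measurable_funX; apply: mcont; exact: c_sub.
by move=> x; rewrite expr2.
Qed.

Lemma Rintegral_normal_pdf : \int[mu]_x rho x = 1.
Proof. by rewrite /Rintegral integral_normal_pdf. Qed.

Lemma normal_mean : \int[mu]_x ((x - m) * rho x) = 0.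
Proof.
have := @normal_stein R m s s_neq0 (cst 1) (cst 0) 1.
have -> : (fun x => (cst 0 x - (x - m) / s ^+ 2 * cst 1 x) * rho x) =
  (fun x => - (s ^+ 2)^-1 * ((x - m) * rho x)) by apply/funext => x /=; field.
rewrite RintegralZl//; last exact: integrable_normal_id.
move=> H; apply/eqP; have /eqP : - (s ^+ 2)^-1 * \int[mu]_x ((x - m) * rho x) = 0.
  apply: H => //=.
  - by move=> x; exact: cvg_cst.
  - by move=> x; rewrite mul1r normr1 E_ge1.
  - by move=> x; rewrite mul1r normr0 (le_trans _ (E_ge1 x)).
  - by move=> x; rewrite mul1r mulr1 E_gex.
by rewrite mulf_eq0 oppr_eq0 invr_eq0 expf_eq0 /= (negbTE s_neq0).
Qed.

Lemma normal_variance : \int[mu]_x ((x - m) ^+ 2 * rho x) = s ^+ 2.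
Proof.
have := @normal_stein R m s s_neq0 (fun x => x - m) (cst 1) 4.
have -> : (fun x => (cst 1 x - (x - m) / s ^+ 2 * (x - m)) * rho x) =
  (fun x => rho x - (s ^+ 2)^-1 * ((x - m) ^+ 2 * rho x)) by apply/funext => x /=; field.
rewrite RintegralB//; last first.
  have := integrableZl measurableT ((s ^+ 2)^-1) integrable_normal_sqr.
  exact.
rewrite RintegralZl//; last exact: integrable_normal_sqr.
rewrite Rintegral_normal_pdf => H.
have : 1 - (s ^+ 2)^-1 * \int[mu]_x ((x - m) ^+ 2 * rho x) = 0.
  apply: H => //=.
  - by move=> x; apply: is_derive_eq; rewrite subr0.
  - by move=> x; exact: cvg_cst.
  - move=> x; rewrite (le_trans (E_gex x))// /E.
    by have := E_ge1 x; rewrite -/(E x); lra.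
  - by move=> x; rewrite normr1 -/(E x); have := E_ge1 x; lra.
move/eqP; rewrite subr_eq0 => /eqP e.
by rewrite -[RHS]mulr1 e mulVKf ?sqrf_eq0.
Qed.

Let psi g t := \int[mu]_x (cos (t * (x - m) + g) * rho x).

Let stein_sin g t : \int[mu]_x ((x - m) * sin (t * (x - m) + g) * rho x) = s ^+ 2 * t * psi g t.
Proof.
have := @normal_stein R m s s_neq0 (fun x => sin (t * (x - m) + g))
  (fun x => t * cos (t * (x - m) + g)) (1 + `|t|).
have -> : (fun x => (t * cos (t * (x - m) + g) - (x - m) / s ^+ 2 *
     sin (t * (x - m) + g)) * rho x) =
  (fun x => t * (cos (t * (x - m) + g) * rho x) -
     (s ^+ 2)^-1 * ((x - m) * sin (t * (x - m) + g) * rho x)).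
  by apply/funext => x /=; field.
rewrite RintegralB//; last 2 first.
- exact: (integrableZl measurableT t (i_cos t g)).
- exact: (integrableZl measurableT (s ^+ 2)^-1 (i_xsin t g)).
rewrite RintegralZl; [|by []|exact: i_cos].
rewrite RintegralZl; [|by []|exact: i_xsin].
move=> H.
have : t * psi g t - (s ^+ 2)^-1 * \int[mu]_x ((x - m) * sin (t * (x - m) + g) * rho x) = 0.
  apply: H => //=.
  - move=> x.
    have -> : (fun x => sin (t * (x - m) + g)) = sin \o (t \*: (id - cst m) + cst g) by [].
    apply: is_derive_eq; rewrite !fctE /GRing.scale /=; ring.
  - by move=> x; apply: cvgM; [exact: cvg_cst|exact: c_cos].
  - move=> x; rewrite (le_trans (abs_sin _))// (le_trans (E_ge1 x))// ler_peMl//.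
      by have := E_ge1 x; lra.
    by rewrite lerDl.
  - by move=> x; rewrite normrM ler_pM// ?lerDr// (le_trans (abs_cos _) (E_ge1 x)).
  - move=> x; rewrite normrM -[leLHS]mulrC ler_pM//.
    by rewrite (le_trans (abs_sin _))// lerDl.
move/eqP; rewrite subr_eq0 => /eqP e.
by rewrite -mulrA e mulVKf ?sqrf_eq0.
Qed.

Let psi' g t : is_derive t (1 : R) (psi g) (- (s ^+ 2 * t * psi g t)).
Proof.
rewrite -stein_sin.
pose f (t x : R) := cos (t * (x - m) + g) * rho x.
have df (u y : R) : is_derive u (1 : R) (f ^~ y) (- ((y - m) * sin (u * (y - m) + g) * rho y)).
  have -> : (f ^~ y) = rho y \*: (cos \o ((y - m) \*: id + cst g)).
    by apply/funext => v; rewrite /f /= !fctE /GRing.scale /= mulrC [v * _]mulrC.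
  apply: is_derive_eq; rewrite !fctE /=.
  by rewrite (_ : (y - m) *: (u : R^o) = u * (y - m)) /GRing.scale /=; [ring|rewrite mulrC].
have tI : `]t - 1, t + 1[%classic t by rewrite /= in_itv /=; apply/andP; split; lra.
have iG : mu.-integrable setT (EFin \o (fun x => `|(x - m) * rho x|)).
  have := integrable_norm integrable_normal_id; apply: eq_integrable => // x.
have H1 : forall x : R, `]t - 1, t + 1[%classic x -> mu.-integrable setT (EFin \o f x).
  by move=> u _; exact: i_cos.
have H2 : forall x y : R, `]t - 1, t + 1[%classic x -> setT y -> derivable (f ^~ y) x 1.
  by move=> u y _ _; apply: ex_derive.
have H3 : forall y : R, 0 <= `|(y - m) * rho y| by [].
have H4 : forall x y : R, `]t - 1, t + 1[%classic x -> setT y ->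
    `|partial1of2 f x y| <= `|(y - m) * rho y|.
  move=> u y _ _; rewrite partial1of2E derive_val normrN 2!normrM.
  by rewrite [leRHS]normrM ler_wpM2r// ler_piMr// abs_sin.
apply: DeriveDef.
  exact: (derivable_under_integral measurableT tI H1 H2 H3 iG H4).
rewrite -derive1E (differentiation_under_integral measurableT tI H1 H2 H3 iG H4).
rewrite -mulN1r -RintegralZl; [|by []|exact: i_xsin].
by apply: eq_Rintegral => x _; rewrite partial1of2E derive_val mulN1r.
Qed.

(** By Stein's identity, the left-hand side satisfies psi'(t) = - s^2 t psi(t), so
[psi t * expR (t ^+ 2 * s ^+ 2 / 2)] is constant. *)
Lemma normal_cos g t :
  \int[mu]_x (cos (t * (x - m) + g) * rho x) = cos g * expR (- (t ^+ 2 * s ^+ 2 / 2)).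
Proof.
pose F (t : R) := psi g t * expR (t ^+ 2 * s ^+ 2 / 2).
have dF (u : R) : is_derive u (1 : R) F 0.
  have -> : F = psi g * (expR \o ((s ^+ 2 / 2) \*: (id ^+ 2))).
    apply/funext => v; transitivity (psi g v * expR (s ^+ 2 / 2 * v ^+ 2)); last by [].
    by rewrite /F; congr (_ * expR _); ring.
  have dpsi := psi' g u.
  apply: is_derive_eq; rewrite !fctE /=.
  pose e := expR (s ^+ 2 / 2 * u ^+ 2).
  rewrite [LHS](_ : _ = psi g u * (e * (s ^+ 2 / 2 * (2 * u ^+ 1 * 1))) +
    e * - (s ^+ 2 * u * psi g u)); last by [].
  by field.
have := is_derive_0_is_cst t 0 dF; rewrite /F.
rewrite expr0n /= !mul0r expR0 mulr1 => e.
rewrite -[LHS]/(psi g t) -[LHS](mulfK (x := expR (t ^+ 2 * s ^+ 2 / 2))); last first.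
  by rewrite gt_eqF// expR_gt0.
rewrite e expRN; congr (_ * _).
rewrite /psi; under eq_Rintegral do rewrite mul0r add0r.
by rewrite RintegralZl// Rintegral_normal_pdf mulr1.
Qed.
End normal_moments.

(** * Gaussian random variables *)

Section law.
Context disp (Omega : measurableType disp) (R : realType) (P : probability Omega R).
Notation lambda := (@lebesgue_measure R).

Lemma integrable_distribution d' (T' : measurableType d') (X : {mfun Omega >-> T'})
    (g : T' -> R) :
  measurable_fun setT g -> (distribution P X).-integrable setT (EFin \o g) ->
  P.-integrable setT (EFin \o (g \o X)) /\
  \int[P]_w g (X w) = \int[distribution P X]_x g x.
Proof.
move=> mg ig.
have mX : measurable_fun setT X by exact: measurable_funP.
have igX : P.-integrable setT (EFin \o (g \o X)).
  apply/integrableP; split; first by apply/measurable_EFinP; exact: measurableT_comp.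
  have /integrableP[_] := ig.
  rewrite (@ge0_integral_distribution _ _ _ _ _ P X (fun x => `|(g x)%:E|)%E)//.
  by apply/measurableT_comp => //; exact/measurable_EFinP.
split => //; rewrite /Rintegral; congr fine.
by rewrite (@integral_distribution _ _ _ _ _ P X (EFin \o g))//; exact/measurable_EFinP.
Qed.

(** The second moment and the cosine integrals are all that is used of the Gaussian
distribution from here on. The degenerate laws are treated separately, as they have no
density. *)
Lemma gaussian_rv_cos (X : {mfun Omega >-> R}) : gaussian_rv P X ->
  P.-integrable setT (fun w => (X w ^+ 2)%:E) /\
  let m := \int[P]_w X w in let v := \int[P]_w ((X w - m) ^+ 2) in
  forall g, \int[P]_w cos (X w + g) = cos (m + g) * expR (- (v / 2)).
Proof.
move=> [m [s XE]].
have mcos g : measurable_fun setT (fun x : R => cos (x + g)).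
  apply: continuous_measurable_fun => x; apply: continuous_comp.
    by apply: cvgD; [exact: cvg_id|exact: cvg_cst].
  exact: continuous_cos.
have msub (c : R) : measurable_fun setT (fun x : R => x - c) by exact: measurable_funB.
have [s0|s_neq0] := eqVneq s 0.
  have law (g : R -> R) : measurable_fun setT g ->
    P.-integrable setT (EFin \o (g \o X)) /\ \int[P]_w g (X w) = g m.
    move=> mg.
    have nuE (A : set R) : measurable A -> distribution P X A = \d_m A.
      by move=> mA; have := XE A mA; rewrite /gaussian_law s0 eqxx.
    have iE (h : R -> \bar R) : measurable_fun setT h ->
        (\int[distribution P X]_x h x = h m)%E.
      move=> mh; transitivity (\int[\d_m]_x h x)%E.
        by apply: eq_measure_integral => A mA _; exact: nuE.
      by rewrite integral_dirac// diracT mul1e.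
    have ig : (distribution P X).-integrable setT (EFin \o g).
      apply/integrableP; split; first exact/measurable_EFinP.
      by rewrite iE ?ltry//; apply/measurableT_comp => //; exact/measurable_EFinP.
    have [? ->] := integrable_distribution mg ig; split => //.
    by rewrite /Rintegral iE//; exact/measurable_EFinP.
  have [iX2 _] := law (fun x => x ^+ 2) (measurable_funX _ (@measurable_id _ R setT)).
  split => //=.
  have [_ ->] := law idfun (@measurable_id _ R setT).
  have [_ ->] := law (fun x => (x - m) ^+ 2) (measurable_funX _ (msub m)).
  move=> g; have [_ ->] := law _ (mcos g).
  by rewrite subrr expr0n /= mul0r oppr0 expR0 mulr1.
(* the Lebesgue measure lives on [measurableTypeR R], hence the change of codomain *)
have mX : measurable_fun setT (X : Omega -> measurableTypeR R).
  exact: (@measurable_funP _ _ _ _ setT X).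
pose X' : {mfun Omega >-> measurableTypeR R} :=
  @mfun_Sub _ _ Omega (measurableTypeR R) X (mem_set mX).
have nuE (A : set R) : measurable A -> distribution P X' A =
    (\int[lambda]_(x in A) (normal_pdf m s x)%:E)%E.
  by move=> mA; have := XE A mA; rewrite /gaussian_law (negbTE s_neq0).
have law (g : R -> R) : measurable_fun setT g ->
    lambda.-integrable setT (EFin \o (g \* normal_pdf m s)) ->
    P.-integrable setT (EFin \o (g \o X)) /\
    \int[P]_w g (X w) = \int[lambda]_x (g x * normal_pdf m s x).
  move=> mg ig.
  have ig' := @integrable_density _ (measurableTypeR R) R (distribution P X') lambda _
    (normal_pdf_ge0 m s) (integrable_normal_pdf m s) nuE _ mg ig.
  have [? H] := @integrable_distribution _ (measurableTypeR R) X' _ mg ig'; split => //.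
  rewrite H /Rintegral (@integral_density _ (measurableTypeR R) R (distribution P X') lambda _
    (normal_pdf_ge0 m s) (integrable_normal_pdf m s) nuE _ mg ig)//.
have [i1 e1] := law _ (msub m) (integrable_normal_id m s_neq0).
have [i2 e2] := law _ (measurable_funX _ (msub m)) (integrable_normal_sqr m s_neq0).
rewrite normal_mean// in e1; rewrite normal_variance// in e2.
have iX : P.-integrable setT (EFin \o X).
  have -> : EFin \o X = (EFin \o ((fun x => x - m) \o X)) \+ (EFin \o cst m).
    by apply/funext => w; rewrite /= -EFinD subrK.
  apply: integrableD => //.
  exact: finite_measure_integrable_cst.
have EX : \int[P]_w X w = m.
  move: e1; rewrite RintegralB//; last exact: finite_measure_integrable_cst.
  rewrite Rintegral_cst// [X in fine X](_ : _ = 1%E); last exact: probability_setT.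
  by rewrite mulr1 => /eqP; rewrite subr_eq0 => /eqP.
split.
  have : P.-integrable setT (EFin \o (fun w => 2 * (X w - m) ^+ 2 + 2 * m ^+ 2)).
    under [X in _.-integrable _ X]eq_fun do rewrite /= EFinD EFinM.
    apply: integrableD => //; first exact: integrableZl.
    exact: finite_measure_integrable_cst.
  apply: le_integrable => //.
    apply/measurable_EFinP; apply: measurable_funX; exact: measurable_funP.
  move=> w _; rewrite lee_fin !ger0_norm ?sqr_ge0//.
    have := sqr_ge0 (X w - 2 * m); nra.
  by rewrite addr_ge0// mulr_ge0 ?sqr_ge0.
rewrite /= EX e2 => g.
have cE x : cos (x + g) = cos (1 * (x - m) + (m + g)) by congr cos; ring.
have ic : lambda.-integrable setT (EFin \o ((fun x => cos (x + g)) \* normal_pdf m s)).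
  apply: (le_integrable measurableT _ _ (integrable_normal_pdf m s)).
  - apply/measurable_EFinP; apply: measurable_funM => //.
      exact: mcos.
    exact: measurable_normal_pdf.
  - move=> x _; rewrite lee_fin normrM ler_piMl//.
    by rewrite ler_norml cos_geN1 cos_le1.
have [_ ->] := law _ (mcos g) ic.
under eq_Rintegral do rewrite cE.
by rewrite normal_cos// expr1n mul1r.
Qed.
End law.

(** * Means and covariances of linear combinations of the field *)

Section bounded_integrals.
Context disp (Omega : measurableType disp) (R : realType) (P : probability Omega R).

Lemma bounded_integrable (g : Omega -> R) (C : R) :
  measurable_fun setT g -> (forall w, `|g w| <= C) ->
  P.-integrable setT (EFin \o g).
Proof.
move=> mg gC.
apply: (le_integrable measurableT _ _
  (finite_measure_integrable_cst P C measurableT)).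
  exact/measurable_EFinP.
by move=> w _; rewrite lee_fin (le_trans (gC w))// ler_norm.
Qed.

Lemma Rintegral_prob_cst (c : R) : \int[P]_w (cst c) w = c.
Proof.
by rewrite Rintegral_cst// [X in fine X](_ : _ = 1%E) ?mulr1//; exact: probability_setT.
Qed.

Lemma Rintegral_le_bound (g : Omega -> R) (C : R) :
  measurable_fun setT g -> (forall w, `|g w| <= C) -> `|\int[P]_w g w| <= C.
Proof.
move=> mg gC; have ig := bounded_integrable mg gC.
rewrite (le_trans (le_normr_Rintegral measurableT ig))//.
rewrite -[leRHS](Rintegral_prob_cst C).
apply: le_Rintegral => //.
  by have := integrable_norm ig; apply: eq_integrable.
exact: finite_measure_integrable_cst.
Qed.

Lemma integrable_Rsum (I : Type) (s : seq I) (h : I -> Omega -> R) :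
  (forall i, P.-integrable setT (EFin \o h i)) ->
  P.-integrable setT (EFin \o (fun w => \sum_(i <- s) h i w)).
Proof.
move=> ih; have := integrable_sum measurableT s (P := predT) (fun i _ => ih i).
by apply: eq_integrable => // w _; rewrite /= -sumEFin.
Qed.

Lemma Rintegral_sum (I : Type) (s : seq I) (h : I -> Omega -> R) :
  (forall i, P.-integrable setT (EFin \o h i)) ->
  \int[P]_w (\sum_(i <- s) h i w) = \sum_(i <- s) \int[P]_w h i w.
Proof.
move=> ih; elim: s => [|i s IH].
  under eq_Rintegral do rewrite big_nil.
  by rewrite big_nil (Rintegral_prob_cst 0).
rewrite big_cons -IH -RintegralD//; last exact: integrable_Rsum.
by apply: eq_Rintegral => w _; rewrite big_cons.
Qed.
End bounded_integrals.

Section gaussian_pair.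
Context disp (Omega : measurableType disp) (R : realType) (P : probability Omega R).
Variables (X : Type) (f : X -> {RV P >-> R}) (f_gaussian : gaussian_field f).

Definition rmean (g : Omega -> R) : R := \int[P]_w g w.
Definition rcov (g h : Omega -> R) : R :=
  \int[P]_w ((g w - rmean g) * (h w - rmean h)).
Definition square_integrable (g : Omega -> R) :=
  measurable_fun setT g /\ P.-integrable setT (fun w => (g w ^+ 2)%:E).

Lemma square_integrableM g h : square_integrable g -> square_integrable h ->
  P.-integrable setT (EFin \o (fun w => g w * h w)).
Proof.
move=> [mg ig] [mh ih].
apply: (le_integrable measurableT _ _ (integrableD measurableT ig ih)).
  by apply/measurable_EFinP; exact: measurable_funM.
move=> w _; rewrite -EFinD lee_fin [leRHS]ger0_norm ?addr_ge0 ?sqr_ge0//.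
have := sqr_ge0 (g w - h w); have := sqr_ge0 (g w + h w).
have := sqr_ge0 (g w); have := sqr_ge0 (h w).
by move=> *; rewrite ler_norml; apply/andP; split; nra.
Qed.

Lemma square_integrable_cst c : square_integrable (cst c).
Proof.
split; first exact: measurable_cst.
exact: (finite_measure_integrable_cst P (c ^+ 2) measurableT).
Qed.

Lemma square_integrable1 g : square_integrable g -> P.-integrable setT (EFin \o g).
Proof.
move=> ig; have := square_integrableM ig (square_integrable_cst 1).
by apply: eq_integrable => // w _ /=; rewrite mulr1.
Qed.

Lemma square_integrableD g h : square_integrable g -> square_integrable h ->
  square_integrable (fun w => g w + h w).
Proof.
move=> sg sh; have [mg ig] := sg; have [mh ih] := sh.
split; first exact: measurable_funD.
have gh := integrableZl measurableT 2 (square_integrableM sg sh).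
have := integrableD measurableT (integrableD measurableT ig gh) ih.
by apply: eq_integrable => // w _; rewrite /= -EFinM -!EFinD; congr (_%:E); ring.
Qed.

Lemma square_integrableZ c g : square_integrable g ->
  square_integrable (fun w => c * g w).
Proof.
move=> [mg ig]; split; first exact: measurable_funM.
have := integrableZl measurableT (c ^+ 2) ig.
by apply: eq_integrable => // w _; rewrite /= -EFinM -exprMn.
Qed.

Lemma square_integrable_center g : square_integrable g ->
  square_integrable (fun w => g w - rmean g).
Proof. by move=> sg; exact: square_integrableD sg (square_integrable_cst _). Qed.

Lemma square_integrable_sum (I : Type) (s : seq I) (a : I -> R) (g : I -> Omega -> R) :
  (forall i, square_integrable (g i)) ->
  square_integrable (fun w => \sum_(i <- s) a i * g i w).
Proof.
move=> sg; elim: s => [|i s IH].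
  by under [X in square_integrable X]eq_fun do rewrite big_nil;
    exact: square_integrable_cst.
under [X in square_integrable X]eq_fun do rewrite big_cons.
by apply: square_integrableD => //; exact: square_integrableZ.
Qed.

Lemma square_integrable_field x : square_integrable (f x).
Proof.
split; first exact: measurable_funP.
have fx : gaussian_rv P (f x).
  have := @f_gaussian 1%N (fun=> x) (fun=> 1).
  by under [X in gaussian_rv _ X]eq_fun do rewrite big_ord1 mul1r.
exact: (gaussian_rv_cos fx).1.
Qed.

Definition lin (n : nat) (x : 'I_n -> X) (a : 'I_n -> R) (w : Omega) : R :=
  \sum_(i < n) a i * f (x i) w.

Lemma square_integrable_lin n (x : 'I_n -> X) a : square_integrable (lin x a).
Proof. by apply: square_integrable_sum => i; exact: square_integrable_field. Qed.

Lemma rmeanD g h : square_integrable g -> square_integrable h ->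
  rmean (fun w => g w + h w) = rmean g + rmean h.
Proof.
by move=> sg sh; rewrite /rmean RintegralD//; exact: square_integrable1.
Qed.

Lemma rmeanZ c g : square_integrable g -> rmean (fun w => c * g w) = c * rmean g.
Proof. by move=> sg; rewrite /rmean RintegralZl//; exact: square_integrable1. Qed.

Lemma rmean_lin n (x : 'I_n -> X) a :
  rmean (lin x a) = \sum_(i < n) a i * rmean (f (x i)).
Proof.
rewrite /rmean /lin Rintegral_sum.
  by apply: eq_bigr => i _; rewrite -RintegralZl//;
    exact/square_integrable1/square_integrable_field.
move=> i; apply: (square_integrable1 (g := fun w => a i * f (x i) w)).
by apply: square_integrableZ; exact: square_integrable_field.
Qed.

Lemma rcov_lin n (x : 'I_n -> X) a m (y : 'I_m -> X) b :
  rcov (lin x a) (lin y b) =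
  \sum_(i < n) \sum_(j < m) a i * b j * rcov (f (x i)) (f (y j)).
Proof.
rewrite /rcov !rmean_lin.
have sf z := square_integrable_center (square_integrable_field z).
transitivity (\int[P]_w (\sum_(i < n) \sum_(j < m)
   a i * b j * ((f (x i) w - rmean (f (x i))) * (f (y j) w - rmean (f (y j)))))).
  apply: eq_Rintegral => w _; rewrite /lin -!sumrB mulr_suml.
  apply: eq_bigr => i _; rewrite mulr_sumr; apply: eq_bigr => j _; ring.
have iK i j : P.-integrable setT (EFin \o (fun w => a i * b j *
    ((f (x i) w - rmean (f (x i))) * (f (y j) w - rmean (f (y j)))))).
  have := integrableZl measurableT (a i * b j) (square_integrableM (sf (x i)) (sf (y j))).
  exact: eq_integrable.
rewrite Rintegral_sum; last by move=> i; apply: integrable_Rsum.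
apply: eq_bigr => i _; rewrite Rintegral_sum//.
apply: eq_bigr => j _; rewrite RintegralZl//.
exact: square_integrableM.
Qed.

(** The joint law of two finite families is accessible only through the field indexed
by their concatenation. *)
Lemma gaussian_lin2 n (x : 'I_n -> X) a m (y : 'I_m -> X) b :
  gaussian_rv P (fun w => lin x a w + lin y b w).
Proof.
have := @f_gaussian (n + m)%N
  (fun i => match fintype.split i with inl i => x i | inr j => y j end)
  (fun i => match fintype.split i with inl i => a i | inr j => b j end).
under [X in gaussian_rv _ X]eq_fun => w.
  rewrite big_split_ord /=.
  under eq_bigr => i _ do rewrite (unsplitK (inl i)).
  under [X in _ + X]eq_bigr => i _ do rewrite (unsplitK (inr i)).
  over.
exact.
Qed.

Lemma Rintegral_cos_lin2 n (x : 'I_n -> X) a m (y : 'I_m -> X) b g :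
  \int[P]_w cos (lin x a w + lin y b w + g) =
  cos (rmean (lin x a) + rmean (lin y b) + g) *
  expR (- ((rcov (lin x a) (lin x a) + 2 * rcov (lin x a) (lin y b) +
      rcov (lin y b) (lin y b)) / 2)).
Proof.
have su := square_integrable_lin x a; have sv := square_integrable_lin y b.
have [mS _] := square_integrableD su sv.
pose S : {mfun Omega >-> R} := mfun_Sub (mem_set mS).
have [_ /(_ g)] := @gaussian_rv_cos _ _ _ P S (gaussian_lin2 x a y b).
have e : \int[P]_w (lin x a w + lin y b w) = rmean (lin x a) + rmean (lin y b).
  exact: rmeanD.
rewrite /= !e.
move=> ->; congr (_ * expR (- (_ / 2))).
have cu := square_integrable_center su; have cv := square_integrable_center sv.
have iuu := square_integrableM cu cu; have iuv := square_integrableM cu cv.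
have ivv := square_integrableM cv cv.
transitivity (\int[P]_w (((lin x a w - rmean (lin x a)) * (lin x a w - rmean (lin x a)) +
    2 * ((lin x a w - rmean (lin x a)) * (lin y b w - rmean (lin y b)))) +
    (lin y b w - rmean (lin y b)) * (lin y b w - rmean (lin y b)))).
  by apply: eq_Rintegral => w _ /=; ring.
have i2 := integrableZl measurableT 2 iuv.
rewrite RintegralD//; last first.
  have := integrableD measurableT iuu i2; exact: eq_integrable.
by rewrite RintegralD// RintegralZl.
Qed.
End gaussian_pair.

(** * Gaussian interpolation *)

Section interpolation.
Context disp (Omega : measurableType disp) (R : realType) (P : probability Omega R).
Variables (X : Type) (f : X -> {RV P >-> R}) (f_gaussian : gaussian_field f).

Lemma linZ n (x : 'I_n -> X) a c w :
  lin f x (fun i => c * a i) w = c * lin f x a w.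
Proof. by rewrite /lin mulr_sumr; apply: eq_bigr => i _; rewrite mulrA. Qed.

Lemma rmean_linZ n (x : 'I_n -> X) a c :
  rmean P (lin f x (fun i => c * a i)) = c * rmean P (lin f x a).
Proof.
rewrite !rmean_lin// mulr_sumr; apply: eq_bigr => i _; ring.
Qed.

Lemma rcovC (g h : Omega -> R) : rcov P g h = rcov P h g.
Proof. by apply: eq_Rintegral => w _; rewrite mulrC. Qed.

Lemma rcov_linZr n (x : 'I_n -> X) a m (y : 'I_m -> X) b c :
  rcov P (lin f x a) (lin f y (fun i => c * b i)) = c * rcov P (lin f x a) (lin f y b).
Proof.
rewrite !rcov_lin// mulr_sumr; apply: eq_bigr => i _; rewrite mulr_sumr.
by apply: eq_bigr => j _; ring.
Qed.

Lemma rcov_linZZ n (x : 'I_n -> X) a c :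
  rcov P (lin f x (fun i => c * a i)) (lin f x (fun i => c * a i)) =
  c ^+ 2 * rcov P (lin f x a) (lin f x a).
Proof. by rewrite rcov_linZr rcovC rcov_linZr; ring. Qed.

Lemma Rintegral_cos_lin n (x : 'I_n -> X) a g :
  \int[P]_w cos (lin f x a w + g) =
  cos (rmean P (lin f x a) + g) * expR (- (rcov P (lin f x a) (lin f x a) / 2)).
Proof.
have := Rintegral_cos_lin2 f_gaussian x (fun i => 2^-1 * a i) x (fun i => 2^-1 * a i) g.
rewrite rmean_linZ rcov_linZZ.
have E w : lin f x (fun i => 2^-1 * a i) w + lin f x (fun i => 2^-1 * a i) w + g =
  lin f x a w + g by rewrite linZ; lra.
under eq_Rintegral => w _ do rewrite E.
move=> ->; congr (cos _ * expR _); lra.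
Qed.

Lemma measurable_cos_lin n (x : 'I_n -> X) a g :
  measurable_fun setT (fun w => cos (lin f x a w + g)).
Proof.
apply: (measurableT_comp (f := @cos R)) => //.
  by apply: continuous_measurable_fun; exact: continuous_cos.
by apply: measurable_funD => //; case: (square_integrable_lin f_gaussian x a).
Qed.

Section pair.
Variables (n m : nat) (x : 'I_n -> X) (y : 'I_m -> X).
Implicit Types (t : R) (a : 'I_n -> R) (b : 'I_m -> R).

(** The second sample point [w'] provides the independent copy. The last term
keeps the mean of the coordinate equal to that of [f (y j)], as the field is not centred;
the square root keeps its variance. At [t = 1] it is [f (y j) w], and at [t = 0] it is
[f (y j) w']. *)
Definition interp t (j : 'I_m) (w w' : Omega) : R :=
  t * f (y j) w + Num.sqrt (1 - t ^+ 2) * f (y j) w' +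
  (1 - t - Num.sqrt (1 - t ^+ 2)) * rmean P (f (y j)).

Definition interp_cos t a al b be : R :=
  \int[P]_w (cos (lin f x a w + al) *
    \int[P]_w' cos (\sum_(j < m) b j * interp t j w w' + be)).

(** The closed form of [interp_cos], in which the dependence on [t] is explicit and
smooth also at the end points, where the square root in [interp] is singular. *)
Definition interp_cos_val t a al b be : R :=
  let A := rmean P (lin f x a) + al in let B := rmean P (lin f y b) + be in
  let K := rcov P (lin f x a) (lin f y b) in
  2^-1 * expR (- ((rcov P (lin f x a) (lin f x a) + rcov P (lin f y b) (lin f y b)) / 2)) *
  (cos (A + B) * expR (- (t * K)) + cos (A - B) * expR (t * K)).

(** Integrating over the copy first replaces it by its mean, at the cost of a Gaussian
factor. *)
Lemma interp_inner t b be w : 0 <= t <= 1 ->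
  \int[P]_w' cos (\sum_(j < m) b j * interp t j w w' + be) =
  cos (t * lin f y b w + (1 - t) * rmean P (lin f y b) + be) *
  expR (- ((1 - t ^+ 2) * rcov P (lin f y b) (lin f y b) / 2)).
Proof.
move=> /andP[t0 t1]; set s := Num.sqrt (1 - t ^+ 2).
have s2 : s ^+ 2 = 1 - t ^+ 2 by rewrite sqr_sqrtr// subr_ge0 expr_le1.
have E w' : \sum_(j < m) b j * interp t j w w' + be =
    lin f y (fun j => s * b j) w' +
    (t * lin f y b w + (1 - t - s) * rmean P (lin f y b) + be).
  rewrite linZ rmean_lin// /lin !mulr_sumr addrA; congr (_ + _).
  by rewrite -!big_split /=; apply: eq_bigr => j _; rewrite /interp -/s; ring.
under eq_Rintegral => w' _ do rewrite E.
rewrite Rintegral_cos_lin rmean_linZ rcov_linZZ s2.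
by congr (cos _ * expR _); ring.
Qed.

(** Only the covariance between the two families depends on [t]: the variance of
[t * Y] and the exponent of the Gaussian factor of the copy add up to a constant. *)
Lemma interp_cosE t a al b be : 0 <= t <= 1 ->
  interp_cos t a al b be = interp_cos_val t a al b be.
Proof.
move=> t01; rewrite /interp_cos.
under eq_Rintegral => w _ do rewrite (interp_inner _ _ _ t01).
set e := expR _; set ga := (1 - t) * rmean P (lin f y b) + be.
have E w : cos (lin f x a w + al) *
    (cos (t * lin f y b w + (1 - t) * rmean P (lin f y b) + be) * e) =
    e / 2 * (cos (lin f x a w + lin f y (fun j => t * b j) w + (al + ga)) +
     cos (lin f x a w + lin f y (fun j => (- t) * b j) w + (al - ga))).
  rewrite !linZ.
  set u := lin f x a w; set v := lin f y b w.
  rewrite (_ : u + t * v + (al + ga) = (u + al) + (t * v + ga)); last by ring.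
  rewrite (_ : u + - t * v + (al - ga) = (u + al) - (t * v + ga)); last by ring.
  rewrite (cosD (u + al)) (cosB (u + al)) -addrA -/ga.
  set c1 := cos (u + al); set c2 := cos (t * v + ga); by field.
under eq_Rintegral => w _ do rewrite E.
have icos c g : P.-integrable setT (EFin \o (fun w =>
    cos (lin f x a w + lin f y (fun j => c * b j) w + g))).
  apply: (@bounded_integrable _ _ _ _ _ 1).
    apply: (measurableT_comp (f := @cos R)) => //.
      by apply: continuous_measurable_fun; exact: continuous_cos.
    apply: measurable_funD => //; apply: measurable_funD.
      by case: (square_integrable_lin f_gaussian x a).
    by case: (square_integrable_lin f_gaussian y (fun j => c * b j)).
  by move=> w; rewrite ler_norml cos_geN1 cos_le1.
have H1 := icos t (al + ga); have H2 := icos (- t) (al - ga).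
rewrite RintegralZl//; last first.
  have := integrableD measurableT H1 H2; exact: eq_integrable.
rewrite RintegralD// !Rintegral_cos_lin2// !rmean_linZ !rcov_linZZ !rcov_linZr.
rewrite /interp_cos_val /e /ga.
set mX := rmean P (lin f x a); set mY := rmean P (lin f y b).
set KX := rcov P (lin f x a) (lin f x a).
set KY := rcov P (lin f y b) (lin f y b); set K := rcov P _ _.
rewrite (_ : mX + t * mY + (al + ((1 - t) * mY + be)) = mX + al + (mY + be)); last by ring.
rewrite (_ : mX + - t * mY + (al - ((1 - t) * mY + be)) = mX + al - (mY + be)); last by ring.
set c1 := cos (_ + _); set c2 := cos (_ - _).
have -> : expR (- ((KX + 2 * (t * K) + t ^+ 2 * KY) / 2)) =
    expR (- ((KX + KY) / 2)) * expR (- (t * K)) * expR ((1 - t ^+ 2) * KY / 2).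
  by rewrite -!expRD; congr expR; field.
have -> : expR (- ((KX + 2 * (- t * K) + (- t) ^+ 2 * KY) / 2)) =
    expR (- ((KX + KY) / 2)) * expR (t * K) * expR ((1 - t ^+ 2) * KY / 2).
  by rewrite -!expRD; congr expR; field.
have -> : expR (- ((1 - t ^+ 2) * KY / 2)) = (expR ((1 - t ^+ 2) * KY / 2))^-1.
  by rewrite expRN.
have := expR_gt0 ((1 - t ^+ 2) * KY / 2); set z := expR (_ / 2) => z0.
by field; rewrite gt_eqF.
Qed.

End pair.
End interpolation.

(** * Covariance inequality for trigonometric sums *)

Lemma is_derive_bigsum (R : realType) (I : Type) (s : seq I) (h : I -> R -> R)
    (dh : I -> R) (t : R) :
  (forall i, is_derive t (1 : R) (h i) (dh i)) ->
  is_derive t (1 : R) (fun u => \sum_(i <- s) h i u) (\sum_(i <- s) dh i).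
Proof.
move=> hd; elim: s => [|i s IH].
  rewrite big_nil; under [X in is_derive _ _ X]eq_fun do rewrite big_nil.
  exact: is_derive_cst.
rewrite big_cons; under [X in is_derive _ _ X]eq_fun do rewrite big_cons.
exact: is_deriveD.
Qed.

Section trig.
Variable R : realType.

Definition trig (n : nat) (I : finType) (c : I -> R) (a : I -> 'I_n -> R)
    (al : I -> R) (z : 'I_n -> R) : R :=
  \sum_k c k * cos (\sum_(i < n) a k i * z i + al k).

(** The partial derivative in direction [i], the sine being written as a shifted cosine
so that a derivative is again a trigonometric sum. *)
Definition dtrig (n : nat) (I : finType) (c : I -> R) (a : I -> 'I_n -> R)
    (al : I -> R) (i : 'I_n) (z : 'I_n -> R) : R :=
  \sum_k c k * a k i * cos (\sum_(j < n) a k j * z j + (al k + pi / 2)).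

End trig.

Section trig_cov.
Context disp (Omega : measurableType disp) (R : realType) (P : probability Omega R).
Variables (X : Type) (f : X -> {RV P >-> R}) (f_gaussian : gaussian_field f).
Variables (n m : nat) (x : 'I_n -> X) (y : 'I_m -> X).
Variables (I J : finType) (c : I -> R) (a : I -> 'I_n -> R) (al : I -> R).
Variables (e : J -> R) (b : J -> 'I_m -> R) (be : J -> R).
Variables (L M kappa : R).
Hypothesis kappa_ge0 : 0 <= kappa.
Hypothesis dL : forall z, \sum_(i < n) `|dtrig c a al i z| <= L.
Hypothesis dM : forall z, \sum_(i < m) `|dtrig e b be i z| <= M.
Hypothesis covk : forall i j, `|rcov P (f (x i)) (f (y j))| <= kappa.

Let K k l := rcov P (lin f x (a k)) (lin f y (b l)).
Let Jv t s k l := interp_cos_val f x y t (a k) (al k + s) (b l) (be l + s).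
(** The interpolation between the two sides of the covariance: [Psi 1] is the
expectation of the product and [Psi 0] the product of the expectations. *)
Let Psi t := \sum_k \sum_l c k * e l * Jv t 0 k l.
Let dPsi t := \sum_k \sum_l c k * e l * (K k l * Jv t (pi / 2) k l).

Let L_ge0 : 0 <= L.
Proof. by rewrite (le_trans _ (dL (fun=> 0)))// sumr_ge0. Qed.

(** The shift of both phases by [pi / 2] differentiates both cosines. *)
Let dJv k l t : is_derive t (1 : R) (fun t => Jv t 0 k l) (K k l * Jv t (pi / 2) k l).
Proof.
pose A := rmean P (lin f x (a k)) + al k; pose B := rmean P (lin f y (b l)) + be l.
pose g := 2^-1 * expR (- ((rcov P (lin f x (a k)) (lin f x (a k)) +
  rcov P (lin f y (b l)) (lin f y (b l))) / 2)).
have -> : Jv t (pi / 2) k l =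
    g * (- cos (A + B) * expR (- (t * K k l)) + cos (A - B) * expR (t * K k l)).
  rewrite /Jv /interp_cos_val -/(K k l) -/g; congr (g * (_ * _ + cos _ * _)).
    by rewrite -cosDpi; congr cos; rewrite /A /B; field.
  by rewrite /A /B; ring.
have -> : (fun t => Jv t 0 k l) =
    (fun t => g * (cos (A + B) * expR (- (t * K k l)) + cos (A - B) * expR (t * K k l))).
  by apply/funext => u; rewrite /Jv /interp_cos_val !addr0.
have -> : (fun t => g * (cos (A + B) * expR (- (t * K k l)) + cos (A - B) * expR (t * K k l))) =
  g \*: (cos (A + B) \*: (expR \o ((- K k l) \*: id)) +
         cos (A - B) \*: (expR \o ((K k l) \*: id))).
  apply/funext => u.
  transitivity (g * (cos (A + B) * expR (- K k l * u) + cos (A - B) * expR (K k l * u))); last by [].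
  by congr (_ * (_ * expR _ + _ * expR _)); ring.
apply: is_derive_eq.
rewrite [LHS](_ : _ = g * (cos (A + B) * (expR (- K k l * t) * (- K k l * 1)) +
   cos (A - B) * (expR (K k l * t) * (K k l * 1)))); last by [].
by rewrite (_ : - K k l * t = - (t * K k l)) ?(mulrC (K k l) t)//; ring.
Qed.

Let dPsiE t : is_derive t (1 : R) Psi (dPsi t).
Proof.
apply: is_derive_bigsum => k; apply: is_derive_bigsum => l.
have := dJv k l t; move=> H.
have -> : (fun u => c k * e l * Jv u 0 k l) = (c k * e l) \*: (fun u => Jv u 0 k l) by [].
exact: is_deriveZ.
Qed.

Let KE k l : K k l = \sum_(i < n) \sum_(j < m) a k i * b l j * rcov P (f (x i)) (f (y j)).
Proof. exact: rcov_lin. Qed.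

Let cosle (z : R) : `|cos z| <= 1. Proof. by rewrite ler_norml cos_geN1 cos_le1. Qed.

Let mcosU k g : measurable_fun setT (fun w => cos (lin f x (a k) w + g)).
Proof. exact: measurable_cos_lin. Qed.

Let mcosY t l g w :
  measurable_fun setT (fun w' => cos (\sum_(j < m) b l j * interp f y t j w w' + g)).
Proof.
apply: (measurableT_comp (f := @cos R)) => //.
  by apply: continuous_measurable_fun; exact: continuous_cos.
apply: measurable_funD => //; apply: measurable_sum => j.
apply: measurable_funM => //; apply: measurable_funD => //.
by apply: measurable_funD => //; apply: measurable_funM => //.
Qed.

(** [dPsi t] is the integral over [w] and [w'] of the sum over [i], [j] of the
covariance of [f (x i)] and [f (y j)], times the product of the partial derivatives of the
two trigonometric sums; bounding the covariances leaves the two l1 norms of the gradients. *)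
Let dPsi_le t : 0 <= t <= 1 -> `|dPsi t| <= kappa * L * M.
Proof.
move=> t01.
pose inner l w := \int[P]_w' cos (\sum_(j < m) b l j * interp f y t j w w' + (be l + pi / 2)).
have minner l : measurable_fun setT (inner l).
  have -> : inner l = (fun w => cos (lin f y (fun j => t * b l j) w +
      ((1 - t) * rmean P (lin f y (b l)) + (be l + pi / 2))) *
      expR (- ((1 - t ^+ 2) * rcov P (lin f y (b l)) (lin f y (b l)) / 2))).
    by apply/funext => w; rewrite /inner (interp_inner f_gaussian _ _ _ _ t01) linZ -addrA.
  by apply: measurable_funM => //; exact: measurable_cos_lin.
have inner_le l w : `|inner l w| <= 1.
  by apply: Rintegral_le_bound; [exact: mcosY|move=> w'; exact: cosle].
pose H w := \sum_k \sum_l c k * e l * K k l *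
  (cos (lin f x (a k) w + (al k + pi / 2)) * inner l w).
have mkl k l : measurable_fun setT (fun w => c k * e l * K k l *
  (cos (lin f x (a k) w + (al k + pi / 2)) * inner l w)).
  by apply: measurable_funM => //; apply: measurable_funM.
have ikl k l : P.-integrable setT (EFin \o (fun w => c k * e l * K k l *
  (cos (lin f x (a k) w + (al k + pi / 2)) * inner l w))).
  apply: (@bounded_integrable _ _ _ _ _ (`|c k * e l * K k l|)) => [|w].
    exact: mkl.
  by rewrite normrM ler_piMr// normrM mulr_ile1.
have -> : dPsi t = \int[P]_w H w.
  rewrite /H Rintegral_sum; last by move=> k; exact: integrable_Rsum.
  apply: eq_bigr => k _; rewrite Rintegral_sum//.
  apply: eq_bigr => l _; rewrite RintegralZl//; last first.
    apply: (@bounded_integrable _ _ _ _ _ 1); first exact: measurable_funM.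
    by move=> w; rewrite normrM mulr_ile1.
  by rewrite /Jv -(interp_cosE f_gaussian)// mulrA.
apply: Rintegral_le_bound => [|w].
  by apply: measurable_sum => k; exact: measurable_sum.
pose G w' := \sum_(i < n) \sum_(j < m) rcov P (f (x i)) (f (y j)) *
  (dtrig c a al i (fun i => f (x i) w) * dtrig e b be j (fun j => interp f y t j w w')).
have -> : H w = \int[P]_w' G w'.
  have GE w' : G w' = \sum_k \sum_l c k * e l * K k l *
     (cos (lin f x (a k) w + (al k + pi / 2)) *
      cos (\sum_(j < m) b l j * interp f y t j w w' + (be l + pi / 2))).
    rewrite /G /dtrig.
    under eq_bigr => i _.
      under eq_bigr => j _.
        rewrite mulr_suml mulr_sumr.
        under eq_bigr => k _ do rewrite mulr_sumr mulr_sumr.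
        over.
      rewrite exchange_big /=.
      under eq_bigr => k _ do rewrite exchange_big /=.
      over.
    rewrite exchange_big /=; apply: eq_bigr => k _.
    rewrite exchange_big /=; apply: eq_bigr => l _.
    rewrite KE mulr_sumr mulr_suml; apply: eq_bigr => i _.
    rewrite mulr_sumr mulr_suml; apply: eq_bigr => j _.
    by rewrite -[\sum_(j0 < n) _]/(lin f x (a k) w); ring.
  under [RHS]eq_Rintegral => w' _ do rewrite GE.
  have ii k l : P.-integrable setT (EFin \o (fun w' => c k * e l * K k l *
     (cos (lin f x (a k) w + (al k + pi / 2)) *
      cos (\sum_(j < m) b l j * interp f y t j w w' + (be l + pi / 2))))).
    apply: (@bounded_integrable _ _ _ _ _ (`|c k * e l * K k l|)).
      by apply: measurable_funM => //; apply: measurable_funM => //; exact: mcosY.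
    by move=> w'; rewrite normrM ler_piMr// normrM mulr_ile1.
  rewrite Rintegral_sum; last by move=> k; exact: integrable_Rsum.
  apply: eq_bigr => k _; rewrite Rintegral_sum//.
  apply: eq_bigr => l _; rewrite mulrA -RintegralZl//.
    by apply: eq_Rintegral => w' _; rewrite mulrA.
  by apply: (@bounded_integrable _ _ _ _ _ 1); [exact: mcosY|move=> w'; exact: cosle].
apply: Rintegral_le_bound.
  apply: measurable_sum => i; apply: measurable_sum => j.
  apply: measurable_funM => //; apply: measurable_funM => //.
  apply: measurable_sum => l; apply: measurable_funM => //; exact: mcosY.
move=> w'; rewrite /G.
rewrite (le_trans (ler_norm_sum _ _ _))//.
rewrite (@le_trans _ _ (\sum_(i < n) kappa * `|dtrig c a al i (fun i => f (x i) w)| * M))//.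
  apply: ler_sum => i _; rewrite (le_trans (ler_norm_sum _ _ _))//.
  set D := dtrig _ _ _ _ _.
  rewrite (@le_trans _ _ (\sum_(j < m) kappa * `|D| *
      `|dtrig e b be j (fun j => interp f y t j w w')|))//.
    by apply: ler_sum => j _; rewrite !normrM mulrA ler_wpM2r// ler_wpM2r.
  by rewrite -mulr_sumr ler_wpM2l// mulr_ge0.
by rewrite -mulr_suml -mulr_sumr ler_wpM2r// ?ler_wpM2l// (le_trans _ (dM (fun=> 0)))// sumr_ge0.
Qed.

Let p w := trig c a al (fun i => f (x i) w).
Let q w := trig e b be (fun j => f (y j) w).

Let iUV k l : P.-integrable setT (EFin \o (fun w =>
  cos (lin f x (a k) w + al k) * cos (lin f y (b l) w + be l))).
Proof.
apply: (@bounded_integrable _ _ _ _ _ 1).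
  by apply: measurable_funM => //; exact: measurable_cos_lin.
by move=> w; rewrite normrM mulr_ile1.
Qed.

Let Psi1 : Psi 1 = \int[P]_w (p w * q w).
Proof.
transitivity (\int[P]_w (\sum_k \sum_l c k * e l *
    (cos (lin f x (a k) w + al k) * cos (lin f y (b l) w + be l)))); last first.
  apply: eq_Rintegral => w _; rewrite /p /q /trig mulr_suml; apply: eq_bigr => k _.
  by rewrite mulr_sumr; apply: eq_bigr => l _; rewrite /lin; ring.
have ikl k l : P.-integrable setT (EFin \o (fun w => c k * e l *
    (cos (lin f x (a k) w + al k) * cos (lin f y (b l) w + be l)))).
  have := integrableZl measurableT (c k * e l) (iUV k l); exact: eq_integrable.
rewrite Rintegral_sum; last by move=> k; exact: integrable_Rsum.
apply: eq_bigr => k _; rewrite Rintegral_sum//.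
apply: eq_bigr => l _; rewrite RintegralZl//; congr (_ * _).
rewrite /Jv -(interp_cosE f_gaussian) ?lexx ?ler01//.
apply: eq_Rintegral => w _; rewrite !addr0; congr (_ * _).
under eq_Rintegral => w' _.
  under eq_bigr => j _ do rewrite /interp expr1n subrr sqrtr0 subr0 !mul0r mul1r !addr0.
  over.
exact: Rintegral_prob_cst.
Qed.

Let Psi0 : Psi 0 = \int[P]_w p w * \int[P]_w q w.
Proof.
have iU k : P.-integrable setT (EFin \o (fun w => cos (lin f x (a k) w + al k))).
  by apply: (@bounded_integrable _ _ _ _ _ 1).
have iV l : P.-integrable setT (EFin \o (fun w => cos (lin f y (b l) w + be l))).
  by apply: (@bounded_integrable _ _ _ _ _ 1) => //; exact: measurable_cos_lin.
have -> : \int[P]_w p w = \sum_k c k * \int[P]_w cos (lin f x (a k) w + al k).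
  rewrite /p /trig Rintegral_sum.
    by apply: eq_bigr => k _; rewrite RintegralZl//; exact: iU.
  by move=> k; have := integrableZl measurableT (c k) (iU k); exact: eq_integrable.
have -> : \int[P]_w q w = \sum_l e l * \int[P]_w cos (lin f y (b l) w + be l).
  rewrite /q /trig Rintegral_sum.
    by apply: eq_bigr => k _; rewrite RintegralZl//; exact: iV.
  by move=> k; have := integrableZl measurableT (e k) (iV k); exact: eq_integrable.
rewrite mulr_suml; apply: eq_bigr => k _; rewrite mulr_sumr; apply: eq_bigr => l _.
rewrite /Jv -(interp_cosE f_gaussian) ?lexx ?ler01//.
transitivity (c k * e l * \int[P]_w (cos (lin f x (a k) w + al k) *
   \int[P]_w' cos (lin f y (b l) w' + be l))).
  congr (_ * _); apply: eq_Rintegral => w _; rewrite !addr0; congr (_ * _).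
  apply: eq_Rintegral => w' _; congr (cos (_ + _)); apply: eq_bigr => j _.
  by rewrite /interp expr0n /= !subr0 sqrtr1 subrr !mul0r mul1r add0r addr0.
by rewrite RintegralZr//; ring.
Qed.

(** Mean value theorem for the interpolation. *)
Theorem trig_covariance :
  `|\int[P]_w (p w * q w) - \int[P]_w p w * \int[P]_w q w| <= kappa * L * M.
Proof.
rewrite -Psi1 -Psi0.
have cP : {within `[0, 1], continuous Psi}.
  apply: continuous_subspaceT => t.
  have d := dPsiE t.
  by apply/differentiable_continuous/derivable1_diffP; apply: ex_derive.
have [t t01 ->] := MVT ltr01 (fun t _ => dPsiE t) cP.
rewrite subr0 mulr1 dPsi_le//.
by move: t01; rewrite in_itv /= => /andP[? ?]; rewrite !ltW.
Qed.
End trig_cov.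

(** * The de la Vallee Poussin kernel on a grid *)

Section kernel.
Variable R : realType.
Implicit Types (N M : nat) (th : R).

Lemma cos_pow (y : R) (K : nat) :
  (2 * cos y) ^+ K = \sum_(j < K.+1) 'C(K, j)%:R * cos ((K%:R - 2 * j%:R) * y).
Proof.
elim: K => [|K IH].
  by rewrite expr0 big_ord1 bin0 mul1r mulr0 subr0 mul0r cos0.
rewrite exprS IH mulr_sumr.
pose g (j : nat) := cos ((K.+1%:R - 2 * j%:R) * y).
have E (j : nat) : 2 * cos y * ('C(K, j)%:R * cos ((K%:R - 2 * j%:R) * y)) =
    'C(K, j)%:R * g j + 'C(K, j)%:R * g j.+1.
  rewrite /g (_ : (K.+1%:R - 2 * j%:R) * y = (K%:R - 2 * j%:R) * y + y); last first.
    by rewrite -natr1; ring.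
  rewrite (_ : (K.+1%:R - 2 * j.+1%:R) * y = (K%:R - 2 * j%:R) * y - y); last first.
    by rewrite -!natr1; ring.
  by rewrite cosD cosB; ring.
under eq_bigr => j _ do rewrite E.
rewrite big_split /= [RHS]big_ord_recl /=.
under [X in _ = _ + X]eq_bigr => j _ do rewrite /bump leq0n add1n binS natrD mulrDl.
rewrite big_split /= addrA; congr (_ + _).
transitivity (\sum_(j < K.+2) 'C(K, j)%:R * g j).
  by rewrite [RHS]big_ord_recr /= bin_small// mul0r addr0.
by rewrite big_ord_recl /= !bin0.
Qed.

(** The kernel is nonnegative and is a cosine sum of degree [N]; it concentrates at 0 as
[N] grows. *)
Definition vp N th : R := ((1 + cos th) / 2) ^+ N.
(** The constant Fourier coefficient of [vp N]. *)
Definition vp0 N : R := 'C(2 * N, N)%:R / 4 ^+ N.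

Lemma vp_ge0 N th : 0 <= vp N th.
Proof. by rewrite exprn_ge0// divr_ge0// -lerBlDl sub0r cos_geN1. Qed.

Lemma vp0_gt0 N : 0 < vp0 N.
Proof. by rewrite divr_gt0 ?exprn_gt0// ltr0n bin_gt0 leq_pmull. Qed.

(** The half-angle formula turns the kernel into a power of a cosine. *)
Lemma vpE N th : vp N th =
  \sum_(j < (2 * N).+1) 'C(2 * N, j)%:R / 4 ^+ N * cos ((N%:R - j%:R) * th).
Proof.
have h : (1 + cos th) / 2 = cos (th / 2) ^+ 2.
  rewrite {1}(_ : th = th / 2 + th / 2); last by field.
  by rewrite cosD -!expr2 sin2cos2; field.
have -> : vp N th = (2 * cos (th / 2)) ^+ (2 * N) / 4 ^+ N.
  rewrite /vp h exprM (_ : (2 * cos (th / 2)) ^+ 2 = 4 * cos (th / 2) ^+ 2); last by ring.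
  by rewrite [(4 * _) ^+ N]exprMn mulrAC divff ?mul1r// expf_neq0.
rewrite cos_pow mulr_suml; apply: eq_bigr => j _; rewrite mulrAC; congr (_ * cos _).
by rewrite natrM; field.
Qed.

Lemma sum_vp_coef N : \sum_(j < (2 * N).+1) 'C(2 * N, j)%:R / 4 ^+ N = 1 :> R.
Proof.
have := vpE N 0; rewrite /vp cos0 -[1 + 1]/2 divff// expr1n => e; rewrite [RHS]e.
by apply: eq_bigr => j _; rewrite mulr0 cos0 mulr1.
Qed.

Definition node M (j : nat) : R := 2 * pi * j%:R / M%:R.

Lemma sin_sub2pi (x : R) (r : nat) : sin (x - 2 * pi * r%:R) = sin x.
Proof.
have e : 2 * pi * r%:R = (pi *+ 2) *+ r :> R.
  by rewrite -mulr_natr -[pi *+ 2]mulr_natr; ring.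
by rewrite -[in RHS](subrK (2 * pi * r%:R) x) [in RHS]e (periodicn (@sinD2pi R)) e.
Qed.

(** Multiplied by [2 * sin (om / 2)], the sum telescopes. *)
Lemma sum_cos_node M r (phi : R) : (0 < r < M)%N ->
  \sum_(j < M) cos (phi - r%:R * node M j) = 0.
Proof.
move=> /andP[r0 rM]; have M0 : (0 < M)%N by exact: leq_ltn_trans rM.
have MR : M%:R != 0 :> R by rewrite pnatr_eq0 -lt0n.
pose om : R := 2 * pi * r%:R / M%:R.
pose g (j : nat) : R := - sin (phi - om * j%:R + om / 2).
have s0 : sin (om / 2) != 0.
  rewrite gt_eqF// sin_gt0_pi//.
  have -> : om / 2 = pi * (r%:R / M%:R) by rewrite /om; field.
  rewrite mulr_gt0 ?pi_gt0 ?divr_gt0 ?ltr0n//=.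
  by rewrite gtr_pMr ?pi_gt0// ltr_pdivrMr ?ltr0n// mul1r ltr_nat.
apply: (mulfI (mulf_neq0 (_ : (2:R) != 0) s0)) => //.
rewrite mulr0 mulr_sumr.
transitivity (\sum_(0 <= j < M) (g j.+1 - g j)).
  rewrite big_mkord; apply: eq_bigr => j _; rewrite /g opprK.
  rewrite (_ : phi - om * j.+1%:R + om / 2 = (phi - om * j%:R) - om / 2); last first.
    by rewrite -natr1; field.
  rewrite (_ : phi - r%:R * node M j = phi - om * j%:R); last first.
    by rewrite /node /om; field.
  by set A := phi - _; rewrite (sinB A) (sinD A); ring.
rewrite telescope_sumr// /g mulr0 subr0 opprK.
rewrite (_ : phi - om * M%:R + om / 2 = phi + om / 2 - 2 * pi * r%:R).
  by rewrite sin_sub2pi addNr.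
by rewrite /om; field.
Qed.

(** A grid of more than [N] nodes integrates cosine sums of degree [N] exactly: only
the constant coefficient remains. *)
Lemma sum_vp_node N M th : (N < M)%N ->
  \sum_(j < M) vp N (th - node M j) = M%:R * vp0 N.
Proof.
move=> NM; under eq_bigr => j _ do rewrite vpE.
rewrite exchange_big /=.
have N2 : (N < (2 * N).+1)%N by rewrite ltnS leq_pmull.
rewrite (bigD1 (Ordinal N2))//= [X in _ + X]big1 ?addr0.
  under eq_bigr => j _ do rewrite subrr mul0r cos0 mulr1.
  by rewrite sumr_const card_ord -[LHS]mulr_natl.
move=> k kN; rewrite -mulr_sumr.
have kN' : (k : nat) != N by apply: contra kN => /eqP e; apply/eqP/val_inj.
have kle : (k <= 2 * N)%N by rewrite -ltnS.
have [lt|gt] : (k < N)%N \/ (N < k)%N.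
  by move: kN'; rewrite neq_ltn => /orP.
- rewrite (eq_bigr (fun j : 'I_M => cos ((N - k)%:R * th - (N - k)%:R * node M j))).
    by rewrite sum_cos_node ?mulr0// subn_gt0 lt (leq_ltn_trans (leq_subr _ _)).
  by move=> j _; congr cos; rewrite natrB ?(ltnW lt)//; ring.
- rewrite (eq_bigr (fun j : 'I_M => cos ((k - N)%:R * th - (k - N)%:R * node M j))).
    rewrite sum_cos_node ?mulr0// subn_gt0 gt (leq_ltn_trans _ NM)//.
    by rewrite leq_subLR addnn -mul2n.
  by move=> j _; rewrite -cosN; congr cos; rewrite natrB ?(ltnW gt)//; ring.
Qed.

(** The explicit ratio makes the second moment of the kernel exactly computable in
[sum_weight_cos]. *)
Lemma vp0S N : vp0 N.+1 = vp0 N * (1 - (2 * N.+1%:R)^-1).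
Proof.
have h1 : (N.+1%:R * 'C(2 * N.+1, N.+1)%:R = 2 * (2 * N%:R + 1) * 'C(2 * N, N)%:R :> R).
  have e : (2 * N.+1 = (2 * N).+2)%N by rewrite mulnS.
  have h : (N.+1 * 'C(2 * N.+1, N.+1) = 2 * ((2 * N).+1 * 'C(2 * N, N)))%N.
    rewrite mul_bin_diag e binS.
    have -> : 'C((2 * N).+1, N) = 'C((2 * N).+1, N.+1).
      rewrite -bin_sub; last by rewrite (leq_trans (leq_pmull N (isT : 0 < 2)%N)).
      by congr ('C(_, _)); rewrite subSn ?leq_pmull// mul2n -addnn addnK.
    by rewrite addnn -mul2n mulnCA.
  by rewrite -natrM h !natrM -[(2 * N).+1%:R]natr1 natrM; ring.
have n0 : N.+1%:R != 0 :> R by rewrite pnatr_eq0.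
rewrite /vp0; apply: (mulfI n0); rewrite mulrA h1 exprS -natr1.
have : N%:R + 1 != 0 :> R by rewrite natr1.
have : (4 : R) ^+ N != 0 by rewrite expf_neq0.
by move=> ? ?; field; apply/andP.
Qed.

(** For a given [th], the weights form a probability distribution on the nodes
([sum_weight]), concentrated near [th]. *)
Definition weight N M (j : nat) th : R := vp N (th - node M j) / (M%:R * vp0 N).

Lemma weight_ge0 N M j th : 0 <= weight N M j th.
Proof. by rewrite divr_ge0 ?vp_ge0// mulr_ge0// ltW// vp0_gt0. Qed.

Lemma sum_weight N M th : (N < M)%N -> \sum_(j < M) weight N M j th = 1.
Proof.
move=> NM; rewrite -mulr_suml sum_vp_node// divff// mulf_neq0//.
  by rewrite pnatr_eq0 -lt0n (leq_ltn_trans _ NM).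
by rewrite gt_eqF// vp0_gt0.
Qed.

(** [vp N * (1 - cos)] is twice the difference of [vp N] and [vp N.+1]. *)
Lemma sum_weight_cos N M th : (N.+1 < M)%N ->
  \sum_(j < M) weight N M j th * (1 - cos (th - node M j)) = N.+1%:R^-1.
Proof.
move=> NM.
have E j : weight N M j th * (1 - cos (th - node M j)) =
   2 * (vp N (th - node M j) - vp N.+1 (th - node M j)) / (M%:R * vp0 N).
  rewrite /weight /vp exprS mulrAC; congr (_ / _).
  by set z := _ ^+ N; set c := cos _; field.
under eq_bigr => j _ do rewrite E.
rewrite -mulr_suml -mulr_sumr sumrB !sum_vp_node//; last exact: ltnW.
rewrite vp0S.
have M0 : M%:R != 0 :> R by rewrite pnatr_eq0 -lt0n (leq_ltn_trans _ NM).
have v0 : vp0 N != 0 by rewrite gt_eqF// vp0_gt0.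
have n0 : N.+1%:R != 0 :> R by rewrite pnatr_eq0.
by rewrite -natr1 in n0 *; field; rewrite v0 M0 n0.
Qed.

(** By [|x| <= z / 2 + x ^+ 2 / (2 * z)] and the second moment of the weights; the free
parameter [z] replaces a Cauchy-Schwarz inequality. *)
Lemma sum_weight_sin N M th (z : R) : (N.+1 < M)%N -> 0 < z ->
  \sum_(j < M) weight N M j th * `|sin (node M j) - sin th| <=
  z / 2 + (z * N.+1%:R)^-1.
Proof.
move=> NM z0.
have h (j : nat) : `|sin (node M j) - sin th| <= z / 2 + (1 - cos (th - node M j)) / z.
  set a := node M j.
  have e : (sin a - sin th) ^+ 2 <= 2 * (1 - cos (th - a)).
    have := sqr_ge0 (cos a - cos th); rewrite cosB.
    have := cos2Dsin2 a; have := cos2Dsin2 th.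
    by move=> *; nra.
  rewrite -(ler_pM2l z0) mulrDr [z * (_ / z)]mulrC divfK ?gt_eqF//.
  have := sqr_ge0 (z - `|sin a - sin th|); rewrite sqrrB real_normK ?num_real//.
  by move=> *; lra.
rewrite (@le_trans _ _ (\sum_(j < M) (weight N M j th * (z / 2) +
   weight N M j th * (1 - cos (th - node M j)) / z)))//.
  by apply: ler_sum => j _; rewrite -mulrA -mulrDr ler_wpM2l// weight_ge0.
rewrite big_split /= -[X in X + _]mulr_suml -[X in _ + X]mulr_suml.
rewrite sum_weight ?(ltnW NM)// sum_weight_cos// mul1r.
by rewrite invfM [z^-1 * _]mulrC.
Qed.
End kernel.

(** * Sizes of trigonometric sums *)

Section taylor.
Variable R : realType.

Lemma sin_lip (u v : R) : `|sin (u + v) - sin u| <= `|v|.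
Proof.
pose g := sin \o (cst u + v \*: id).
have dg (t : R) : is_derive t (1 : R) g (cos (u + v * t) * v).
  apply: is_derive_eq.
  by rewrite [LHS](_ : _ = cos (u + v * t) * (0 + v * 1)) ?add0r ?mulr1.
have cg : {within `[0, 1], continuous g}.
  apply: continuous_subspaceT => t; have d := dg t.
  by apply/differentiable_continuous/derivable1_diffP; apply: ex_derive.
have [t _] := MVT ltr01 (fun t _ => dg t) cg.
rewrite subr0 mulr1.
rewrite (_ : g 1 - g 0 = sin (u + v) - sin u); last first.
  by rewrite -[g 1]/(sin (u + v * 1)) -[g 0]/(sin (u + v * 0)) mulr1 mulr0 addr0.
by move=> ->; rewrite normrM ler_piMl// ler_norml cos_geN1 cos_le1.
Qed.

Lemma cos_taylor1 (x y : R) : `|cos (x + y) - cos x + y * sin x| <= y ^+ 2.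
Proof.
pose g := (cos \o (cst x + y \*: id)) + (y * sin x) \*: id.
have dg (t : R) : is_derive t (1 : R) g (y * (sin x - sin (x + y * t))).
  apply: is_derive_eq.
  rewrite [LHS](_ : _ = - sin (x + y * t) * (0 + y * 1) + (y * sin x) * 1)//.
  ring.
have cg : {within `[0, 1], continuous g}.
  apply: continuous_subspaceT => t; have d := dg t.
  by apply/differentiable_continuous/derivable1_diffP; apply: ex_derive.
have [t] := MVT ltr01 (fun t _ => dg t) cg.
rewrite in_itv /= => /andP[t0 t1]; rewrite subr0 mulr1.
rewrite (_ : g 1 - g 0 = cos (x + y) - cos x + y * sin x); last first.
  rewrite -[g 1]/(cos (x + y * 1) + y * sin x * 1) -[g 0]/(cos (x + y * 0) + y * sin x * 0).
  by rewrite !mulr1 !mulr0 !addr0; ring.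
move=> ->; rewrite normrM distrC -[y ^+ 2]real_normK ?num_real// expr2 ler_wpM2l//.
by rewrite (le_trans (sin_lip _ _))// normrM ler_piMr// ger0_norm ?ltW.
Qed.

Lemma sin_taylor1 (y : R) : `|sin y - y| <= y ^+ 2.
Proof.
have := cos_taylor1 (- (pi / 2)) y.
by rewrite [- (pi / 2) + y]addrC cosBpihalf cosN cos_pihalf sinN sin_pihalf subr0 mulrN1.
Qed.
End taylor.

Section is_trig.
Variables (R : realType) (n : nat).
Implicit Types (A B : R) (p q : ('I_n -> R) -> R).

(** [A] bounds the coefficients and [B] the frequencies: these bounds control the
error in the first-order expansion [trig_taylor]. *)
Definition is_trig A B p := exists (I : finType) (c : I -> R) (a : I -> 'I_n -> R) (al : I -> R),
  [/\ p = trig c a al, \sum_k `|c k| <= A & forall k, \sum_(i < n) `|a k i| <= B].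

Lemma is_trig1 : is_trig 1 0 (fun=> 1).
Proof.
exists unit, (fun=> 1), (fun _ _ => 0), (fun=> 0); split.
- apply/funext => z; rewrite /trig (big_pred1 tt); last by case.
  by rewrite big1 ?addr0 ?cos0 ?mulr1// => i _; rewrite mul0r.
- by rewrite (big_pred1 tt) ?normr1//; case.
- by move=> _; rewrite big1// => i _; rewrite normr0.
Qed.

(** A product of two cosines is the half-sum of the cosines of the sum and of the
difference, encoded by the boolean index. *)
Lemma is_trigM A B A' B' p q : is_trig A B p -> is_trig A' B' q ->
  is_trig (A * A') (B + B') (fun z => p z * q z).
Proof.
move=> [I [c [a [al [-> cA aB]]]]] [J [d [b [be [-> dA bB]]]]].
pose sg (s : bool) : R := if s then 1 else -1.
have sgn s : `|sg s| = 1 by case: s; rewrite /sg ?normrN normr1.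
exists (I * J * bool)%type, (fun k => c k.1.1 * d k.1.2 / 2),
  (fun k i => a k.1.1 i + sg k.2 * b k.1.2 i), (fun k => al k.1.1 + sg k.2 * be k.1.2); split.
- apply/funext => z; rewrite /trig mulr_suml.
  transitivity (\sum_k \sum_l \sum_(s : bool) c k * d l / 2 *
     cos (\sum_(i < n) (a k i + sg s * b l i) * z i + (al k + sg s * be l))).
    apply: eq_bigr => k _; rewrite mulr_sumr; apply: eq_bigr => l _.
    rewrite big_bool /= /sg.
    set u := \sum_(i < n) a k i * z i + al k; set v := \sum_(i < n) b l i * z i + be l.
    have -> : \sum_(i < n) (a k i + 1 * b l i) * z i + (al k + 1 * be l) = u + v.
      rewrite /u /v addrACA -big_split /= mul1r; congr (_ + _).
      by apply: eq_bigr => i _; rewrite mul1r mulrDl.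
    have -> : \sum_(i < n) (a k i + -1 * b l i) * z i + (al k + -1 * be l) = u - v.
      rewrite /u /v opprD addrACA -sumrN -big_split /= mulN1r; congr (_ + _).
      by apply: eq_bigr => i _; rewrite mulN1r mulrDl mulNr.
    by rewrite (cosB u v) (cosD u v); field.
  by rewrite pair_big /= pair_big.
- have -> : \sum_(k : I * J * bool) `|c k.1.1 * d k.1.2 / 2| =
      \sum_k \sum_l \sum_(s : bool) `|c k * d l / 2|.
    by rewrite pair_big /= pair_big.
  apply: (@le_trans _ _ ((\sum_k `|c k|) * (\sum_l `|d l|))); last first.
    by rewrite ler_pM// sumr_ge0.
  rewrite mulr_suml; apply: ler_sum => k _; rewrite mulr_sumr; apply: ler_sum => l _.
  by rewrite big_bool /= !normrM (ger0_norm (_ : 0 <= 2^-1)) ?invr_ge0//; lra.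
- move=> [[k l] s] /=; apply: (@le_trans _ _ (\sum_(i < n) (`|a k i| + `|b l i|))).
    by apply: ler_sum => i _; rewrite (le_trans (ler_normD _ _))// normrM sgn mul1r.
  by rewrite big_split /= lerD.
Qed.

Lemma is_trig_prod A B (I : Type) (r : seq I) (p : I -> ('I_n -> R) -> R) :
  (forall i, is_trig A B (p i)) ->
  is_trig (A ^+ size r) ((size r)%:R * B) (fun z => \prod_(i <- r) p i z).
Proof.
move=> hp; elim: r => [|i r IH].
  by under eq_fun do rewrite big_nil; rewrite mul0r expr0; exact: is_trig1.
under eq_fun do rewrite big_cons.
rewrite /= exprS -natr1 mulrDl mul1r addrC.
exact: is_trigM.
Qed.

Lemma is_trig_sum A B (J : finType) (phi : J -> R) (p : J -> ('I_n -> R) -> R) :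
  (forall j, is_trig A B (p j)) -> (forall j, `|phi j| <= 1) ->
  is_trig (#|J|%:R * A) B (fun z => \sum_j phi j * p j z).
Proof.
move=> hp phi1.
have {}hp j : { I : finType & { x : (I -> R) * (I -> 'I_n -> R) * (I -> R) |
   [/\ p j = trig x.1.1 x.1.2 x.2, \sum_k `|x.1.1 k| <= A &
     forall k, \sum_(i < n) `|x.1.2 k i| <= B]}}.
  have /cid[I /cid[c /cid[a /cid[al H]]]] := hp j.
  by exists I, (c, a, al).
pose II j := projT1 (hp j); pose xx j := proj1_sig (projT2 (hp j)).
have Hx j := proj2_sig (projT2 (hp j)).
exists {j : J & II j}, (fun k => phi (tag k) * (xx (tag k)).1.1 (tagged k)),
  (fun k => (xx (tag k)).1.2 (tagged k)), (fun k => (xx (tag k)).2 (tagged k)); split.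
- apply/funext => z; rewrite /trig.
  transitivity (\sum_j \sum_(k : II j) phi j * (xx j).1.1 k *
     cos (\sum_(i < n) (xx j).1.2 k i * z i + (xx j).2 k)).
    apply: eq_bigr => j _; have [e _ _] := Hx j.
    rewrite (congr1 (fun h => h z) e : p j z = _) /trig mulr_sumr.
    by apply: eq_bigr => k _; rewrite mulrA.
  by rewrite sig_big_dep.
- have -> : \sum_(k : {j : J & II j}) `|phi (tag k) * (xx (tag k)).1.1 (tagged k)| =
      \sum_j \sum_(k : II j) `|phi j * (xx j).1.1 k|.
    by rewrite sig_big_dep.
  rewrite (@le_trans _ _ (\sum_(j : J) A))//; last by rewrite sumr_const mulr_natl.
  apply: ler_sum => j _; have [_ h _] := Hx j; apply: le_trans h.
  by apply: ler_sum => k _; rewrite normrM ler_piMl.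
- by move=> [j k] /=; have [_ _ h] := Hx j; exact: h.
Qed.

Lemma is_trig_weight (N M j : nat) (S : R) (i : 'I_n) : (0 < M)%N -> 0 < S ->
  is_trig (M%:R * vp0 R N)^-1 (N%:R / S) (fun z => weight N M j (z i / S)).
Proof.
move=> M0 S0; have D0 : 0 < M%:R * vp0 R N by rewrite mulr_gt0 ?vp0_gt0// ltr0n.
exists 'I_(2 * N).+1, (fun k : 'I_(2 * N).+1 => 'C(2 * N, k)%:R / 4 ^+ N / (M%:R * vp0 R N)),
  (fun (k : 'I_(2 * N).+1) i' => (i' == i)%:R * ((N%:R - k%:R) / S)),
  (fun k : 'I_(2 * N).+1 => - ((N%:R - k%:R) * node R M j)); split.
- apply/funext => z; rewrite /trig /weight vpE mulr_suml; apply: eq_bigr => k _.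
  rewrite mulrAC; congr (_ * cos _).
  rewrite (bigD1 i)//= eqxx mul1r big1 ?addr0; first by field; rewrite gt_eqF.
  by move=> i' /negbTE ->; rewrite !mul0r.
- rewrite (eq_bigr (fun k : 'I_(2 * N).+1 =>
     'C(2 * N, k)%:R / 4 ^+ N / (M%:R * vp0 R N))); last first.
    by move=> k _; rewrite ger0_norm// divr_ge0 ?(ltW D0)// divr_ge0// exprn_ge0.
  by rewrite -mulr_suml sum_vp_coef mul1r.
- move=> k; rewrite (bigD1 i)//= eqxx mul1r big1 ?addr0; last first.
    by move=> i' /negbTE ->; rewrite mul0r normr0.
  rewrite normrM [X in _ * X]ger0_norm ?invr_ge0 ?(ltW S0)// ler_pM2r ?invr_gt0//.
  have : (k%:R : R) <= 2 * N%:R by rewrite -natrM ler_nat -ltnS.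
  by have : 0 <= k%:R :> R by []; move=> *; rewrite ler_norml; apply/andP; split; lra.
Qed.
End is_trig.

(** * Trigonometric approximation of Lipschitz functions *)

Section approximation.
Variables (R : realType) (n : nat).
Implicit Types (Phi : ('I_n -> R) -> R) (z : 'I_n -> R).

Definition sup_lipschitz (L : R) Phi := forall u v (de : R), 0 <= de ->
  (forall i, `|u i - v i| <= de) -> `|Phi u - Phi v| <= L * de.

Section fixed_parameters.
Variables (N M : nat) (S L : R) (Phi : ('I_n -> R) -> R).
Hypotheses (NM : (N.+1 < M)%N) (S_gt0 : 0 < S) (L_ge0 : 0 <= L).
Hypotheses (Phi_lip : sup_lipschitz L Phi) (Phi_le1 : forall z, `|Phi z| <= 1).
Local Notation idx := {ffun 'I_n -> 'I_M}.

Definition grid_weight (u : idx) (th : 'I_n -> R) := \prod_(i < n) weight N M (u i) (th i).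
Local Notation W := grid_weight.
Definition grid_point (u : idx) (i : 'I_n) := S * sin (node R M (u i)).
Local Notation pt := grid_point.
(** The average of [Phi] over the grid points [S * sin node], weighted by the kernel
around the angles [z i / S]. It approximates [Phi (S * sin (z / S))], hence [Phi] near the
origin when [S] is large. The sine makes the argument of [Phi] periodic in the angles. *)
Definition smoothing z := \sum_(u : idx) Phi (pt u) * W u (fun i => z i / S).
Local Notation p := smoothing.

Let M0 : (0 < M)%N. Proof. exact: leq_ltn_trans NM. Qed.

Let W_ge0 u th : 0 <= W u th.
Proof. by apply: prodr_ge0 => i _; exact: weight_ge0. Qed.

Let sumW th : \sum_u W u th = 1.
Proof.
rewrite /grid_weight -(bigA_distr_bigA (fun i (j : 'I_M) => weight N M j (th i))) /=.
by rewrite big1// => i _; rewrite sum_weight// ltnW.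
Qed.

(** Sums against the product weights of a function of one coordinate reduce to
one-dimensional sums. *)
Let marginW th (i0 : 'I_n) (h : 'I_M -> R) :
  \sum_u W u th * h (u i0) = \sum_(j < M) weight N M j (th i0) * h j.
Proof.
pose F i (j : 'I_M) := weight N M j (th i) * (if i == i0 then h j else 1).
transitivity (\sum_(u : idx) \prod_(i < n) F i (u i)).
  apply: eq_bigr => u _; rewrite /F big_split /= /grid_weight; congr (_ * _).
  by rewrite (bigD1 i0)//= eqxx big1 ?mulr1// => i /negbTE ->.
rewrite -(bigA_distr_bigA F) (bigD1 i0)//= [X in _ * X]big1 ?mulr1.
  by apply: eq_bigr => j _; rewrite /F eqxx.
move=> i /negbTE ii0; rewrite /F ii0.
by under eq_bigr do rewrite mulr1; rewrite sum_weight// ltnW.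
Qed.

Lemma smooth_le1 z : `|p z| <= 1.
Proof.
rewrite -(sumW (fun i => z i / S)) (le_trans (ler_norm_sum _ _ _))//.
by apply: ler_sum => u _; rewrite normrM (ger0_norm (W_ge0 _ _)) ler_piMl.
Qed.

(** The [n] coordinates contribute additively, which is harmless: [N] is chosen after
[n]. *)
Lemma smooth_approx z (ze : R) : 0 < ze ->
  `|p z - Phi (fun i => S * sin (z i / S))| <=
  L * S * (n%:R * (ze / 2 + (ze * N.+1%:R)^-1)).
Proof.
move=> ze0; set th := fun i => z i / S.
rewrite (_ : Phi _ = \sum_u Phi (fun i => S * sin (z i / S)) * W u th); last first.
  by rewrite -mulr_sumr sumW mulr1.
rewrite -sumrB.
apply: (@le_trans _ _ (\sum_(u : idx) W u th * (L * (S * \sum_(i < n)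
     `|sin (node R M (u i)) - sin (th i)|)))).
  rewrite (le_trans (ler_norm_sum _ _ _))//; apply: ler_sum => u _.
  rewrite -mulrBl normrM (ger0_norm (W_ge0 _ _)) mulrC ler_wpM2l//.
  apply: Phi_lip => [|i]; first by rewrite mulr_ge0 ?(ltW S_gt0)// sumr_ge0.
  rewrite /grid_point -mulrBr normrM (ger0_norm (ltW S_gt0)) ler_wpM2l ?(ltW S_gt0)//.
  by rewrite (bigD1 i)//= lerDl sumr_ge0.
rewrite (eq_bigr (fun u => L * S * \sum_(i < n) W u th *
    `|sin (node R M (u i)) - sin (th i)|)); last first.
  by move=> u _; rewrite -mulr_sumr; ring.
rewrite -mulr_sumr ler_wpM2l ?mulr_ge0 ?(ltW S_gt0)// exchange_big /=.
apply: (@le_trans _ _ (\sum_(i < n) (ze / 2 + (ze * N.+1%:R)^-1))); last first.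
  by rewrite sumr_const card_ord mulr_natl.
apply: ler_sum => i _; rewrite (marginW _ _ (fun j => `|sin (node R M j) - sin (th i)|)).
exact: sum_weight_sin.
Qed.

Let node_modn k : node R M k = node R M (k %% M) + 2 * pi * (k %/ M)%:R.
Proof.
have MR : M%:R != 0 :> R by rewrite pnatr_eq0 -lt0n.
by rewrite /node {1}(divn_eq k M) natrD natrM; field.
Qed.

Let cos_add2pi (x : R) (r : nat) : cos (x + 2 * pi * r%:R) = cos x.
Proof.
have e : 2 * pi * r%:R = (pi *+ 2) *+ r :> R.
  by rewrite -mulr_natr -[pi *+ 2]mulr_natr; ring.
by rewrite e (periodicn (@cosD2pi R)).
Qed.

Let h := 2 * pi / M%:R : R.

Let shiftn (s : bool) (j : nat) := if s then j.+1 else (j + M).-1.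
Definition sign_of (s : bool) : R := if s then 1 else -1.
Local Notation sg := sign_of.

Let node_shiftn s j : exists r : nat, node R M (shiftn s j) = node R M j + sg s * h + 2 * pi * r%:R.
Proof.
have MR : M%:R != 0 :> R by rewrite pnatr_eq0 -lt0n.
case: s; rewrite /shiftn /sign_of.
  by exists 0%N; rewrite /node /h -natr1; field.
exists 1%N; rewrite /node /h.
have -> : (j + M).-1%:R = j%:R + M%:R - 1 :> R.
  by rewrite -subn1 natrB ?natrD// (leq_trans M0)// leq_addl.
by field.
Qed.

(** Translating the angles by one step of the grid permutes the grid points, each
coordinate moving forward or backward according to [s]. *)
Let shift (s : 'I_n -> bool) (u : idx) : idx :=
  [ffun i => if s i then ordS (u i) else ord_pred (u i)].

Let shift_inj s : injective (shift s).
Proof.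
move=> u v /ffunP e; apply/ffunP => i; have := e i; rewrite !ffunE.
by case: (s i) => [/ordS_inj|/ord_pred_inj].
Qed.

Let shiftE s u i : shift s u i = (shiftn (s i) (u i) %% M)%N :> nat.
Proof. by rewrite ffunE /shiftn; case: (s i). Qed.

(** A translation of [z] by one grid step in the direction of the signs [s] is absorbed by
[shift s], which moves each coordinate of the grid points by at most the step. Hence the
Lipschitz constant of [Phi] is inherited with no loss for such translations. *)
Lemma smooth_lip z (s : 'I_n -> bool) :
  `|p (fun i => z i + S * h * sg (s i)) - p z| <= L * (S * h).
Proof.
have MR : M%:R != 0 :> R by rewrite pnatr_eq0 -lt0n.
set th := fun i => z i / S.
have h0 : 0 <= S * h by rewrite /h mulr_ge0 ?(ltW S_gt0)// divr_ge0// mulr_ge0// pi_ge0.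
have -> : p (fun i => z i + S * h * sg (s i)) =
    \sum_(u : idx) Phi (pt (shift s u)) * W u th.
  rewrite /smoothing (reindex_inj (@shift_inj s)); apply: eq_bigr => u _.
  congr (_ * _); apply: eq_bigr => i _; rewrite /weight; congr (_ / _).
  rewrite /vp shiftE; congr (((1 + _) / 2) ^+ _).
  have [r nr] := node_shiftn (s i) (u i).
  have := node_modn (shiftn (s i) (u i)); rewrite nr => e.
  rewrite -(cos_add2pi _ r) -(cos_add2pi (th i - _) (shiftn (s i) (u i) %/ M)).
  congr cos; apply/eqP; rewrite -subr_eq0; apply/eqP.
  have {}e : node R M (shiftn (s i) (u i) %% M) =
    node R M (u i) + sg (s i) * h + 2 * pi * r%:R - 2 * pi * (shiftn (s i) (u i) %/ M)%:R.
    by rewrite e addrK.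
  by rewrite e /th; field; rewrite gt_eqF.
rewrite /smoothing -sumrB (le_trans (ler_norm_sum _ _ _))//.
rewrite (@le_trans _ _ (\sum_(u : idx) L * (S * h) * W u th))//; last first.
  by rewrite -mulr_sumr sumW mulr1.
apply: ler_sum => u _; rewrite -mulrBl normrM (ger0_norm (W_ge0 _ _)) ler_wpM2r//.
apply: Phi_lip => // i; rewrite /grid_point -mulrBr normrM (ger0_norm (ltW S_gt0)).
rewrite ler_wpM2l ?(ltW S_gt0)// shiftE.
have [r nr] := node_shiftn (s i) (u i).
have e := node_modn (shiftn (s i) (u i)); rewrite nr in e.
have -> : node R M (shiftn (s i) (u i) %% M) =
    node R M (u i) + sg (s i) * h + 2 * pi * r%:R - 2 * pi * (shiftn (s i) (u i) %/ M)%:R.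
  by rewrite e addrK.
rewrite sin_sub2pi -(sin_sub2pi _ r) addrK (le_trans (sin_lip _ _))//.
have -> : `|sg (s i) * h| = h.
  rewrite normrM [`|h|]ger0_norm; last by rewrite /h divr_ge0// mulr_ge0// pi_ge0.
  by case: (s i); rewrite /sign_of ?normrN normr1 mul1r.
by [].
Qed.

Lemma smooth_is_trig : is_trig ((vp0 R N)^-1 ^+ n) (n%:R * (N%:R / S)) p.
Proof.
have MR : M%:R != 0 :> R by rewrite pnatr_eq0 -lt0n.
have Wt (u : idx) : is_trig ((M%:R * vp0 R N)^-1 ^+ n) (n%:R * (N%:R / S))
    (fun z => W u (fun i => z i / S)).
  have sz : size (index_enum 'I_n) = n by rewrite -[RHS]card_ord cardT enumT.
  have := @is_trig_prod R n _ _ _ (index_enum 'I_n)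
    (fun i z => weight N M (u i) (z i / S))
    (fun i => is_trig_weight N (u i) i M0 S_gt0).
  by rewrite sz.
have := @is_trig_sum R n _ _ _ (fun u => Phi (pt u)) _ Wt (fun u => Phi_le1 _).
rewrite (_ : #|_|%:R * _ = (vp0 R N)^-1 ^+ n)//.
by rewrite card_ffun !card_ord natrX invfM exprMn mulrA -exprMn divff// expr1n mul1r.
Qed.
End fixed_parameters.

Lemma trig_taylor (I : finType) (c : I -> R) (a : I -> 'I_n -> R) (al : I -> R)
    (A B t : R) (v z : 'I_n -> R) :
  \sum_k `|c k| <= A -> (forall k, \sum_(i < n) `|a k i| <= B) ->
  (forall i, `|v i| <= 1) ->
  `|trig c a al (fun i => z i + t * v i) - trig c a al z -
    t * \sum_(i < n) v i * dtrig c a al i z| <= A * (t * B) ^+ 2.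
Proof.
move=> cA aB v1.
have -> : \sum_(i < n) v i * dtrig c a al i z = \sum_k c k *
    ((\sum_(i < n) a k i * v i) * cos (\sum_(j < n) a k j * z j + (al k + pi / 2))).
  rewrite /dtrig (eq_bigr _ (fun i _ => mulr_sumr _ _ _ _)) exchange_big /=.
  apply: eq_bigr => k _; rewrite mulr_suml mulr_sumr; apply: eq_bigr => i _; ring.
rewrite /trig mulr_sumr -!sumrB (le_trans (ler_norm_sum _ _ _))//.
apply: (@le_trans _ _ (\sum_k `|c k| * (t * B) ^+ 2)); last first.
  by rewrite -mulr_suml ler_wpM2r// sqr_ge0.
apply: ler_sum => k _.
set s := \sum_(i < n) a k i * v i; set x := \sum_(i < n) a k i * z i + al k.
have -> : \sum_(i < n) a k i * (z i + t * v i) + al k = x + t * s.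
  rewrite /x /s mulr_sumr addrAC -big_split /=; congr (_ + _).
  by apply: eq_bigr => i _; ring.
rewrite addrA -/x cosDpihalf.
have -> : c k * cos (x + t * s) - c k * cos x - t * (c k * (s * - sin x)) =
    c k * (cos (x + t * s) - cos x + t * s * sin x) by ring.
rewrite normrM ler_wpM2l// (le_trans (cos_taylor1 _ _))// !exprMn ler_wpM2l ?sqr_ge0//.
rewrite -[s ^+ 2]real_normK ?num_real// lerXn2r ?nnegrE//.
  by rewrite (le_trans _ (aB k))// sumr_ge0.
rewrite (le_trans _ (aB k))// (le_trans (ler_norm_sum _ _ _))//.
by apply: ler_sum => i _; rewrite normrM ler_piMr.
Qed.

End approximation.

(** The l1 norm of the gradient at [z] is the derivative in the direction of the signs
of the partial derivatives; it is compared with the increment of the smoothing over one grid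
step, bounded in [smooth_lip], and the Taylor error is small once the grid is fine. Thus the
bound [L + eta] does not depend on the dimension. *)
Lemma trig_approx (R : realType) (n : nat) (L : R) (Phi : ('I_n -> R) -> R) (eta r : R) :
  0 <= L -> sup_lipschitz L Phi -> (forall z, `|Phi z| <= 1) -> 0 < eta ->
  exists (I : finType) (c : I -> R) (a : I -> 'I_n -> R) (al : I -> R),
  [/\ forall z, `|trig c a al z| <= 1,
      forall z, \sum_(i < n) `|dtrig c a al i z| <= L + eta &
      forall z, (forall i, `|z i| <= r) -> `|trig c a al z - Phi z| <= eta].
Proof.
move=> L0 lipP P1 eta0.
(* [S] makes [S * sin (x / S)] close to [x] on [- r, r], *)
pose S := 2 * L * r ^+ 2 / eta + 1.
have S0 : 0 < S by rewrite ltr_wpDl// divr_ge0 ?(ltW eta0)// mulr_ge0 ?sqr_ge0// mulr_ge0.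
pose D := L * S * n%:R.
have D0 : 0 <= D by rewrite !mulr_ge0 ?(ltW S0).
(* [ze] and [N] make the error in [smooth_approx] smaller than [eta / 2], *)
pose ze := eta / (2 * (D + 1)).
have ze0 : 0 < ze by rewrite divr_gt0// mulr_gt0// ltr_wpDl.
pose N := Num.truncn (4 * D / (ze * eta)).
pose A := (vp0 R N)^-1 ^+ n; pose B := n%:R * (N%:R / S).
have A0 : 0 <= A by rewrite exprn_ge0// invr_ge0 ltW// vp0_gt0.
have B0 : 0 <= B by rewrite mulr_ge0// divr_ge0// ltW.
(* and [M], chosen last, makes the Taylor error over one grid step at most [t * eta]. *)
pose M := (maxn N.+2 (Num.truncn (A * B ^+ 2 * (2 * pi * S) / eta)).+1)%N.
have NM : (N.+1 < M)%N by rewrite /M leq_max ltnS leqnn.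
have M0 : 0 < M%:R :> R by rewrite ltr0n (leq_ltn_trans _ NM).
pose t := S * (2 * pi / M%:R).
have t0 : 0 < t by rewrite mulr_gt0// divr_gt0// mulr_gt0// pi_gt0.
have [I [c [a [al [pE cA aB]]]]] := smooth_is_trig NM S0 P1.
have := smooth_le1 S NM P1; rewrite pE => p1.
have := smooth_approx NM S0 L0 lipP; rewrite pE => papp.
have := smooth_lip NM S0 lipP; rewrite pE => plip.
exists I, c, a, al; split => //.
- move=> z; pose s i := 0 <= dtrig c a al i z.
  pose v i : R := sign_of R (s i).
  have v1 i : `|v i| <= 1 by rewrite /v /sign_of; case: (s i); rewrite ?normrN normr1.
  have -> : \sum_(i < n) `|dtrig c a al i z| = \sum_(i < n) v i * dtrig c a al i z.
    apply: eq_bigr => i _; rewrite /v /sign_of /s; case: (leP 0) => h.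
      by rewrite ger0_norm// mul1r.
    by rewrite ltr0_norm// mulN1r.
  have h1 := trig_taylor al t z cA aB v1.
  have h2 : `|trig c a al (fun i => z i + t * v i) - trig c a al z| <= L * t := plip z s.
  have h3 : A * (t * B) ^+ 2 <= t * eta.
    have : A * B ^+ 2 * t <= eta.
      have hM : A * B ^+ 2 * (2 * pi * S) / eta <= M%:R.
        have h := truncnS_gt (A * B ^+ 2 * (2 * pi * S) / eta).
        rewrite (le_trans (ltW h))// ler_nat /M leq_max leqnn orbT//.
      rewrite ler_pdivrMr// in hM.
      rewrite /t (_ : A * B ^+ 2 * (S * (2 * pi / M%:R)) = A * B ^+ 2 * (2 * pi * S) / M%:R).
        by rewrite ler_pdivrMr// [eta * _]mulrC.
      by field; rewrite gt_eqF.
    by rewrite -(ler_pM2l t0) => /(le_trans _); apply; rewrite le_eqVlt; apply/orP; left; apply/eqP; ring.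
  rewrite -(ler_pM2l t0).
  set d := t * \sum_(i < n) _ in h1 *.
  have -> : t * (L + eta) = L * t + t * eta by ring.
  move: h1 h2; set u := trig _ _ _ (fun i => _); set u' := trig _ _ _ z.
  by rewrite -/A -/B !ler_norml => /andP[? ?] /andP[? ?]; lra.
- move=> z zr; have := papp z ze ze0.
  set y := Phi (fun i => S * _) => h.
  have h1 : L * S * (n%:R * (ze / 2 + (ze * N.+1%:R)^-1)) <= eta / 2.
    have -> : L * S * (n%:R * (ze / 2 + (ze * N.+1%:R)^-1)) =
      D * ze / 2 + D / (ze * N.+1%:R).
      have : N.+1%:R != 0 :> R by rewrite pnatr_eq0.
      by rewrite /D; set k := N.+1%:R => k0; field; rewrite ?k0 ?gt_eqF /=.
    have : D * ze / 2 <= eta / 4.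
      have -> : D * ze / 2 = eta / 4 * (D / (D + 1)).
        by rewrite /ze; field; rewrite gt_eqF// ltr_wpDl.
      by rewrite ler_piMr ?divr_ge0 ?(ltW eta0)// ler_pdivrMr ?ltr_wpDl// mul1r lerDl.
    have : D / (ze * N.+1%:R) <= eta / 4.
      rewrite ler_pdivrMr; last by rewrite (mulr_gt0 ze0)// ltr0n.
      have := truncnS_gt (4 * D / (ze * eta)); rewrite -/N => /ltW.
      rewrite ler_pdivrMr; last exact: mulr_gt0.
      move=> h'; rewrite (_ : eta / 4 * (ze * N.+1%:R) = N.+1%:R * (ze * eta) / 4); [lra|by field].
    by move=> hb ha; rewrite (le_trans (lerD ha hb))//; clear -eta0; lra.
  have h2 : `|y - Phi z| <= eta / 2.
    apply: (@le_trans _ _ (L * (r ^+ 2 / S))).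
      apply: lipP => [|i]; first by rewrite divr_ge0 ?sqr_ge0 ?(ltW S0).
      have := sin_taylor1 (z i / S) => hs.
      have -> : S * sin (z i / S) - z i = S * (sin (z i / S) - z i / S).
        by field; rewrite gt_eqF.
      rewrite normrM (ger0_norm (ltW S0)).
      apply: (@le_trans _ _ (S * (z i / S) ^+ 2)); first by rewrite ler_wpM2l// ltW.
      have -> : S * (z i / S) ^+ 2 = z i ^+ 2 / S by field; rewrite gt_eqF.
      rewrite ler_wpM2r ?invr_ge0 ?(ltW S0)// -[z i ^+ 2]real_normK ?num_real//.
      by rewrite lerXn2r ?nnegrE// (le_trans _ (zr i)).
    rewrite mulrA ler_pdivrMr// /S.
    have -> : eta / 2 * (2 * L * r ^+ 2 / eta + 1) = L * r ^+ 2 + eta / 2.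
      by field; rewrite gt_eqF.
    by rewrite lerDl divr_ge0// ltW.
  have -> : trig c a al z - Phi z = (trig c a al z - y) + (y - Phi z) by ring.
  by rewrite (le_trans (ler_normD _ _))// (le_trans (lerD (le_trans h h1) h2))//; lra.
Qed.

(** * Sprinkled decoupling *)

Section clamp.
Variable R : realType.
Implicit Types a b x : R.

Definition clamp x : R := Num.max 0 (Num.min 1 x).

Lemma clamp_lip a b : `|clamp a - clamp b| <= `|a - b|.
Proof.
have clampE c : clamp c = if c < 0 then 0 else if c < 1 then c else 1.
  rewrite /clamp.
  case: (ltP c 0) => c0; first by rewrite min_r ?max_l//; lra.
  by case: (ltP c 1) => c1; rewrite max_r//; lra.
have h1 : a - b <= `|a - b| := ler_norm _.
have h2 : b - a <= `|a - b| by rewrite distrC ler_norm.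
rewrite !clampE ler_norml.
case: (ltP a 0) => ?; case: (ltP b 0) => ?; case: (ltP a 1) => ?;
  case: (ltP b 1) => ?; apply/andP; split; lra.
Qed.

Lemma clamp0 x : x <= 0 -> clamp x = 0.
Proof. by move=> x0; rewrite /clamp min_r ?max_l// (le_trans x0). Qed.

Lemma clamp1 x : 1 <= x -> clamp x = 1.
Proof. by move=> x1; rewrite /clamp min_l ?max_r. Qed.

Lemma clamp_id x : 0 <= x <= 1 -> clamp x = x.
Proof. by move=> /andP[x0 x1]; rewrite /clamp min_r ?max_r. Qed.

Lemma continuous_clamp : continuous clamp.
Proof.
move=> x; apply/cvgrPdist_lt => e e0; near=> y.
by rewrite (le_lt_trans (clamp_lip _ _))//; near: y; exact: cvgr_dist_lt.
Unshelve. all: end_near. Qed.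
End clamp.

Section decoupling.
Context disp (Omega : measurableType disp) (R : realType) (P : probability Omega R).
Variables (X : Type) (f : X -> {RV P >-> R}) (f_gaussian : gaussian_field f).

Lemma trig_approx_seq (n : nat) (L : R) (Phi : ('I_n -> R) -> R) :
  0 <= L -> sup_lipschitz L Phi -> (forall z, `|Phi z| <= 1) ->
  exists p : nat -> ('I_n -> R) -> R,
  (forall k, exists (I : finType) (c : I -> R) (a : I -> 'I_n -> R) (al : I -> R),
    [/\ p k = trig c a al, forall z, `|p k z| <= 1 &
        forall z, \sum_(i < n) `|dtrig c a al i z| <= L + k.+1%:R^-1]) /\
  forall z, p k z @[k --> \oo] --> Phi z.
Proof.
move=> L0 lipP P1.
pose Q (k : nat) (p : ('I_n -> R) -> R) :=
  (exists (I : finType) (c : I -> R) (a : I -> 'I_n -> R) (al : I -> R),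
    [/\ p = trig c a al, forall z, `|p z| <= 1 &
        forall z, \sum_(i < n) `|dtrig c a al i z| <= L + k.+1%:R^-1]) /\
  forall z, (forall i, `|z i| <= k%:R) -> `|p z - Phi z| <= k.+1%:R^-1.
have /choice[p hp] : forall k, exists p, Q k p.
  move=> k; have k0 : 0 < k.+1%:R^-1 :> R by rewrite invr_gt0 ltr0n.
  have [I [c [a [al [h1 h2 h3]]]]] := trig_approx k%:R L0 lipP P1 k0.
  exists (trig c a al); split; last exact: h3.
  by exists I, c, a, al.
exists p; split => [k|z]; first by case: (hp k).
apply/cvgrPdist_le => e e0; near=> k.
rewrite distrC (le_trans ((hp k).2 _ _))//.
  move=> i; rewrite (@le_trans _ _ (\sum_(i < n) `|z i|))//.
    by rewrite (bigD1 i)//= lerDl sumr_ge0.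
  by near: k; exact: nbhs_infty_ger.
near: k; have /cvgrPdist_le/(_ e e0) := @cvg_harmonic R.
by apply: filterS => k; rewrite sub0r normrN ger0_norm// invr_ge0.
Unshelve. all: end_near. Qed.

Section pair.
Variables (n m : nat) (x : 'I_n -> X) (y : 'I_m -> X).

Lemma measurable_trig (I : finType) (c : I -> R) (a : I -> 'I_n -> R) (al : I -> R) :
  measurable_fun setT (fun w => trig c a al (fun i => f (x i) w)).
Proof.
rewrite /trig; apply: measurable_sum => k; apply: measurable_funM => //.
exact: (measurable_cos_lin f_gaussian).
Qed.

End pair.

(** Limit of [trig_covariance] along trigonometric approximations, by dominated
convergence. *)
Theorem lipschitz_covariance (n m : nat) (x : 'I_n -> X) (y : 'I_m -> X)
    (L M kappa : R) (Phi : ('I_n -> R) -> R) (Psi : ('I_m -> R) -> R) :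
  0 <= L -> 0 <= M -> 0 <= kappa ->
  sup_lipschitz L Phi -> sup_lipschitz M Psi ->
  (forall z, `|Phi z| <= 1) -> (forall z, `|Psi z| <= 1) ->
  (forall i j, `|rcov P (f (x i)) (f (y j))| <= kappa) ->
  `|\int[P]_w (Phi (fun i => f (x i) w) * Psi (fun j => f (y j) w)) -
    \int[P]_w Phi (fun i => f (x i) w) * \int[P]_w Psi (fun j => f (y j) w)|
  <= kappa * L * M.
Proof.
move=> L0 M0 k0 lipP lipQ P1 Q1 hk.
have [p [hp cp]] := trig_approx_seq L0 lipP P1.
have [q [hq cq]] := trig_approx_seq M0 lipQ Q1.
pose pX k w := p k (fun i => f (x i) w); pose qY k w := q k (fun j => f (y j) w).
have mp k : measurable_fun setT (pX k).
  have [I [c [a [al [e _ _]]]]] := hp k; rewrite /pX e; exact: measurable_trig.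
have mq k : measurable_fun setT (qY k).
  have [I [c [a [al [e _ _]]]]] := hq k; rewrite /qY e; exact: measurable_trig.
have p1 k w : `|pX k w| <= 1 by have [I [c [a [al [_ h _]]]]] := hp k; exact: h.
have q1 k w : `|qY k w| <= 1 by have [I [c [a [al [_ h _]]]]] := hq k; exact: h.
have i1 : P.-integrable setT (EFin \o cst (1 : R)).
  exact: finite_measure_integrable_cst.
have [_ C1] := Rintegral_dominated_cvg mp (fun w => cp _) i1 p1.
have [_ C2] := Rintegral_dominated_cvg mq (fun w => cq _) i1 q1.
have pq1 k w : `|pX k w * qY k w| <= 1 by rewrite normrM mulr_ile1.
have [_ C3] := Rintegral_dominated_cvg
  (fun k => measurable_funM (mp k) (mq k)) (fun w => cvgM (cp _) (cq _)) i1
  pq1.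
have C4 : `|\int[P]_w (pX k w * qY k w) - \int[P]_w pX k w * \int[P]_w qY k w|
    @[k --> \oo] --> `|\int[P]_w (Phi (fun i => f (x i) w) * Psi (fun j => f (y j) w)) -
    \int[P]_w Phi (fun i => f (x i) w) * \int[P]_w Psi (fun j => f (y j) w)|.
  by apply: cvg_norm; apply: cvgB; [exact: C3|apply: cvgM; [exact: C1|exact: C2]].
have C5 : kappa * (L + k.+1%:R^-1) * (M + k.+1%:R^-1) @[k --> \oo] --> kappa * L * M.
  have h : (fun k => k.+1%:R^-1 : R) @ \oo --> (0 : R) by exact: cvg_harmonic.
  rewrite -[L in X in _ --> X]addr0 -[M in X in _ --> X]addr0.
  apply: cvgM; [apply: cvgM; [exact: cvg_cst|]|]; apply: cvgD => //; exact: cvg_cst.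
apply: (ler_cvg_to C4 C5); apply: nearW => k.
have [I [c [a [al [ep _ dp]]]]] := hp k; have [J [e [b [be [eq _ dq]]]]] := hq k.
have := trig_covariance f_gaussian k0 dp dq hk.
by rewrite /pX /qY ep eq.
Qed.

Lemma prob_le_Rintegral (A : set Omega) (g : Omega -> R) (C : R) :
  measurable A -> measurable_fun setT g -> (forall w, `|g w| <= C) ->
  (forall w, 0 <= g w) -> (forall w, A w -> 1 <= g w) ->
  fine (P A) <= \int[P]_w g w.
Proof.
move=> mA mg gC g0 gA.
have -> : fine (P A) = \int[P]_w (\1_A w) by rewrite /Rintegral integral_indic// setIT.
apply: le_Rintegral => //.
- apply: (@bounded_integrable _ _ _ _ _ 1); first exact: measurable_indic.
  by move=> w; rewrite indicE; case: (_ \in _); rewrite ?normr1 ?normr0.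
- exact: bounded_integrable gC.
- move=> w _; rewrite indicE; have [|//] := boolP (w \in A).
  by rewrite inE => /gA.
Qed.

Lemma Rintegral_le_prob (A : set Omega) (g : Omega -> R) :
  measurable A -> measurable_fun setT g -> (forall w, 0 <= g w <= 1) ->
  (forall w, ~ A w -> g w <= 0) ->
  \int[P]_w g w <= fine (P A).
Proof.
move=> mA mg g01 gA.
have -> : fine (P A) = \int[P]_w (\1_A w) by rewrite /Rintegral integral_indic// setIT.
apply: le_Rintegral => //.
- apply: (@bounded_integrable _ _ _ _ _ 1) => // w.
  by have /andP[? ?] := g01 w; rewrite ger0_norm.
- apply: (@bounded_integrable _ _ _ _ _ 1); first exact: measurable_indic.
  by move=> w; rewrite indicE; case: (_ \in _); rewrite ?normr1 ?normr0.
- move=> w _; rewrite indicE; have [_|] := boolP (w \in A).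
    by have /andP[] := g01 w.
  by rewrite notin_setE => /gA.
Qed.

(** Equal to 1 above [u] and to 0 below [u - eps], with Lipschitz constant [eps^-1]. *)
Definition ramp (u eps t : R) : R := clamp ((t - u) / eps + 1).

Lemma ramp_bound u eps t : 0 <= ramp u eps t <= 1.
Proof. by rewrite /ramp /clamp le_max lexx ge_max ler01 ge_min lexx. Qed.

Lemma ramp_lip u eps s t : 0 < eps -> `|ramp u eps s - ramp u eps t| <= `|s - t| / eps.
Proof.
move=> e0; set a := (s - u) / eps + 1; set b := (t - u) / eps + 1.
have -> : `|s - t| / eps = `|a - b|.
  rewrite -[eps in LHS]gtr0_norm// -normfV -normrM; congr `|_|.
  by rewrite /a /b; field; rewrite gt_eqF.
rewrite /ramp -/a -/b.
exact: clamp_lip.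
Qed.

(** Lipschitz for the sup norm of the values of the field at the points [x]. *)
Definition lip_functional (n : nat) (x : 'I_n -> X) (T : Omega -> R) :=
  exists2 F : ('I_n -> R) -> R, sup_lipschitz 1 F &
    forall w, T w = F (fun i => f (x i) w).

(** Squeeze the indicators of [u < T] and of [u - eps < T] around a ramp, and likewise
for [U]; then apply the covariance inequality to the two ramps. *)
Theorem sprinkled_decoupling (n m : nat) (x : 'I_n -> X) (y : 'I_m -> X)
    (T U : Omega -> R) (kappa u eps : R) :
  measurable_fun setT T -> measurable_fun setT U ->
  lip_functional x T -> lip_functional y U -> 0 <= kappa -> 0 < eps ->
  (forall i j, `|rcov P (f (x i)) (f (y j))| <= kappa) ->
  fine (P [set w | u < T w /\ u < U w]) <=
  fine (P [set w | u - eps < T w]) * fine (P [set w | u - eps < U w]) + kappa / eps ^+ 2.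
Proof.
move=> mT mU [F lipF TE] [G lipG UE] k0 e0 hk.
have mgt (v : R) (V : Omega -> R) : measurable_fun setT V -> measurable [set w | v < V w].
  move=> mV; have := mV measurableT `]v, +oo[%classic (measurable_itv _).
  rewrite setTI; congr measurable; apply/seteqP; split => w /=; rewrite in_itv /= andbT //.
have mramp (V : Omega -> R) : measurable_fun setT V ->
    measurable_fun setT (fun w => ramp u eps (V w)).
  move=> mV; apply: measurable_maxr => //; apply: measurable_minr => //.
  by apply: measurable_funD => //; apply: measurable_funM => //; exact: measurable_funB.
have lip (k : nat) (H : ('I_k -> R) -> R) : sup_lipschitz 1 H ->
    sup_lipschitz eps^-1 (fun z => ramp u eps (H z)).
  move=> lipH a b de de0 h; rewrite (le_trans (ramp_lip _ _ _ e0))// mulrC.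
  by rewrite ler_wpM2l ?invr_ge0 ?(ltW e0)// -[leRHS]mul1r lipH.
have nb t : `|ramp u eps t| <= 1.
  by have /andP[? ?] := ramp_bound u eps t; rewrite ger0_norm.
have ei : 0 <= eps^-1 by rewrite invr_ge0 ltW.
have := lipschitz_covariance ei ei k0 (lip _ _ lipF) (lip _ _ lipG)
  (fun z => nb _) (fun z => nb _) hk.
under [X in `|X - _|]eq_Rintegral => w _ do rewrite -TE -UE.
under [X in `|_ - X * _|]eq_Rintegral => w _ do rewrite -TE.
under [X in `|_ - _ * X|]eq_Rintegral => w _ do rewrite -UE.
rewrite ler_norml => /andP[_].
have -> : kappa / eps / eps = kappa / eps ^+ 2.
  by field; rewrite gt_eqF.
rewrite lerBlDr addrC => h.
have ramp1 v : u < v -> 1 <= ramp u eps v.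
  move=> uv; rewrite /ramp /clamp le_max le_min lexx /=; apply/orP; right.
  by rewrite lerDr divr_ge0 ?subr_ge0// ltW.
have ramp0 v : ~ (u - eps < v) -> ramp u eps v <= 0.
  move/negP; rewrite -leNgt => uv; rewrite /ramp /clamp ge_max lexx /= ge_min; apply/orP; right.
  rewrite -lerBrDr sub0r ler_pdivrMr// mulN1r; lra.
have h0 : fine (P [set w | u < T w /\ u < U w]) <=
    \int[P]_w (ramp u eps (T w) * ramp u eps (U w)).
  apply: (@prob_le_Rintegral _ _ 1).
  - rewrite (_ : [set w | _] = [set w | u < T w] `&` [set w | u < U w])//.
    by apply: measurableI; exact: mgt.
  - by apply: measurable_funM; exact: mramp.
  - by move=> w; rewrite normrM mulr_ile1.
  - by move=> w; rewrite mulr_ge0//; case/andP: (ramp_bound u eps (T w)); case/andP: (ramp_bound u eps (U w)).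
  - by move=> w [h1 h2]; rewrite -[leLHS]mulr1 ler_pM// ramp1.
have hT : \int[P]_w ramp u eps (T w) <= fine (P [set w | u - eps < T w]).
  apply: Rintegral_le_prob; [exact: mgt|exact: mramp|move=> w; exact: ramp_bound|].
  by move=> w; exact: ramp0.
have hU : \int[P]_w ramp u eps (U w) <= fine (P [set w | u - eps < U w]).
  apply: Rintegral_le_prob; [exact: mgt|exact: mramp|move=> w; exact: ramp_bound|].
  by move=> w; exact: ramp0.
rewrite (le_trans h0)// (le_trans h)// lerD2r ler_pM//.
- by apply: Rintegral_ge0 => w _; case/andP: (ramp_bound u eps (T w)).
- by apply: Rintegral_ge0 => w _; case/andP: (ramp_bound u eps (U w)).
Qed.
End decoupling.

(** * Chains and boxes in the integer lattice *)

Section lattice_geometry.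
Variable d : nat.
Local Notation V := 'rV[int]_d.
Implicit Types z : V.

Definition within (r : nat) (z z' : V) := [forall i, (`|z ord0 i - z' ord0 i| <= r)%N].

Lemma withinP r z z' :
  reflect (forall i, (`|z ord0 i - z' ord0 i| <= r)%N) (within r z z').
Proof. exact: forallP. Qed.

Lemma withinPn r z z' : reflect (exists i, (r < `|z ord0 i - z' ord0 i|)%N) (~~ within r z z').
Proof.
rewrite negb_forall; apply: (iffP existsP) => -[i h]; exists i; lia.
Qed.

Definition apart (r : nat) (z z' : V) := exists i, (r <= `|z ord0 i - z' ord0 i|)%N.

Lemma within_sym r : symmetric (within r).
Proof. by move=> z z'; apply/withinP/withinP => h i; have := h i; lia. Qed.

(** Stop the chain at its first exit: steps have size one, so the overshoot is zero. *)
Lemma star_chain_stop (m : nat) (z : V) (s : seq V) : (0 < m)%N -> path (within 1) z s ->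
  apart m z (last z s) ->
  exists s1, [/\ {subset s1 <= s}, path (within 1) z s1, apart m z (last z s1) &
    within m z (last z s1)].
Proof.
move=> m0; elim/last_ind: s => [_ [i]|s y IH].
  by rewrite /= subrr absz0 leqNgt m0.
rewrite rcons_path last_rcons => /andP[ps lasty] ay.
case: (boolP (within m.-1 z (last z s))) => [w|/withinPn[i hi]].
  exists (rcons s y); rewrite rcons_path ps lasty last_rcons; split => //.
  by apply/withinP => i; move/withinP/(_ i) : w; move/withinP/(_ i) : lasty; lia.
have [|s1 [h1 h2 h3 h4]] := IH ps; first by exists i; lia.
by exists s1; split => // t /h1 ts; rewrite mem_rcons inE ts orbT.
Qed.

Lemma star_chain_rev (z : V) (s : seq V) : path (within 1) z s ->
  exists s', [/\ path (within 1) (last z s) s', last (last z s) s' = z &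
    {subset last z s :: s' <= z :: s}].
Proof.
move=> ps; exists (rev (belast z s)); split.
- rewrite rev_path (eq_path (e' := within 1))// => x y.
  exact: within_sym.
- by case: s {ps} => //= y s; rewrite rev_cons last_rcons.
- move=> t; rewrite inE mem_rev => /orP[/eqP ->|/mem_belast//].
  exact: mem_last.
Qed.

(** Positions of the subboxes of a cascade, in units of the lower scale: 25 values per
coordinate, centred by subtracting 12 in [shifted]. *)
Definition offset := {ffun 'I_d -> 'I_25}.
Definition shifted (n : nat) (z : V) (a : offset) : V :=
  \row_i (z ord0 i + (8 ^ n)%N%:Z * ((a i)%:Z - 12%:Z)).
(** Boxes at offsets differing by 7 remain apart after each is enlarged by
[cascade_radius]; this radius is at most 12/7 of the scale. *)
Definition gapped (p : offset * offset) :=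
  [exists i, (7 <= `|(p.1 i)%:Z - (p.2 i)%:Z|)%N].

(** Rounding to the nearest multiple of [8 ^ n]. *)
Lemma nearest_shifted (n : nat) (z y : V) :
  (forall i, (2 * `|y ord0 i - z ord0 i| <= 3 * 8 ^ n.+1)%N) ->
  exists a : offset, forall i, (2 * `|y ord0 i - shifted n z a ord0 i| <= 8 ^ n)%N.
Proof.
move=> hy.
have /(_ _)/cid2 h i : exists2 b : 'I_25, True &
  (2 * `|(y ord0 i - (z ord0 i + (8 ^ n)%N%:Z * ((b : nat)%:Z - 12%:Z)))%R| <= 8 ^ n)%N.
  have := hy i; rewrite expnS; set t := y ord0 i - z ord0 i => ht.
  have p0 : (0 < 8 ^ n)%N by rewrite expn_gt0.
  set P := (8 ^ n)%N in ht p0 *.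
  pose q := ((t + (P %/ 2)%N%:Z) %/ P%:Z)%Z.
  have e := divz_eq (t + (P %/ 2)%N%:Z) P%:Z.
  have r1 : 0 <= ((t + (P %/ 2)%N%:Z) %% P%:Z)%Z by apply: modz_ge0; lia.
  have r2 : ((t + (P %/ 2)%N%:Z) %% P%:Z)%Z < P%:Z by apply: ltz_pmod; lia.
  rewrite -/q in e; move: e r1 r2; set r := (_ %% _)%Z => e r1 r2.
  have q1 : -13 < q < 13.
    by apply/andP; split; nia.
  have hb : (`|(q + 12%:Z)%R| < 25)%N by lia.
  exists (Ordinal hb) => //=.
  have -> : `|(q + 12)%R|%N%:Z - 12%:Z = q by lia.
  have -> : y ord0 i - (z ord0 i + P%:Z * q) = t - q * P%:Z by rewrite /t; ring.
  by lia.
exists [ffun i => sval (h i)] => i; rewrite mxE ffunE.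
by have := svalP (h i); case: (h i) => b /=.
Qed.
End lattice_geometry.

(** * Cascades *)

Section cascade.
Variables (R : realType) (d : nat).
Local Notation V := 'rV[int]_d.
Implicit Types (z : V) (g h : V -> nat -> R) (u : R).

(** A default value for the maximum in [cascade], chosen gapped so that it changes
nothing. *)
Definition extreme_pair : offset d * offset d :=
  ([ffun=> ord0], [ffun=> ord_max]).

Lemma gapped_extreme : (0 < d)%N -> gapped extreme_pair.
Proof.
move=> d0; apply/existsP; exists (Ordinal d0); rewrite /= !ffunE /=; lia.
Qed.

(** The event [u < cascade K n g z] says that the values above [u] contain a binary tree of
depth [n] around [z], whose two branches at each level start from well-separated points.
Only the first [K] sample points of each cell are inspected, which keeps the number of
variables finite. *)
Fixpoint cascade (K n : nat) g z : R :=
  if n is n'.+1 then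
    let both p := Num.min (cascade K n' g (shifted n' z p.1))
                          (cascade K n' g (shifted n' z p.2)) in
    \big[Num.max/both extreme_pair]_(p | gapped p) both p
  else \big[Num.max/g z 0%N]_(k < K) g z k.

Lemma cascade0_gt K g z u :
  u < cascade K.+1 0 g z <-> exists2 k, (k <= K)%N & u < g z k.
Proof.
split=> [/bigmax_gtP[h|[k _ h]]|[k kK h]].
- by exists 0%N.
- by exists k => //; rewrite -ltnS.
- by apply/bigmax_gtP; right; exists (Ordinal (kK : (k < K.+1)%N)).
Qed.

Lemma cascadeS_gt K n g z u : (0 < d)%N ->
  u < cascade K n.+1 g z <-> exists p, [/\ gapped p,
    u < cascade K n g (shifted n z p.1) & u < cascade K n g (shifted n z p.2)].
Proof.
move=> d0; split=> [/bigmax_gtP[|[p gp]]|[p [gp h1 h2]]].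
- by rewrite lt_min => /andP[? ?]; exists extreme_pair; rewrite gapped_extreme.
- by rewrite lt_min => /andP[? ?]; exists p.
- by apply/bigmax_gtP; right; exists p => //; rewrite lt_min h1.
Qed.

Lemma cascade_mono K K' n g z u : (0 < d)%N -> (K <= K')%N ->
  u < cascade K.+1 n g z -> u < cascade K'.+1 n g z.
Proof.
move=> d0 KK; elim: n z => [|n IH] z.
  by move=> /cascade0_gt[k kK h]; apply/cascade0_gt; exists k => //; exact: leq_trans KK.
move=> /cascadeS_gt-/(_ d0)[p [gp h1 h2]]; apply/cascadeS_gt => //.
by exists p; split => //; exact: IH.
Qed.

Definition cascade_radius (n : nat) : nat := \sum_(m < n) 12 * 8 ^ m.

Lemma cascade_radiusE n : (7 * cascade_radius n + 12 = 12 * 8 ^ n)%N.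
Proof.
elim: n => [|n IH]; first by rewrite /cascade_radius big_ord0 expn0.
rewrite /cascade_radius big_ord_recr /= -/(cascade_radius n) expnS; lia.
Qed.

Lemma shifted_within n z (a : offset d) i :
  (`|shifted n z a ord0 i - z ord0 i| <= 12 * 8 ^ n)%N.
Proof.
rewrite mxE; have := ltn_ord (a i); set b := nat_of_ord _ => b25.
have p0 : (0 < 8 ^ n)%N by rewrite expn_gt0.
by set P := (8 ^ n)%N in p0 *; nia.
Qed.

Lemma max_lip (a b a' b' de : R) : `|a - a'| <= de -> `|b - b'| <= de ->
  `|Num.max a b - Num.max a' b'| <= de.
Proof.
rewrite !ler_norml => /andP[? ?] /andP[? ?].
by case: (leP a b) => ?; case: (leP a' b') => ?; apply/andP; split; lra.
Qed.

Lemma min_lip (a b a' b' de : R) : `|a - a'| <= de -> `|b - b'| <= de ->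
  `|Num.min a b - Num.min a' b'| <= de.
Proof.
rewrite !ler_norml => /andP[? ?] /andP[? ?].
by case: (leP a b) => ?; case: (leP a' b') => ?; apply/andP; split; lra.
Qed.

Lemma bigmax_lip (I : Type) (s : seq I) (Q : pred I) (F G : I -> R) (x y de : R) :
  `|x - y| <= de -> (forall i, `|F i - G i| <= de) ->
  `|\big[Num.max/x]_(i <- s | Q i) F i - \big[Num.max/y]_(i <- s | Q i) G i| <= de.
Proof.
move=> xy FG; elim: s => [|i s IH]; first by rewrite !big_nil.
by rewrite !big_cons; case: ifP => // _; exact: max_lip.
Qed.

(** Maxima and minima do not increase sup-norm distances. *)
Lemma cascade_lip K n g h z (de : R) :
  (forall y k, within (cascade_radius n) z y -> (k <= K)%N -> `|g y k - h y k| <= de) ->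
  `|cascade K.+1 n g z - cascade K.+1 n h z| <= de.
Proof.
elim: n z => [|n IH] z hgh.
  have w0 : within (cascade_radius 0) z z by apply/withinP => i; rewrite subrr.
  apply: bigmax_lip => [|k]; apply: hgh => //.
  by rewrite -ltnS.
have sub (a : offset d) y : within (cascade_radius n) (shifted n z a) y ->
    within (cascade_radius n.+1) z y.
  move=> /withinP hw; apply/withinP => i; have := hw i; have := shifted_within n z a i.
  rewrite /cascade_radius big_ord_recr /= -/(cascade_radius n); lia.
have both (p : offset d * offset d) :
    `|Num.min (cascade K.+1 n g (shifted n z p.1)) (cascade K.+1 n g (shifted n z p.2)) -
      Num.min (cascade K.+1 n h (shifted n z p.1)) (cascade K.+1 n h (shifted n z p.2))| <= de.
  by apply: min_lip; apply: IH => y k /sub; exact: hgh.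
rewrite /=; apply: bigmax_lip => [|p]; [exact: (both extreme_pair)|exact: both].
Qed.

Lemma offset_gap (P A B : nat) (x y z : int) : (0 < P)%N -> (8 * P <= `|x - y|)%N ->
  (2 * `|(x - (z + P%:Z * (A%:Z - 12%:Z)))%R| <= P)%N ->
  (2 * `|(y - (z + P%:Z * (B%:Z - 12%:Z)))%R| <= P)%N -> (7 <= `|A%:Z - B%:Z|)%N.
Proof.
move=> p0 hxy hx hy; have [//|lt] := leqP 7 `|A%:Z - B%:Z|.
have h : (`|(P%:Z * (A%:Z - B%:Z))%R| <= P * 6)%N by rewrite abszM leq_mul//=; lia.
have e : P%:Z * (A%:Z - B%:Z) = (x - y) - (x - (z + P%:Z * (A%:Z - 12%:Z))) +
  (y - (z + P%:Z * (B%:Z - 12%:Z))) by ring.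
by rewrite e in h; lia.
Qed.

(** Cut the crossing at distance [8 ^ n.+1] from its start. Followed from either end, it
crosses a box of the lower scale; the two starting points, rounded to shifted boxes, are
separated. *)
Lemma crossing_cascade g u n z z0 (s : seq V) : (0 < d)%N ->
  path (within 1) z0 s -> (forall y, y \in z0 :: s -> exists k, u < g y k) ->
  (forall i, (2 * `|z0 ord0 i - z ord0 i| <= 8 ^ n)%N) ->
  apart (8 ^ n) z0 (last z0 s) -> exists K, u < cascade K.+1 n g z.
Proof.
move=> d0; elim: n z z0 s => [|n IH] z z0 s ps bs near far.
  have -> : z = z0.
    apply/rowP => i; have h := near i; rewrite expn0 in h.
    by have : z ord0 i = z0 ord0 i by lia.
  have [k hk] := bs z0 (mem_head _ _).
  by exists k; apply/cascade0_gt; exists k.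
have p0 : (0 < 8 ^ n)%N by rewrite expn_gt0.
have p1 : (0 < 8 ^ n.+1)%N by rewrite expn_gt0.
have [s1 [sub1 ps1 far1 near1]] := star_chain_stop p1 ps far.
have [s2 [ps2 last2 sub2]] := star_chain_rev ps1.
have [|a ha] := @nearest_shifted d n z z0.
  by move=> i; have := near i; lia.
have [|b hb] := @nearest_shifted d n z (last z0 s1).
  by move=> i; have := near i; move/withinP/(_ i) : near1; lia.
have [i hi] := far1.
have [||K1 h1] := IH (shifted n z a) z0 s1 ps1 _ ha.
- by move=> y; rewrite inE => /orP[/eqP ->|/sub1 ys]; apply: bs; rewrite ?mem_head// inE ys orbT.
- by exists i; rewrite expnS in hi; lia.
have [||K2 h2] := IH (shifted n z b) (last z0 s1) s2 ps2 _ hb.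
- move=> y /sub2; rewrite inE => /orP[/eqP ->|/sub1 ys]; apply: bs; rewrite ?mem_head//.
  by rewrite inE ys orbT.
- by exists i; rewrite last2; rewrite expnS in hi; lia.
exists (maxn K1 K2); apply/cascadeS_gt => //; exists (a, b); split => /=.
- apply/existsP; exists i => /=.
  have hai := ha i; have hbi := hb i; rewrite !mxE in hai hbi.
  by rewrite expnS in hi; exact: offset_gap p0 hi hai hbi.
- by apply: cascade_mono h1 => //; rewrite leq_maxl.
- by apply: cascade_mono h2 => //; rewrite leq_maxr.
Qed.
End cascade.

(** * Renormalisation of cascade probabilities *)

Section power_arithmetic.
Variable R : realType.
Implicit Types (n : nat) (eta : R).

(** Convexity of [x `^ (- eta)]. It serves twice: as a lower bound for the sprinkling between
two scales, and to sum [n%:R `^ (- 1 - eta)] by telescoping. *)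
Lemma natr_powR_lb n eta : (0 < n)%N -> 0 < eta ->
  eta * n.+1%:R `^ (- 1 - eta) <= n%:R `^ (- eta) - n.+1%:R `^ (- eta) :> R.
Proof.
move=> n0 e0; have m0 : 0 < n.+1%:R :> R by rewrite ltr0n.
have nn0 : 0 < n%:R :> R by rewrite ltr0n.
have x0 : 0 < n%:R / n.+1%:R :> R by rewrite divr_gt0.
have -> : n%:R `^ (- eta) = n.+1%:R `^ (- eta) * (n%:R / n.+1%:R) `^ (- eta) :> R.
  rewrite -powRM ?ltW// mulrC divfK// gt_eqF//.
have -> : n.+1%:R `^ (- 1 - eta) = n.+1%:R `^ (- eta) * n.+1%:R^-1 :> R.
  rewrite (_ : - 1 - eta = - eta + - 1); last by ring.
  by rewrite powRD; [rewrite powR_inv1 ?ltW|rewrite [n.+1%:R == 0]gt_eqF ?implybT].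
set y := n.+1%:R `^ (- eta); have y0 : 0 <= y by exact: powR_ge0.
rewrite (_ : _ - y = y * ((n%:R / n.+1%:R) `^ (- eta) - 1)); last by ring.
rewrite mulrCA ler_wpM2l// lerBrDr.
rewrite /powR gt_eqF//; apply: le_trans (expR_ge1Dx _).
rewrite addrC lerD2l mulNr -mulrN ler_wpM2l ?(ltW e0)// lerNr.
have -> : n%:R / n.+1%:R = 1 + (- n.+1%:R^-1) :> R.
  by rewrite -natr1 in m0 *; field; rewrite gt_eqF.
apply: le_ln1Dx; rewrite ltrN2 invf_lt1// ltr1n ltnS//.
Qed.

Lemma powR_natS n (x : R) : (0 < n)%N -> 0 <= x -> n.+1%:R `^ x <= 2 `^ x * n%:R `^ x.
Proof.
move=> n0 x0; rewrite -powRM//; apply: ge0_ler_powR => //; rewrite ?nnegrE// ?mulr_ge0//.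
by rewrite -natrM ler_nat mul2n -addnn -addn1 leq_add2l.
Qed.
End power_arithmetic.

Section renormalisation.
Context disp (Omega : measurableType disp) (R : realType) (P : probability Omega R).
Variable d : nat.
Hypothesis d_gt0 : (0 < d)%N.
Local Notation V := 'rV[int]_d.
Variables (f : V * nat -> {RV P >-> R}) (f_gaussian : gaussian_field f).
Implicit Types (z : V) (w : Omega).

Definition config w z k : R := f (z, k) w.

(** Uniformity in the location replaces stationarity, and uniformity in [K] allows for
all sample points of a cell. *)
Definition cascade_bound (n : nat) (u q : R) := forall K z,
  fine (P [set w | u < cascade K.+1 n (config w) z]) <= q.

Lemma measurable_bigmax (I : Type) (s : seq I) (Q : pred I) (F : I -> Omega -> R) x :
  measurable_fun setT x -> (forall i, measurable_fun setT (F i)) ->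
  measurable_fun setT (fun w => \big[Num.max/x w]_(i <- s | Q i) F i w).
Proof.
move=> mx mF; elim: s => [|i s IH]; first by under eq_fun do rewrite big_nil.
case Qi : (Q i); under eq_fun do rewrite big_cons Qi.
  exact: measurable_maxr.
exact: IH.
Qed.

Lemma measurable_cascade K n z :
  measurable_fun setT (fun w => cascade K.+1 n (config w) z).
Proof.
elim: n z => [|n IH] z /=; first by apply: measurable_bigmax.
by apply: measurable_bigmax => [|p]; apply: measurable_minr.
Qed.

Lemma measurable_cascade_gt K n z (u : R) :
  measurable [set w | u < cascade K.+1 n (config w) z].
Proof.
have := @measurable_cascade K n z measurableT `]u, +oo[%classic (measurable_itv _).
rewrite setTI; congr measurable; apply/seteqP; split => w /=; rewrite in_itv /= andbT //.
Qed.

Lemma prob_union_le (I : finType) (Q : pred I) (A : set Omega) (B : I -> set Omega) :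
  measurable A -> (forall i, measurable (B i)) ->
  (forall w, A w -> exists2 i, Q i & B i w) ->
  fine (P A) <= \sum_(i | Q i) fine (P (B i)).
Proof.
move=> mA mB AB.
have E i : fine (P (B i)) = \int[P]_w (\1_(B i) w).
  by rewrite /Rintegral integral_indic// setIT.
have iB i : P.-integrable setT (EFin \o (\1_(B i) : Omega -> R)).
  apply: (@bounded_integrable _ _ _ _ _ 1); first exact: measurable_indic.
  by move=> w; rewrite indicE; case: (_ \in _); rewrite ?normr1 ?normr0.
under eq_bigr => i _ do rewrite E.
rewrite -big_filter -Rintegral_sum//.
apply: (@prob_le_Rintegral _ _ _ _ _ _ (size [seq i <- index_enum I | Q i])%:R) => //.
- by apply: measurable_sum => i; exact: measurable_indic.
- move=> w; rewrite (le_trans (ler_norm_sum _ _ _))//.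
  rewrite -sum1_size natr_sum ler_sum// => i _.
  by rewrite indicE; case: (_ \in _); rewrite ?normr1 ?normr0.
- by move=> w; apply: sumr_ge0.
- move=> w /AB[i Qi Bi]; rewrite big_filter (bigD1 i)//= indicE mem_set// lerDl.
  by apply: sumr_ge0.
Qed.

(** All the variables on which a cascade depends, enumerated so as to apply the
decoupling of finite families. *)
Definition box_index (K n : nat) : finType :=
  ({ffun 'I_d -> 'I_(2 * cascade_radius n).+1} * 'I_K.+1)%type.

Definition box_site (K n : nat) z (b : box_index K n) : V * nat :=
  (\row_i (z ord0 i + ((b.1 i : nat)%:Z - (cascade_radius n)%:Z)), b.2 : nat).

Definition box_sites (K n : nat) z (i : 'I_#|box_index K n|) : V * nat :=
  box_site z (enum_val i).

Lemma box_sites_within K n z i : within (cascade_radius n) z (@box_sites K n z i).1.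
Proof.
apply/withinP => j; rewrite /box_sites /box_site /= mxE.
have := ltn_ord ((enum_val i).1 j); set b := nat_of_ord _; lia.
Qed.

Lemma box_sites_cover K n z y k : within (cascade_radius n) z y -> (k <= K)%N ->
  exists i, @box_sites K n z i = (y, k).
Proof.
move=> /withinP wy kK.
have hb j : (`|(y ord0 j - z ord0 j + (cascade_radius n)%:Z)%R| <
    (2 * cascade_radius n).+1)%N by have := wy j; lia.
pose b : box_index K n := ([ffun j => Ordinal (hb j)], Ordinal (kK : (k < K.+1)%N)).
exists (enum_rank b); rewrite /box_sites enum_rankK /box_site /=; congr (_, _).
apply/rowP => j; rewrite mxE ffunE /=; have := wy j.
by have -> : y 0 j = y ord0 j by []; lia.
Qed.

Lemma cascade_lip_functional K n z :
  lip_functional f (@box_sites K n z) (fun w => cascade K.+1 n (config w) z).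
Proof.
pose G (v : 'I_#|box_index K n| -> R) (y : V) (k : nat) : R :=
  if [pick i | @box_sites K n z i == (y, k)] is Some i then v i else 0.
exists (fun v => cascade K.+1 n (G v) z) => [v v' de de0 vv'|w].
  rewrite mul1r; apply: cascade_lip => y k wy kK; rewrite /G.
  by case: pickP => [i _|_]; [exact: vv'|rewrite subrr normr0].
apply/eqP; rewrite -subr_eq0 -normr_le0.
apply: cascade_lip => y k wy kK; rewrite /G; case: pickP => [i /eqP e|no].
  by rewrite e /config subrr normr0.
by have [i e] := box_sites_cover wy kK; have := no i; rewrite e eqxx.
Qed.

Let npairs : R := #|{: offset d * offset d}|%:R.

(** The union bound without decoupling: it loses a constant factor and serves for the
first scales, where the covariance estimate is useless. *)
Lemma cascade_bound_union n u q : 0 <= q -> cascade_bound n u q ->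
  cascade_bound n.+1 u (npairs * q).
Proof.
move=> q0 hq K z.
rewrite (le_trans (@prob_union_le _ (@gapped d) _
  (fun p => [set w | u < cascade K.+1 n (config w) (shifted n z p.1)]) _ _ _))//.
- exact: measurable_cascade_gt.
- by move=> p; exact: measurable_cascade_gt.
- by move=> w /= /(cascadeS_gt _ _ _ _ _ d_gt0)[p [gp ? _]]; exists p.
rewrite (@le_trans _ _ (\sum_(p : offset d * offset d) q))//; last first.
  by rewrite sumr_const /npairs mulr_natl.
rewrite big_mkcond; apply: ler_sum => p _; case: ifP => // _; exact: hq.
Qed.

(** The renormalisation step: decouple the two branches of each gapped pair. *)
Lemma cascade_bound_step n u q eps kappa : 0 <= q -> 0 <= kappa -> 0 < eps ->
  (forall z z' k k', apart (8 ^ n) z z' -> `|rcov P (f (z, k)) (f (z', k'))| <= kappa) ->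
  cascade_bound n u q ->
  cascade_bound n.+1 (u + eps) (npairs * (q ^+ 2 + kappa / eps ^+ 2)).
Proof.
move=> q0 k0 e0 hk hq K z.
pose T p w := cascade K.+1 n (config w) (shifted n z p).
rewrite (le_trans (@prob_union_le _ (@gapped d) _
  (fun p => [set w | u + eps < T p.1 w /\ u + eps < T p.2 w]) _ _ _))//.
- exact: measurable_cascade_gt.
- move=> p; rewrite (_ : [set w | _] =
    [set w | u + eps < T p.1 w] `&` [set w | u + eps < T p.2 w])//.
  by apply: measurableI; exact: measurable_cascade_gt.
- by move=> w /= /(cascadeS_gt _ _ _ _ _ d_gt0)[p [gp ? ?]]; exists p.
have c0 : 0 <= q ^+ 2 + kappa / eps ^+ 2 by rewrite addr_ge0 ?sqr_ge0// divr_ge0// sqr_ge0.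
rewrite (@le_trans _ _ (\sum_(p : offset d * offset d) (q ^+ 2 + kappa / eps ^+ 2)))//; last first.
  by rewrite sumr_const /npairs mulr_natl.
rewrite big_mkcond; apply: ler_sum => p _; case: ifP => // gp.
have h := sprinkled_decoupling f_gaussian (u + eps)
  (measurable_cascade K n (shifted n z p.1)) (measurable_cascade K n (shifted n z p.2))
  (cascade_lip_functional K n (shifted n z p.1))
  (cascade_lip_functional K n (shifted n z p.2)) k0 e0.
rewrite (le_trans (h _))//.
  move=> i j.
  move: (box_sites_within (shifted n z p.1) i) (box_sites_within (shifted n z p.2) j).
  case: (box_sites _ i) => y k; case: (box_sites _ j) => y' k' /= /withinP hy /withinP hy'.
  apply: hk; case/existsP: gp => l gl; exists l.
  have := hy l; have := hy' l; rewrite !mxE.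
  have := cascade_radiusE n; move: gl.
  set P8 := (8 ^ n)%N; set r := cascade_radius n.
  move: (nat_of_ord (p.1 l)) (nat_of_ord (p.2 l)) => a b gl hr h1 h2.
  have h7 : (P8 * 7 <= `|(P8%:Z * (a%:Z - b%:Z))%R|)%N by rewrite abszM leq_mul.
  have e : P8%:Z * (a%:Z - b%:Z) = (z ord0 l + P8%:Z * (a%:Z - 12%:Z)) -
    (z ord0 l + P8%:Z * (b%:Z - 12%:Z)) by ring.
  rewrite e in h7; lia.
rewrite addrK lerD2r expr2.
by apply: ler_pM; rewrite ?fine_ge0//; exact: hq.
Qed.

Lemma cascade_bound_le n u u' q : u <= u' -> cascade_bound n u q -> cascade_bound n u' q.
Proof.
move=> uu hq K z; apply: le_trans (hq K z).
rewrite fine_le ?fin_num_measure//; try exact: measurable_cascade_gt.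
apply: le_measure; rewrite ?inE; try exact: measurable_cascade_gt.
by move=> w /=; exact: le_lt_trans.
Qed.

Variables (C0 c1 delta : R) (n1 : nat).
Hypothesis C0_ge0 : 0 <= C0.
Hypothesis c1_ge0 : 0 <= c1.
Hypothesis delta_gt0 : 0 < delta.
Hypothesis tail : forall u, 0 < u -> cascade_bound 0 u (C0 / u).
Hypothesis cov_decay : forall n z z' k k', (n1 <= n)%N -> apart (8 ^ n) z z' ->
  `|rcov P (f (z, k)) (f (z', k'))| <= c1 * n%:R `^ (- 3 - delta).

(** The levels [U0 + 1 - n%:R `^ (- eta)] increase with the scale and stay below [U0 + 1],
which leaves a sprinkling of order [n%:R `^ (- 1 - eta)] at scale [n]. *)
Theorem cascade_renormalisation : exists2 eta : R, 0 < eta & exists n2 : nat,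
  forall n0, (n2 <= n0)%N -> exists U : R, forall u, U <= u -> forall n, (n0 <= n)%N ->
  cascade_bound n u (n%:R `^ (- 1 - eta)).
Proof.
(* With this choice, [n `^ (- 3 - delta)] divided by the square of the sprinkling is of order
   [n `^ (- 1 - 2 * eta)], which dominates the square of [q n]. *)
pose eta := delta / 4; have eta0 : 0 < eta by rewrite divr_gt0.
have np0 : 0 <= npairs by [].
exists eta => //.
pose c2 := c1 / eta ^+ 2 * 2 `^ (2 + 2 * eta).
have c20 : 0 <= c2 by rewrite mulr_ge0 ?powR_ge0// divr_ge0// sqr_ge0.
pose D := npairs * (1 + c2) * 2 `^ (1 + eta) + 1.
have D0 : 0 < D by rewrite ltr_wpDl// mulr_ge0 ?powR_ge0// mulr_ge0// addr_ge0.
(* from this scale on, the factor [n `^ (- eta)] gained beats the constant [D] *)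
exists (maxn 1 (maxn n1 (Num.truncn (D `^ eta^-1)).+1)) => n0 n0l.
have [n01 n0n1 n0D] : [/\ (0 < n0)%N, (n1 <= n0)%N & D `^ eta^-1 <= n0%:R].
  move: n0l; rewrite !geq_max => /and3P[-> -> h]; split => //.
  by rewrite (le_trans (ltW (truncnS_gt _)))// ler_nat.
pose q (n : nat) : R := n%:R `^ (- 1 - eta).
have q0 n : 0 <= q n by exact: powR_ge0.
have qn0 : 0 < q n0 by rewrite powR_gt0// ltr0n.
(* the union bound up to scale [n0] gives [q n0] at this level *)
pose U0 := npairs ^+ n0 * C0 / q n0 + 1.
have U00 : 0 < U0 by rewrite ltr_wpDl// divr_ge0// mulr_ge0// exprn_ge0.
have init n : cascade_bound n U0 (npairs ^+ n * (C0 / U0)).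
  elim: n => [|n IH]; first by rewrite expr0 mul1r; exact: tail.
  rewrite exprS -mulrA; apply: cascade_bound_union => //.
  by rewrite mulr_ge0 ?exprn_ge0// divr_ge0// ltW.
pose s (n : nat) : R := n%:R `^ (- eta).
have main n : (n0 <= n)%N -> cascade_bound n (U0 + 1 - s n) (q n).
  move=> /subnK <-; elim: (n - n0)%N => {n} [|k IH].
    rewrite add0n; apply: (@cascade_bound_le _ U0).
      rewrite -addrA lerDl subr_ge0 /s -[leRHS](powRr0 n0%:R).
      by apply: ler_powR; rewrite ?ler1n// oppr_le0 ltW.
    move=> K z; apply: le_trans (init n0 K z) _.
    rewrite mulrA ler_pdivrMr// /U0 mulrDr mulr1 [q n0 * _]mulrC divfK ?gt_eqF//.
    by rewrite lerDl.
  rewrite addSn; set n := (k + n0)%N in IH *.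
  have nn0 : (n0 <= n)%N by rewrite leq_addl.
  have n_gt0 : (0 < n)%N by exact: leq_trans nn0.
  have nR : 0 < n%:R :> R by rewrite ltr0n.
  have nneq0 : n%:R != 0 :> R by rewrite gt_eqF.
  have lb := natr_powR_lb n_gt0 eta0.
  have lb0 : 0 < eta * n.+1%:R `^ (- 1 - eta) by rewrite mulr_gt0// powR_gt0// ltr0n.
  have e0 : 0 < s n - s n.+1 by exact: lt_le_trans lb.
  have k0 : 0 <= c1 * n%:R `^ (- 3 - delta) by rewrite mulr_ge0// powR_ge0.
  have hk z z' k1 k2 : apart (8 ^ n) z z' ->
     `|rcov P (f (z, k1)) (f (z', k2))| <= c1 * n%:R `^ (- 3 - delta).
    by apply: cov_decay; exact: leq_trans nn0.
  have := cascade_bound_step (q0 n) k0 e0 hk IH.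
  rewrite (_ : U0 + 1 - s n + (s n - s n.+1) = U0 + 1 - s n.+1); last by ring.
  move=> H K z; apply: le_trans (H K z) _.
  have B1 : q n ^+ 2 <= n%:R `^ (- 1 - 2 * eta).
    rewrite expr2 /q -powRD; last by rewrite nneq0 implybT.
    by apply: ler_powR; rewrite ?ler1n//; lra.
  have B2 : c1 * n%:R `^ (- 3 - delta) / (s n - s n.+1) ^+ 2 <=
      c2 * n%:R `^ (- 1 - 2 * eta).
    apply: (@le_trans _ _ (c1 * n%:R `^ (- 3 - delta) /
       (eta * n.+1%:R `^ (- 1 - eta)) ^+ 2)).
      rewrite ler_wpM2l// lef_pV2 ?posrE ?exprn_gt0// lerXn2r// nnegrE ltW//.
    rewrite exprMn -[(_ `^ _) ^+ 2]powR_mulrn ?powR_ge0// -powRrM invfM -powRN.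
    have -> : - ((- 1 - eta) * 2%:R) = 2 + 2 * eta by ring.
    have h := powR_natS n_gt0 (_ : 0 <= 2 + 2 * eta).
    apply: (@le_trans _ _ (c1 * n%:R `^ (- 3 - delta) *
       ((eta ^+ 2)^-1 * (2 `^ (2 + 2 * eta) * n%:R `^ (2 + 2 * eta))))).
      rewrite ler_wpM2l// ler_wpM2l ?invr_ge0 ?sqr_ge0// h//.
      by rewrite addr_ge0// mulr_ge0// ltW.
    have -> : n%:R `^ (- 1 - 2 * eta) = n%:R `^ (- 3 - delta) * n%:R `^ (2 + 2 * eta) :> R.
      rewrite -powRD; last by rewrite nneq0 implybT.
      by congr (_ `^ _); rewrite /eta; field.
    by rewrite /c2 le_eqVlt; apply/orP; left; apply/eqP; ring.
  apply: (@le_trans _ _ (npairs * (1 + c2) * n%:R `^ (- 1 - 2 * eta))).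
    by rewrite -mulrA ler_wpM2l// mulrDl mul1r lerD.
  rewrite -[leRHS]/(n.+1%:R `^ (- 1 - eta)).
  have q1 : 0 < n.+1%:R `^ (1 + eta) :> R by rewrite powR_gt0// ltr0n.
  rewrite (_ : - 1 - eta = - (1 + eta)); last by ring.
  rewrite powRN -[leRHS]mul1r ler_pdivlMr//.
  have Dn : D <= n%:R `^ eta.
    have e : D = (D `^ eta^-1) `^ eta.
      by rewrite -powRrM mulVf ?lt0r_neq0// powRr1// ltW.
    rewrite [leLHS]e; apply: ge0_ler_powR; rewrite ?nnegrE ?powR_ge0 ?(ltW eta0)//.
    by rewrite (le_trans n0D)// ler_nat.
  have h := powR_natS n_gt0 (_ : 0 <= 1 + eta).
  apply: (@le_trans _ _ (npairs * (1 + c2) * n%:R `^ (- 1 - 2 * eta) *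
     (2 `^ (1 + eta) * n%:R `^ (1 + eta)))).
    rewrite ler_wpM2l ?mulr_ge0 ?powR_ge0 ?addr_ge0// h// addr_ge0// ltW//.
  have -> : npairs * (1 + c2) * n%:R `^ (- 1 - 2 * eta) * (2 `^ (1 + eta) * n%:R `^ (1 + eta))
     = (D - 1) * (n%:R `^ (- 1 - 2 * eta) * n%:R `^ (1 + eta)) by rewrite /D; ring.
  rewrite -powRD; last by rewrite nneq0 implybT.
  have -> : - 1 - 2 * eta + (1 + eta) = - eta by ring.
  rewrite powRN ler_pdivrMr ?powR_gt0// mul1r; lra.
exists (U0 + 1) => u uU n nn0.
apply: cascade_bound_le (main n nn0).
by rewrite (le_trans _ uU)// gerBl powR_ge0.
Qed.
End renormalisation.

(** * Planar duality *)

Section planar_duality.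
Local Notation pt := (int * int)%type.

Definition nnadj (p q : pt) := (`|p.1 - q.1| + `|p.2 - q.2| == 1)%N.
Definition staradj (p q : pt) := (`|p.1 - q.1| <= 1)%N && (`|p.2 - q.2| <= 1)%N.

Variables (good : pt -> bool) (N : nat).
Let o : pt := (0, 0).
Hypothesis good0 : good o.

(** [chi] is the cluster of the origin, [delta] the set of bad sites joined to the positive
half-axis by a chain of bad sites. *)
Let chi p := `[< exists s, [/\ path nnadj o s, all good s & last o s = p] >].
Let delta p := `[< exists (a : nat) s, [/\ (0 < a)%N, path staradj (a%:Z, 0) s,
  all (predC good) ((a%:Z, 0) :: s) & last (a%:Z, 0) s = p] >].

Hypothesis bounded_cluster : forall s, path nnadj o s -> all good s ->
  (`|(last o s).1| < N)%N /\ (`|(last o s).2| < N)%N.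

Let chi_good p : chi p -> good p.
Proof.
move/asboolP => [s [_ gs <-]]; case: s gs => [//|q s] /allP; apply.
by rewrite /= mem_last.
Qed.

Let chi_nn p q : nnadj p q -> chi p -> good q -> chi q.
Proof.
move=> pq /asboolP[s [ps gs lp]] gq; apply/asboolP; exists (rcons s q).
by rewrite rcons_path all_rcons last_rcons ps gs gq lp.
Qed.

Let delta_bad p : delta p -> ~~ good p.
Proof.
move/asboolP => [a [s [_ _ /allP h <-]]].
by have := h _ (mem_last _ s).
Qed.

Let delta_star p q : staradj p q -> delta p -> ~~ good q -> delta q.
Proof.
move=> pq /asboolP[a [s [a0 ps gs lp]]] gq; apply/asboolP; exists a, (rcons s q).
rewrite rcons_path last_rcons ps lp pq; split => //.
by move: gs => /= /andP[-> gs]; rewrite all_rcons gs /= gq.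
Qed.

Let chi_out p : (N <= `|p.1|)%N || (N <= `|p.2|)%N -> chi p = false.
Proof.
move=> out; apply/negP => /asboolP[s [ps gs lp]].
by have := bounded_cluster ps gs; rewrite lp; lia.
Qed.

(** Edges of the boundary of the cluster whose outer end lies in the part of the outer
boundary joined to the positive half-axis. Each unit face contains an even number of them
([face]), so that their number on a row does not depend on the row modulo 2. *)
Let e p q := (chi p && delta q) (+) (chi q && delta p).

(** Between sites whose bad ones are in [delta], [e] counts all the boundary edges of the
cluster. *)
Let eE p q : nnadj p q -> delta p || delta q || chi p || chi q ->
  (~~ good p -> delta p) -> (~~ good q -> delta q) -> e p q = chi p (+) chi q.
Proof.
move=> pq _ hp hq; have qp : nnadj q p by move: pq; rewrite /nnadj; lia.
rewrite /e; case cp : (chi p); case cq : (chi q) => //=.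
- by rewrite !(contraNF (@delta_bad _))// chi_good.
- case gq : (good q); first by rewrite (chi_nn pq) in cq.
  by rewrite hq ?gq.
- case gp : (good p); first by rewrite (chi_nn qp) in cp.
  by rewrite hp ?gp.
Qed.

(** If some corner of the face is in [delta], then so are all its bad corners, since the
corners of a face are pairwise adjacent for chains; the boundary edges of a set always meet
a face an even number of times. *)
Let face (x y : int) :
  e (x, y) (x + 1, y) (+) e (x + 1, y) (x + 1, y + 1) =
  e (x, y) (x, y + 1) (+) e (x, y + 1) (x + 1, y + 1).
Proof.
case D : [|| delta (x, y), delta (x + 1, y), delta (x, y + 1) | delta (x + 1, y + 1)];
  last first.
  move: D; rewrite /e; case: (delta (x, y)) => //=; case: (delta (x + 1, y)) => //=.
  by case: (delta (x, y + 1)) => //= ->; rewrite !andbF.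
have all4 p : (p \in [:: (x, y); (x + 1, y); (x, y + 1); (x + 1, y + 1)]) ->
    ~~ good p -> delta p.
  move=> hp gp.
  have st q : q \in [:: (x, y); (x + 1, y); (x, y + 1); (x + 1, y + 1)] -> staradj q p.
    move: hp; rewrite !inE => /or4P[] /eqP -> /or4P[] /eqP ->; rewrite /staradj /=; lia.
  case/or4P: D => dq; apply: delta_star dq gp; apply: st; rewrite !inE eqxx ?orbT//.
have E p q : p \in [:: (x, y); (x + 1, y); (x, y + 1); (x + 1, y + 1)] ->
    q \in [:: (x, y); (x + 1, y); (x, y + 1); (x + 1, y + 1)] -> nnadj p q ->
    e p q = chi p (+) chi q.
  move=> hp hq pq; case cc : (delta p || delta q || chi p || chi q).
    by apply: eE => //; exact: all4.
  by move: cc; rewrite /e; case: (delta p); case: (delta q); case: (chi p); case: (chi q).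
rewrite !E ?inE ?eqxx ?orbT//; try by rewrite /nnadj /=; lia.
Qed.

(** Parity of the number of counted horizontal edges on row [y], from the abscissa
[- N] on, and indicator of the vertical edge after [m] steps. *)
Let H (y : int) (m : nat) :=
  \big[addb/false]_(i < m) e (- N%:Z + i%:Z, y) (- N%:Z + i.+1%:Z, y).
Let v (y : int) (m : nat) := e (- N%:Z + m%:Z, y) (- N%:Z + m%:Z, y + 1).

Let row y m : H y m (+) H (y + 1) m = v y 0 (+) v y m.
Proof.
elim: m => [|m IH]; first by rewrite /H !big_ord0 !addbb.
rewrite /H !big_ord_recr /= -!/(H _ _).
have -> : v y m.+1 = v y m (+) e (- N%:Z + m%:Z, y) (- N%:Z + m.+1%:Z, y) (+)
    e (- N%:Z + m%:Z, y + 1) (- N%:Z + m.+1%:Z, y + 1).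
  have := face (- N%:Z + m%:Z) y; rewrite /v.
  rewrite (_ : - N%:Z + m%:Z + 1 = - N%:Z + m.+1%:Z); last by lia.
  by case: (e _ _); case: (e _ _); case: (e _ _); case: (e _ _).
move: IH; case: (H y m); case: (H (y + 1) m); case: (v y 0); case: (v y m) => //= _;
  by case: (e _ _); case: (e _ _).
Qed.

Let e_out p q : chi p = false -> chi q = false -> e p q = false.
Proof. by move=> a b; rewrite /e a b. Qed.

(** The parity is the same on all rows, and the rows outside the cluster contain no
edge. *)
Let H0 : H 0 (N + N) = false.
Proof.
have step (y : nat) : H y%:Z (N + N) = H y.+1%:Z (N + N).
  have := row y%:Z (N + N); rewrite /v !e_out ?chi_out//=; try by apply/orP; left; lia.
  rewrite (_ : y%:Z + 1 = y.+1%:Z); last by lia.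
  by case: (H _ _); case: (H _ _).
have all_rows (y : nat) : H 0 (N + N) = H y%:Z (N + N).
  by elim: y => // y ->; rewrite step.
rewrite (all_rows N).
rewrite /H big1// => i _; rewrite e_out// chi_out//; apply/orP; right; rewrite /=; lia.
Qed.

(** If no chain of bad sites joins the two half-axes, the negative half-axis contains no
edge counted by [e], while on the positive half-axis all boundary edges are counted. The
latter are odd in number, since the origin is in the cluster and far sites are not. This
contradicts [H0]. *)
Theorem planar_duality : exists (a b : nat) s, [/\ (0 < a)%N, (0 < b)%N,
  path staradj (a%:Z, 0) s, all (predC good) ((a%:Z, 0) :: s) &
  last (a%:Z, 0) s = (- b%:Z, 0)].
Proof.
have N0 : (0 < N)%N.
  by have [] := @bounded_cluster [::] isT isT; rewrite /=; lia.
apply: contrapT => no.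
have left_false (b : nat) : (0 < b)%N -> delta (- b%:Z, 0) = false.
  move=> b0; apply/negP => /asboolP[a [s [a0 ps gs ls]]].
  by apply: no; exists a, b, s.
have right_true (a : nat) : (0 < a)%N -> ~~ good (a%:Z, 0) -> delta (a%:Z, 0).
  by move=> a0 ga; apply/asboolP; exists a, [::]; rewrite /= ga.
have Hleft m : (m <= N)%N -> H 0 m = false.
  move=> mN; rewrite /H big1// => i _; have iN := ltn_ord i.
  have d1 : delta (- N%:Z + i%:Z, 0) = false.
    have -> : - N%:Z + i%:Z = - (N - i)%N%:Z by lia.
    by apply: left_false; lia.
  have d2 : delta (- N%:Z + i.+1%:Z, 0) = false.
    have [e0|ne] := eqVneq (i.+1 : nat) N.
      apply/negP => /delta_bad; rewrite e0.
      by rewrite (_ : - N%:Z + N%:Z = 0) ?good0//; lia.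
    have -> : - N%:Z + i.+1%:Z = - (N - i.+1)%N%:Z by lia.
    by apply: left_false; lia.
  by rewrite /e d1 d2 !andbF.
have Hright k : H 0 (N + k) = chi o (+) chi (k%:Z, 0).
  elim: k => [|k IH]; first by rewrite addn0 Hleft// addbb.
  rewrite addnS /H big_ord_recr /= -/(H _ _) IH.
  rewrite (_ : - N%:Z + (N + k)%N%:Z = k%:Z); last by lia.
  rewrite (_ : - N%:Z + (N + k).+1%:Z = k.+1%:Z); last by lia.
  have -> : e (k%:Z, 0) (k.+1%:Z, 0) = chi (k%:Z, 0) (+) chi (k.+1%:Z, 0).
    case cc : (delta (k%:Z, 0) || delta (k.+1%:Z, 0) || chi (k%:Z, 0) || chi (k.+1%:Z, 0)).
      apply: eE => //; first by rewrite /nnadj /=; lia.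
      + by case: (k) => [|k']; [rewrite good0|apply: right_true].
      + by apply: right_true.
    by move: cc; rewrite /e; do 2 case: (delta _); do 2 case: (chi _).
  by case: (chi o); case: (chi (k%:Z, 0)); case: (chi _).
have := H0; rewrite Hright (chi_out (p := (N%:Z, 0))) /=; last by apply/orP; left; lia.
by rewrite addbF => /negP; apply; apply/asboolP; exists [::].
Qed.
End planar_duality.

(** * Sampling the field on cells *)

Lemma unit_ball_self (R : realType) (d : nat) (D : domain) (x : site R d D) : unit_ball x x.
Proof.
rewrite /unit_ball /= /eucl_dist subrr /eucl_norm big1 ?sqrtr0// => i _.
by rewrite mxE expr0n.
Qed.

Section cells.
Variables (R : realType) (d : nat).
Hypothesis d_gt0 : (0 < d)%N.
Local Notation V := 'rV[int]_d.
Implicit Types (z : V) (k : nat).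

(** Projection on [-1, 1]. *)
Definition clip (r : R) : R := Num.max (-1) (Num.min 1 r).

(** Enumeration of a dense subset of the cube of half-side 1, through the countable set of
rational vectors. *)
Definition cell_offset k : 'rV[R]_d :=
  if (unpickle k : option 'rV[rat]_d) is Some q
  then \row_i clip (ratr (q ord0 i)) else 0.

(** The mesh [1 / d] makes each cell contained in the unit ball around its center, where
the supremum of the field is controlled. *)
Definition cell_center (D : domain) z : site R d D :=
  match D with
  | Lattice => z
  | Continuum => \row_i ((z ord0 i)%:~R / d%:R)
  end.

(** Neighbouring cells overlap: each has half-side [1 / d], so that it contains the
segments joining its center to those of its neighbours. *)
Definition cell_point (D : domain) z k : site R d D :=
  match D with
  | Lattice => z
  | Continuum => \row_i (((z ord0 i)%:~R + cell_offset k ord0 i) / d%:R)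
  end.

Lemma clip_bound r : `|clip r| <= 1.
Proof.
by rewrite ler_norml /clip le_max lexx /= ge_max ge_min lexx /= andbT; lra.
Qed.

Lemma clip_id r : `|r| <= 1 -> clip r = r.
Proof. by rewrite ler_norml => /andP[a b]; rewrite /clip min_r// max_r. Qed.

Lemma cell_offset_bound k i : `|cell_offset k ord0 i| <= 1.
Proof.
rewrite /cell_offset; case: unpickle => [q|]; last by rewrite mxE normr0.
by rewrite mxE; exact: clip_bound.
Qed.

Lemma coord_le_eucl_norm (x : 'rV[R]_d) i : `|x ord0 i| <= eucl_norm x.
Proof.
rewrite /eucl_norm -sqrtr_sqr ler_wsqrtr// (bigD1 i)//= lerDl.
by apply: sumr_ge0 => j _; exact: sqr_ge0.
Qed.

Let dR : 0 < d%:R :> R. Proof. by rewrite ltr0n. Qed.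

Lemma cell_point_unit_ball D z k : unit_ball (cell_center D z) (cell_point D z k).
Proof.
case: D; first exact: unit_ball_self.
rewrite /unit_ball /= /eucl_dist /= /eucl_norm -[leRHS]sqrtr1 ler_wsqrtr//.
rewrite (@le_trans _ _ (\sum_(i < d) d%:R^-1))//; last first.
  by rewrite sumr_const card_ord -[_ *+ _]mulr_natr mulVf// gt_eqF.
apply: ler_sum => i _; rewrite !mxE -mulrBl addrAC subrr add0r exprMn.
have h := cell_offset_bound k i.
rewrite (@le_trans _ _ (1 * d%:R^-1 ^+ 2))// ?ler_wpM2r ?sqr_ge0//.
  by rewrite -[_ ^+ 2]real_normK ?num_real// expr_le1.
rewrite mul1r expr2 ler_piMl ?invr_ge0 ?(ltW dR)// invf_le1// ler1n//.
Qed.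

Lemma cell_point_dist D z z' k k' r : apart r z z' ->
  (r%:R - 2) / d%:R <= eucl_dist (cell_point D z k) (cell_point D z' k').
Proof.
move=> [i hi].
have hR : r%:R <= `|(z ord0 i)%:~R - (z' ord0 i)%:~R| :> R.
  by rewrite -intrB -intr_norm -[r%:R]/(r%:~R) ler_int; lia.
case: D; rewrite /eucl_dist /=; apply: le_trans (coord_le_eucl_norm _ i); rewrite !mxE.
  apply: le_trans hR; rewrite ler_pdivrMr//.
  have : 1 <= d%:R :> R by rewrite ler1n.
  by have : 0 <= r%:R :> R by []; nra.
rewrite -mulrBl normrM [`|d%:R^-1|]ger0_norm ?invr_ge0 ?(ltW dR)//.
rewrite ler_wpM2r ?invr_ge0 ?(ltW dR)//.
have h1 := cell_offset_bound k i; have h2 := cell_offset_bound k' i.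
move: hR h1 h2; set a := (z ord0 i)%:~R; set b := (z' ord0 i)%:~R.
set s := cell_offset k _ _; set t := cell_offset k' _ _ => hR h1 h2.
have -> : a + s - (b + t) = (a - b) + (s - t) by ring.
have := lerB_normD (a - b) (s - t); have := ler_normB s t; lra.
Qed.

Definition continuous_sample D (h : site R d D -> R) : Prop :=
  (match D return (site R d D -> R) -> Prop with
   | Lattice => fun=> True
   | Continuum => fun h : 'rV[R]_d -> R => continuous h
   end) h.

(** Rational points are dense, and [{h > a}] is open. *)
Lemma cell_dense (h : 'rV[R]_d -> R) z (p : 'rV[R]_d) (a : R) : continuous h ->
  (forall i, `|d%:R * p ord0 i - (z ord0 i)%:~R| <= 1) -> a < h p ->
  exists k, a < h (cell_point Continuum z k).
Proof.
move=> ch hp ap.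
have /(_ _ ap) : forall b, b < h p -> \forall y \near p, b < h y.
  by move=> b bp; exact: (cvgr_gt (h p) (ch p)).
move=> /nbhs_ballP[e /= e0 he].
pose th i := d%:R * p ord0 i - (z ord0 i)%:~R.
have /(_ _)/cid hq i : exists q : rat, `|ratr q| <= 1 :> R /\ `|th i - ratr q| < e.
  have := hp i; rewrite -/(th i) ler_norml => /andP[t1 t2].
  have lt : Num.max (-1) (th i - e) < Num.min 1 (th i + e).
    by rewrite lt_min !gt_max; apply/andP; split; apply/andP; split; lra.
  have [q] := rat_in_itvoo lt; rewrite in_itv /= gt_max lt_min.
  move=> /andP[/andP[? ?] /andP[? ?]]; exists q; split; first by rewrite ler_norml !ltW.
  by rewrite ltr_norml; apply/andP; split; lra.
exists (pickle (\row_i sval (hq i) : 'rV[rat]_d)); apply: he.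
split=> // i j; rewrite [i]ord1 /ball /= !mxE /cell_offset pickleK !mxE.
have [h1 h2] := svalP (hq j); rewrite clip_id//.
move: h1 h2; move: (ratr _) => q h1 h2.
have -> : p 0 j - ((z ord0 j)%:~R + q) / d%:R = (th j - q) / d%:R.
  by rewrite /th -[p 0 j]/(p ord0 j); field; rewrite gt_eqF.
rewrite normrM [X in _ * X]ger0_norm ?invr_ge0 ?(ltW dR)//.
rewrite (le_lt_trans _ h2)// ler_piMr// invf_le1// ler1n//.
Qed.

Lemma unbounded_coord (A : set 'rV[R]_d) : ~ bounded_set A <->
  forall M, exists2 x, A x & exists i, M < `|x ord0 i|.
Proof.
split=> [nb M|h].
  apply: contrapT => no; apply: nb.
  exists (Num.max M 0); split; first exact: num_real.
  move=> N MN x Ax; rewrite /= [`|x|]mx_normrE; apply: bigmax_le => [|[i j] _] /=.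
    by rewrite (le_trans _ (ltW MN))// le_max lexx orbT.
  rewrite [i]ord1 (le_trans _ (ltW MN))// le_max; apply/orP; left.
  by rewrite leNgt; apply/negP => Mx; apply: no; exists x => //; exists j.
move=> [M [_ hM]]; have [x Ax [i]] := h (`|M| + 1).
have : M < `|M| + 1 by rewrite (le_lt_trans (ler_norm _))// ltrDl.
move=> /hM/(_ x Ax) /= xM; rewrite ltNge (le_trans _ xM)//.
by rewrite [`|x|]mx_normrE; exact: (le_bigmax _ (fun i : 'I_1 * 'I_d => `|x i.1 i.2|) (ord0, i)).
Qed.
End cells.

(** * Percolation produces chains of bad cells *)

Section geometry.
Variables (R : realType) (d : nat).
Hypothesis d_gt0 : (0 < d)%N.
Local Notation V := 'rV[int]_d.

(** Connectedness of the unit interval, in the form of a chaining principle: a locally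
trivial equivalence relation relates the end points. *)
Lemma segment_chain (E : R -> R -> Prop) : E 0 0 -> (forall a b, E a b -> E b a) ->
  (forall a b c, E a b -> E b c -> E a c) ->
  (forall t, 0 <= t <= 1 -> exists2 e, 0 < e &
     forall t', 0 <= t' <= 1 -> `|t - t'| < e -> E t t') -> E 0 1.
Proof.
move=> E00 Es Et loc; pose S := [set t : R | 0 <= t <= 1 /\ E 0 t].
have S0 : S 0 by split => //; rewrite lexx ler01.
have ubS : ubound S 1 by move=> t [/andP[]].
have hS : has_sup S by split; [exists 0|exists 1].
pose s := sup S.
have s0 : 0 <= s by apply: ub_le_sup => //; exists 1.
have s1 : s <= 1 by apply: ge_sup => //; exists 0.
have [|e e0 he] := loc s; first by rewrite s0.
have [t [t01 Et0] st] := sup_adherent e0 hS.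
have ts : t <= s by apply: ub_le_sup; [exists 1|split].
have E0s : E 0 s.
  apply: Et Et0 _; apply: Es; apply: he => //.
  by rewrite ger0_norm ?subr_ge0// ltrBlDr -ltrBlDl.
have [->//|sn1] := eqVneq (1 : R) s.
have lt1 : s < 1 by rewrite lt_neqAle s1 eq_sym sn1.
pose t' := Num.min 1 (s + e / 2).
have t's : s < t' by rewrite lt_min lt1 ltrDl divr_gt0.
have t'01 : 0 <= t' <= 1 by rewrite (le_trans s0 (ltW t's)) ge_min lexx.
have : t' <= s.
  apply: ub_le_sup; first by exists 1.
  split => //; apply: Et E0s _; apply: he => //.
  rewrite distrC ger0_norm ?subr_ge0 ?(ltW t's)// ltrBlDr.
  by rewrite (@le_lt_trans _ _ (s + e / 2))// ?ge_min ?lexx ?orbT// addrC ltrD2r; lra.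
by rewrite leNgt t's.
Qed.

(** A lattice path is itself a chain. In the continuum, the cells of two nearby points of
a path are adjacent, and [segment_chain] makes a finite chain out of them. *)
Lemma percolation_chains (D : domain) (h : site R d D -> R) (l u : R) :
  continuous_sample h -> u < - l -> has_unbounded_component [set x | 0 <= h x + l] ->
  exists z0 : V, forall m, exists s, [/\ path (within 1) z0 s,
    forall y, y \in z0 :: s -> exists k, u < h (cell_point R D y k) &
    apart m z0 (last z0 s)].
Proof.
move=> ch ul [x Ax unb].
have bad y : 0 <= h y + l -> u < h y by move=> *; lra.
case: D h ch x Ax unb bad => h ch x Ax unb bad.
  exists x => m.
  have [_ [y [s [ps <- As]] <-] [i hi]] :=
    ((unbounded_coord _).1 unb) ((\sum_i `|x ord0 i|)%N%:R + m%:R).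
  exists s; split.
  - apply: sub_path ps => p q /eqP e; apply/withinP => j.
    have : `|p ord0 j - q ord0 j| <= \sum_(i < d) `|p ord0 i - q ord0 i|.
      by rewrite (bigD1 j)//= lerDl sumr_ge0.
    by rewrite e; lia.
  - by move=> y0 ys; exists 0%N; exact/bad/As.
  - exists i; move: hi; rewrite /= mxE -natrD -intr_norm pmulrn ltr_int.
    have : (`|x ord0 i| <= \sum_j `|x ord0 j|)%N by rewrite (bigD1 i)//= leq_addr.
    move: (\sum_j _)%N (x ord0 i) (last x s ord0 i) => S a b; lia.
have dR : 0 < d%:R :> R by rewrite ltr0n.
(* the point [p] lies in the cell [fl p] *)
pose fl (p : 'rV[R]_d) : V := \row_i Num.floor (d%:R * p ord0 i).
have flb p i : (fl p ord0 i)%:~R <= d%:R * p ord0 i < (fl p ord0 i)%:~R + 1.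
  by rewrite /fl mxE floor_le /= -intrD1 floorD1_gt.
exists (fl x) => m.
have [_ [y [ga [cga ga0 ga1 Aga]] <-] [i hi]] :=
  ((unbounded_coord _).1 unb) (\sum_i `|x ord0 i| + m%:R + 1).
pose E t t' := exists s, [/\ path (within 1) (fl (ga t)) s, last (fl (ga t)) s = fl (ga t') &
  forall y, y \in fl (ga t) :: s -> exists k, u < h (cell_point R Continuum y k)].
have badga t : 0 <= t <= 1 -> exists k, u < h (cell_point R Continuum (fl (ga t)) k).
  move=> t01; apply: (cell_dense d_gt0 ch (p := ga t)).
    by move=> j; have := flb (ga t) j; rewrite ler_norml => /andP[? ?]; apply/andP; split; lra.
  by apply: bad; apply: Aga; rewrite in_itv.
have [s [ps ls bs]] : E 0 1.
  apply: segment_chain.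
  - exists [::]; split => // y0; rewrite inE => /eqP ->; apply: badga.
    by rewrite lexx ler01.
  - move=> a b [s [ps ls bs]]; have [s' [ps' ls' sub]] := star_chain_rev ps.
    by exists s'; rewrite -ls; split => // y0 /sub; exact: bs.
  - move=> a b c [s [ps ls bs]] [s' [ps' ls' bs']]; exists (s ++ s').
    rewrite cat_path last_cat ps ls ps' ls'; split => // y0.
    rewrite -cat_cons mem_cat => /orP[ys|ys]; first exact: bs.
    apply: bs'.
    by rewrite inE ys orbT.
  - move=> t t01.
    have tI : `[0, 1]%classic t by rewrite /= in_itv.
    have /subspace_continuousP/(_ t tI) ct := cga.
    have : nbhs (ga t) (ball (ga t) (d%:R^-1)) by apply: nbhsx_ballx; rewrite invr_gt0.
    move=> /ct; rewrite /fmap /= /within /= => /nbhs_ballP[e /= e0 he].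
    exists e => // t' t'01 tt'.
    have tI' : `[0, 1]%classic t' by rewrite /= in_itv.
    have [_ hb] := he t' tt' tI'.
    exists [:: fl (ga t')]; split => //=.
      rewrite andbT; apply/withinP => j.
      have := hb ord0 j; rewrite /ball /= => hj.
      have hj' : `|d%:R * ga t ord0 j - d%:R * ga t' ord0 j| < 1.
        rewrite -mulrBr normrM (ger0_norm (ltW dR)) mulrC -ltr_pdivlMr// div1r.
        exact: hj.
      have /andP[a1 a2] := flb (ga t) j; have /andP[b1 b2] := flb (ga t') j.
      move: hj'; rewrite ltr_norml => /andP[c1 c2].
      have : (fl (ga t) ord0 j)%:~R < (fl (ga t') ord0 j)%:~R + 2 :> R by lra.
      have : (fl (ga t') ord0 j)%:~R < (fl (ga t) ord0 j)%:~R + 2 :> R by lra.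
      rewrite -[2]/(2%:~R) -!intrD !ltr_int.
      by clear; move: (fl (ga t) ord0 j) (fl (ga t') ord0 j) => p q; lia.
    by move=> y0; rewrite !inE => /orP[] /eqP ->; exact: badga.
rewrite ga0 in ps ls bs; rewrite ga1 in ls.
exists s; split => //; exists i; rewrite ls.
have /andP[a1 a2] := flb x i; have /andP[b1 b2] := flb y i.
have xi : `|x ord0 i| <= \sum_j `|x ord0 j| by rewrite (bigD1 i)//= lerDl sumr_ge0.
have d1 : 1 <= d%:R :> R by rewrite ler1n.
have far : m%:R + 1 <= `|d%:R * x ord0 i - d%:R * y ord0 i|.
  rewrite -mulrBr normrM (ger0_norm (ltW dR)).
  have h1 : m%:R + 1 <= `|x ord0 i - y ord0 i|.
    by have := lerB_dist (y ord0 i) (x ord0 i); rewrite distrC; lra.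
  by rewrite (le_trans h1)// ler_peMl.
have : m%:R <= `|(fl x ord0 i)%:~R - (fl y ord0 i)%:~R| :> R.
  by move: far; rewrite !ler_normr => /orP[] ?; apply/orP; [left|right]; lra.
rewrite -intrB -intr_norm -[m%:R]/(m%:~R) ler_int.
by clear; move: (fl x ord0 i) (fl y ord0 i) => p q; lia.
Qed.
End geometry.

(** * Clusters of good cells percolate *)

Section polygon.
Variables (R : realType) (d : nat).
Local Notation pt := 'rV[R]_d.

(** The path through the points [v 0], ..., [v n], each segment being run in time
[1 / n]. *)
Definition polygon (v : nat -> pt) (n : nat) (t : R) : pt :=
  v 0%N + \sum_(k < n) clamp (n%:R * t - k%:R) *: (v k.+1 - v k).

Lemma polygon_partial (v : nat -> pt) (x : R) m : m%:R <= x ->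
  v 0%N + \sum_(k < m) clamp (x - k%:R) *: (v k.+1 - v k) = v m.
Proof.
elim: m => [|m IH] mx; first by rewrite big_ord0 addr0.
rewrite big_ord_recr /= addrA IH; last by rewrite (le_trans _ mx)// ler_nat.
rewrite clamp1; first by rewrite scale1r addrC subrK.
by rewrite lerBrDr addrC natr1.
Qed.

Lemma polygon_piece (v : nat -> pt) (x : R) k m : (k < m)%N -> k%:R <= x <= k.+1%:R ->
  v 0%N + \sum_(j < m) clamp (x - j%:R) *: (v j.+1 - v j) =
  v k + (x - k%:R) *: (v k.+1 - v k).
Proof.
move=> km /andP[kx xk]; elim: m km => // m IH; rewrite ltnS leq_eqVlt => /orP[/eqP <-|km].
  rewrite big_ord_recr /= addrA polygon_partial// clamp_id// subr_ge0 kx /=.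
  by rewrite lerBlDr addrC natr1.
rewrite big_ord_recr /= addrA IH// clamp0 ?scale0r ?addr0//.
by rewrite subr_le0 (le_trans xk)// ler_nat.
Qed.

Lemma continuous_polygon v n : continuous (polygon v n).
Proof.
suff H m (t : R) : (v 0%N + \sum_(k < m) clamp (n%:R * x - k%:R) *: (v k.+1 - v k))
    @[x --> t] --> v 0%N + \sum_(k < m) clamp (n%:R * t - k%:R) *: (v k.+1 - v k).
  by move=> t; exact: H.
elim: m => [|m IH].
  rewrite big_ord0; under eq_fun do rewrite big_ord0; exact: cvg_cst.
rewrite big_ord_recr /= addrA; under eq_fun do rewrite big_ord_recr /= addrA.
apply: cvgD; first exact: IH.
apply: cvgZr_tmp.
apply: (@cvg_comp _ _ _ (fun x : R => n%:R * x - m%:R) (@clamp R)); last exact: continuous_clamp.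
apply: cvgB; last exact: cvg_cst.
by apply: cvgM; [exact: cvg_cst|exact: cvg_id].
Qed.
End polygon.

Section cluster.
Variables (R : realType) (d : nat).
Local Notation V := 'rV[int]_d.

(** The coordinate plane in which the percolating path is found. *)
Definition plane (p : int * int) : V :=
  \row_i (if val i == 0%N then p.1 else if val i == 1%N then p.2 else 0).

Lemma plane_dist p q i : (`|plane p ord0 i - plane q ord0 i| <=
  `|p.1 - q.1| + `|p.2 - q.2|)%N.
Proof. by rewrite !mxE; case: ifP => _; [|case: ifP => _]; lia. Qed.

Hypothesis d_ge2 : (2 <= d)%N.
Let d_gt0 : (0 < d)%N. Proof. exact: leq_trans d_ge2. Qed.

Definition i0 : 'I_d := Ordinal d_gt0.
Definition i1 : 'I_d := Ordinal (d_ge2 : (1 < d)%N).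

Lemma plane_nn p q : nnadj p q -> nearest_neighbour (plane p) (plane q).
Proof.
move=> /eqP pq; rewrite /nearest_neighbour (bigD1 i0)//= (bigD1 i1)//=.
rewrite big1 ?addr0; last first.
  move=> i /andP[n0 n1]; rewrite !mxE.
  have -> : (val i == 0%N) = false by apply: contraNF n0 => /eqP e; apply/eqP/val_inj.
  have -> : (val i == 1%N) = false by apply: contraNF n1 => /eqP e; apply/eqP/val_inj.
  by rewrite subrr.
by rewrite !mxE /=; apply/eqP; lia.
Qed.

(** The lattice path in the cluster is mapped to the plane; in the continuum, the polygon
through the centers of the cells stays in the cells, where the field is large at a dense set
of points, hence everywhere. *)
Lemma cluster_percolates (D : domain) (h : site R d D -> R) (u : R) :
  continuous_sample h ->
  (forall m, exists s, [/\ path nnadj (0, 0) s,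
     forall p, p \in (0, 0) :: s -> forall k, - u <= h (cell_point R D (plane p) k) &
     (m <= `|(last (0%R, 0%R) s).1|)%N \/ (m <= `|(last (0%R, 0%R) s).2|)%N]) ->
  has_unbounded_component [set x | 0 <= h x + u].
Proof.
move=> ch cl.
have far s m : (m <= `|(last (0%R, 0%R) s).1|)%N \/ (m <= `|(last (0%R, 0%R) s).2|)%N ->
    exists i, (m <= `|plane (last (0%R, 0%R) s) ord0 i|)%N.
  by move=> [hm|hm]; [exists i0|exists i1]; rewrite mxE.
case: D h ch cl => h ch cl.
  exists (plane (0, 0)).
    have [s [_ gs _]] := cl 0%N; rewrite /= -lerBlDr sub0r.
    exact: (gs (0, 0) (mem_head _ _) 0%N).
  apply/unbounded_coord => M.
  have [s [ps gs /far[i hi]]] := cl (Num.truncn `|M|).+1.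
  exists (@embed R d Lattice (plane (last (0%R, 0%R) s))).
    exists (plane (last (0%R, 0%R) s)) => //; exists (map plane s); split.
    - by rewrite path_map; apply: sub_path ps => p q; exact: plane_nn.
    - by rewrite last_map.
    - move=> z; rewrite -(map_cons plane) => /mapP[p ps' ->] /=; rewrite -lerBlDr sub0r.
      exact: (gs p ps' 0%N).
  exists i; rewrite /= mxE (le_lt_trans (ler_norm _))// (lt_le_trans (truncnS_gt _))//.
  by rewrite -intr_norm pmulrn ler_int -abszE lez_nat.
have dR : 0 < d%:R :> R by rewrite ltr0n.
have cell_ge z (p : 'rV[R]_d) : (forall k, - u <= h (cell_point R Continuum z k)) ->
    (forall i, `|d%:R * p ord0 i - (z ord0 i)%:~R| <= 1) -> 0 <= h p + u.
  move=> gz hp; rewrite leNgt; apply/negP => hu.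
  have ch' : continuous (fun y : 'rV[R]_d => - h y : R).
    by move=> y; apply: (continuous_comp (ch y)); exact: opp_continuous.
  have [|k] := cell_dense d_gt0 (a := u) ch' hp; first by lra.
  by have := gz k; lra.
have centerE (z : V) i : d%:R * cell_center R Continuum z ord0 i = (z ord0 i)%:~R.
  by rewrite /= mxE mulrCA mulfV ?mulr1// gt_eqF.
exists (cell_center R Continuum (plane (0, 0))).
  have [s [_ gs _]] := cl 0%N.
  apply: (cell_ge (plane (0, 0))) => [k|i]; first exact: (gs (0, 0) (mem_head _ _)).
  by rewrite centerE subrr normr0.
apply/unbounded_coord => M.
have [s [ps gs /far[i hi]]] := cl (Num.truncn (d%:R * `|M|)).+1.
pose v k := cell_center R Continuum (plane (nth (0, 0) ((0, 0) :: s) k)).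
exists (v (size s)).
  exists (v (size s)) => //.
  exists (polygon v (size s)); split.
  - by apply: continuous_subspaceT; exact: continuous_polygon.
  - rewrite /polygon mulr0 big1 ?addr0// => k _.
    by rewrite clamp0 ?scale0r// sub0r oppr_le0.
  - by rewrite /polygon mulr1 polygon_partial.
  - move=> t; rewrite in_itv /= => /andP[t0 t1].
    have [s0|s0] := posnP (size s).
      rewrite /polygon s0 big_ord0 addr0; apply: (cell_ge (plane (0, 0))) => [k|j].
        exact: (gs (0, 0) (mem_head _ _)).
      by rewrite centerE subrr normr0.
    set x := (size s)%:R * t.
    have x0 : 0 <= x by rewrite mulr_ge0.
    have xs : x <= (size s)%:R by rewrite ler_piMr.
    pose k := minn (Num.truncn x) (size s).-1.
    have ks : (k < size s)%N by rewrite /k; lia.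
    have kx : k%:R <= x <= k.+1%:R.
      have := truncn_itv x0 => /andP[a b]; apply/andP; split.
        by rewrite (le_trans _ a)// ler_nat geq_minl.
      have [le|le] := leqP (Num.truncn x) (size s).-1.
        by rewrite /k (minn_idPl le) ltW.
      by rewrite /k (minn_idPr (ltnW le)) prednK.
    rewrite /polygon -/x (polygon_piece _ ks kx).
    set z := plane (nth (0, 0) ((0, 0) :: s) k).
    apply: (cell_ge z) => [j|j].
      by apply: gs; rewrite mem_nth//= ltnS ltnW.
    have hv l : d%:R * v l ord0 j = (plane (nth (0, 0) ((0, 0) :: s) l) ord0 j)%:~R.
      exact: centerE.
    have -> : d%:R * (v k + (x - k%:R) *: (v k.+1 - v k)) ord0 j - (z ord0 j)%:~R =
        (x - k%:R) * (d%:R * v k.+1 ord0 j - d%:R * v k ord0 j).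
      rewrite /z -hv; move: (v k) (v k.+1) => p q; rewrite !mxE; ring.
    rewrite !hv.
    have nnk : nnadj (nth (0, 0) ((0, 0) :: s) k) (nth (0, 0) s k).
      by move/(pathP (0, 0)) : ps => /(_ k ks).
    rewrite normrM -[leRHS]mulr1 ler_pM//.
      by move/andP: kx => [a b]; rewrite ger0_norm ?subr_ge0// lerBlDr addrC natr1.
    rewrite -intrB -intr_norm -[1]/(1%:~R) ler_int.
    have := plane_dist (nth (0, 0) s k) (nth (0, 0) ((0, 0) :: s) k) j.
    by move/eqP: nnk; rewrite !mxE; lia.
exists i; rewrite -(ltr_pM2l dR) -[d%:R in X in _ < X](ger0_norm (ltW dR)) -normrM centerE.
rewrite nth_last /= in hi *.
rewrite (le_lt_trans (ler_wpM2l (ltW dR) (ler_norm M)))//.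
by rewrite (lt_le_trans (truncnS_gt _))// -intr_norm pmulrn ler_int -abszE lez_nat.
Qed.
End cluster.

(** * Percolation in terms of cascades *)

Section blocking.
Variables (R : realType) (d : nat).
Hypothesis d_ge2 : (2 <= d)%N.
Local Notation V := 'rV[int]_d.
Let d_gt0 : (0 < d)%N. Proof. exact: leq_trans d_ge2. Qed.

Lemma percolation_cascades (D : domain) (h : site R d D -> R) (l u : R) :
  continuous_sample h -> u < - l -> has_unbounded_component [set x | 0 <= h x + l] ->
  exists z0 : V, forall n, exists K,
    u < cascade K.+1 n (fun z k => h (cell_point R D z k)) z0.
Proof.
move=> ch ul perc; have [z0 chain] := percolation_chains d_gt0 ch ul perc.
exists z0 => n; have [s [ps bad far]] := chain (8 ^ n)%N.
by apply: (crossing_cascade d_gt0 ps bad _ far) => i; rewrite subrr muln0.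
Qed.

(** If [|r|] exceeds [8 ^ n0], take the scale [n] with [8 ^ n <= |r| < 8 ^ n.+1] and round
[r] to the nearest multiple of [8 ^ n]: the quotient is at most 8. *)
Lemma axis_crossing_cascade (g : V -> nat -> R) u n0 (r r' : int) (s : seq V) :
  path (within 1) (plane d (r, 0)) s ->
  (forall y, y \in plane d (r, 0) :: s -> exists k, u < g y k) ->
  last (plane d (r, 0)) s = plane d (r', 0) -> (`|r| <= `|r - r'|)%N ->
  (exists2 t : int, (`|t| <= 8 ^ n0)%N & exists K, u < cascade K.+1 0 g (plane d (t, 0))) \/
  (exists2 n, (n0 <= n)%N & exists2 j : int, (`|j| <= 8)%N &
     exists K, u < cascade K.+1 n g (plane d ((8 ^ n)%:Z * j, 0))).
Proof.
move=> ps bad ls far.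
have [rn|rn] := leqP `|r| (8 ^ n0).
  left; exists r => //; have [k uk] := bad _ (mem_head _ _).
  by exists k; apply/cascade0_gt; exists k.
right; pose n := trunc_log 8 `|r|.
have r0 : (0 < `|r|)%N by apply: leq_ltn_trans rn.
have /andP[n1 n2] := trunc_log_bounds (isT : (1 < 8)%N) r0; rewrite -/n in n1 n2.
exists n; first by rewrite trunc_log_max// ltnW.
pose a := ((2 * `|r| + 8 ^ n) %/ (2 * 8 ^ n))%N.
have p0 : (0 < 8 ^ n)%N by rewrite expn_gt0.
have a8 : (a <= 8)%N.
  rewrite -ltnS ltn_divLR ?muln_gt0//; rewrite expnS in n2; lia.
have aE : (2 * `|(`|r|%:Z - (8 ^ n)%:Z * a%:Z)%R| <= 8 ^ n)%N.
  have := divn_eq (2 * `|r| + 8 ^ n) (2 * 8 ^ n).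
  have := ltn_pmod (2 * `|r| + 8 ^ n) (_ : (0 < 2 * 8 ^ n)%N).
  by rewrite -/a; lia.
exists (if (0 <= r)%R then a%:Z else - a%:Z); first by case: ifP; lia.
apply: (crossing_cascade d_gt0 ps bad).
  move=> i; rewrite (leq_trans _ aE)// leq_mul2l /=.
  set j := if _ then _ else _.
  have /= := @plane_dist d (r, 0) ((8 ^ n)%:Z * j, 0) i => le.
  apply: (leq_trans le); rewrite /j; case: ifP => r0'; lia.
exists (i0 d_ge2); rewrite ls !mxE /=; lia.
Qed.

(** By duality, if the cluster of the origin is finite there is a chain of bad cells
between two points of the axis on either side of the origin. Start it from the end farther
from the origin: it then travels at least as far as this end is from the origin. *)
Lemma no_cascade_percolates (D : domain) (h : site R d D -> R) (u : R) n0 :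
  let g z k := - h (cell_point R D z k) in continuous_sample h ->
  ~ (exists2 t : int, (`|t| <= 8 ^ n0)%N & exists K, u < cascade K.+1 0 g (plane d (t, 0))) ->
  ~ (exists2 n, (n0 <= n)%N & exists2 j : int, (`|j| <= 8)%N &
     exists K, u < cascade K.+1 n g (plane d ((8 ^ n)%:Z * j, 0))) ->
  has_unbounded_component [set x | 0 <= h x + u].
Proof.
move=> g ch no0 non.
pose good p := `[< forall k, - u <= h (cell_point R D (plane d p) k) >].
have badP p : ~~ good p -> exists k, u < g (plane d p) k.
  move/asboolPn/existsNP => -[k /negP]; rewrite -ltNge => hk.
  by exists k; rewrite /g ltrNr.
have good0 : good (0, 0).
  apply: contrapT => /negP/badP[k uk]; apply: no0; exists 0 => //.
  by exists k; apply/cascade0_gt; exists k.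
apply: (cluster_percolates d_ge2) => //.
apply: contrapT => /existsNP[N nofar].
have bounded s : path nnadj (0, 0) s -> all good s ->
    (`|(last (0, 0)%R s).1| < N)%N /\ (`|(last (0, 0)%R s).2| < N)%N.
  move=> ps gs; apply: contrapT => nb; apply: nofar; exists s; split => //.
    move=> p pin; apply/asboolP; rewrite -/(good p).
    by move: pin; rewrite inE => /predU1P[->//|/(allP gs)].
  by apply: contrapT => /not_orP[/negP h1 /negP h2]; apply: nb; rewrite !ltnNge.
have [a [b [s [a0 b0 ps bs ls]]]] := planar_duality good0 bounded.
have pps : path (within 1) (plane d (a%:Z, 0)) (map (plane d) s).
  rewrite path_map; apply: sub_path ps => p q /andP[h1 h2]; apply/withinP => i.
  by rewrite !mxE; case: ifP => _; [|case: ifP].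
have bad y : y \in plane d (a%:Z, 0) :: map (plane d) s -> exists k, u < g y k.
  by rewrite -(map_cons (plane d)) => /mapP[p /(allP bs) /badP ? ->].
have lp : last (plane d (a%:Z, 0)) (map (plane d) s) = plane d (- b%:Z, 0).
  by rewrite last_map ls.
have [ba|ab] := leqP b a.
  by case: (axis_crossing_cascade n0 pps bad lp _) => //; lia.
have [s' [ps' ls' sub]] := star_chain_rev pps; rewrite lp in ps' ls' sub.
have bad' y : y \in plane d (- b%:Z, 0) :: s' -> exists k, u < g y k.
  by move/sub; exact: bad.
by case: (axis_crossing_cascade n0 ps' bad' ls' _) => //; lia.
Qed.
End blocking.

(** * The sampled field satisfies the renormalisation hypotheses *)

Section transfer.
Context disp (Omega : measurableType disp) (R : realType) (P : probability Omega R).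
Variables (d : nat) (D : domain) (f : site R d D -> {RV P >-> R}).
Hypothesis d_gt0 : (0 < d)%N.
Local Notation V := 'rV[int]_d.

(** Markov's inequality for a function [S] that need not be measurable, such as an
uncountable supremum: the integral is defined as a supremum over simple functions below
[S]. *)
Lemma markov_sup (S : Omega -> \bar R) (A : set Omega) (u C : R) :
  measurable A -> 0 < u -> (forall w, 0 <= S w)%E -> (forall w, A w -> u%:E <= S w)%E ->
  (\int[P]_w S w <= C%:E)%E -> fine (P A) <= C / u.
Proof.
move=> mA u0 S0 AS; rewrite ge0_integralTE// => hS.
rewrite ler_pdivlMr// mulrC -lee_fin EFinM fineK ?fin_num_measure//.
apply: le_trans hS; rewrite -sintegral_indic.
have <- := sintegralrM P u (indic_nnsfun R mA).
apply: ereal_sup_ubound; exists (scale_nnsfun (indic_nnsfun R mA) (ltW u0)) => // w.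
rewrite [X in (X <= _)%E](_ : _ = (u * \1_A w)%:E)// indicE; have [wA|wA] := boolP (w \in A).
  by rewrite mulr1; apply: AS; rewrite inE in wA.
by rewrite mulr0.
Qed.

(** [e] is a sign: the lower bound on the critical level uses the field, the upper bound
its opposite. *)
Definition cell_field (e : R) (zk : V * nat) : {RV P >-> R} :=
  (e \o* f (cell_point R D zk.1 zk.2))%R.

Lemma cell_field_gaussian e : gaussian_field f -> gaussian_field (cell_field e).
Proof.
move=> fg n x a; have := fg n (fun i => cell_point R D (x i).1 (x i).2) (fun i => a i * e).
congr (gaussian_rv P _); apply/funext => w; apply: eq_bigr => i _ /=.
by rewrite -mulrA [e * _]mulrC.
Qed.

Lemma local_sup_bound : bounded_local_suprema f -> exists2 C : R, 0 <= C &
  forall x, (\int[P]_w ereal_sup [set (`|f y w|%R)%:E | y in unit_ball x] <= C%:E)%E.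
Proof.
rewrite /bounded_local_suprema; set M := ereal_sup _ => hM.
have leM x : (\int[P]_w ereal_sup [set (`|f y w|%R)%:E | y in unit_ball x] <= M)%E.
  by apply: ereal_sup_ubound; exists x.
exists (Num.max 0 (fine M)); first by rewrite le_max lexx.
move=> x; apply: le_trans (leM x) _.
move: M hM {leM} => [r||] //= _; last by rewrite leNye.
by rewrite lee_fin le_max lexx orbT.
Qed.

Lemma cell_field_tail e C : `|e| = 1 ->
  (forall x, (\int[P]_w ereal_sup [set (`|f y w|%R)%:E | y in unit_ball x] <= C%:E)%E) ->
  forall u, 0 < u -> cascade_bound (cell_field e) 0 u (C / u).
Proof.
move=> e1 hC u u0 K z.
apply: (markov_sup _ u0 _ _ (hC (cell_center R D z))).
- exact: measurable_cascade_gt.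
- move=> w; apply: le_trans (_ : 0 <= `|f (cell_center R D z) w|%:E)%E _; first by rewrite lee_fin.
  by apply: ereal_sup_ubound; exists (cell_center R D z) => //; exact: unit_ball_self.
- move=> w /cascade0_gt[k _]; rewrite /config /= => uf.
  apply: (@le_trans _ _ (`|f (cell_point R D z k) w|%:E)%E).
    rewrite lee_fin -[leRHS]mulr1 -e1 -normrM (le_trans (ltW uf))//.
    exact: ler_norm.
  apply: ereal_sup_ubound; exists (cell_point R D z k) => //.
  exact: cell_point_unit_ball.
Qed.

Lemma rcov_covariance (X : Type) (h : X -> {RV P >-> R}) x y : gaussian_field h ->
  covariance P (h x) (h y) = (rcov P (h x) (h y))%:E.
Proof.
move=> hg; rewrite unlock /rcov /Rintegral fineK; last first.
  apply: integrable_fin_num => //; apply: square_integrableM; apply: square_integrable_center;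
    exact: square_integrable_field.
rewrite !expectation.unlock.
by apply: eq_integral => w _.
Qed.

Lemma rcov_scale e (X : Type) (h : X -> {RV P >-> R}) x y : gaussian_field h -> `|e| = 1 ->
  rcov P (e \o* h x)%R (e \o* h y)%R = rcov P (h x) (h y).
Proof.
move=> hg e1.
have mZ t : rmean P (e \o* h t)%R = e * rmean P (h t).
  rewrite -rmeanZ; last exact: square_integrable_field.
  by apply: eq_Rintegral => w _ /=; rewrite mulrC.
rewrite /rcov !mZ; apply: eq_Rintegral => w _ /=.
have e2 : e * e = 1 by rewrite -expr2 -real_normK ?num_real// e1 expr1n.
by rewrite ![_ * e]mulrC -!mulrBr mulrACA e2 mul1r.
Qed.

(** Replacing [8 ^ n] by [2 ^ n] absorbs the mesh of the cells and only changes the constant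
once logarithms are taken. *)
Lemma exp8_apart (r : R) n : (maxn 1 d <= n)%N ->
  ((8 ^ n)%N%:R - 2) / d%:R <= r -> 2 ^+ n <= r.
Proof.
rewrite geq_max => /andP[n0 dn]; apply: le_trans.
have dR : 0 < d%:R :> R by rewrite ltr0n.
rewrite ler_pdivlMr// lerBrDr -natrX -natrM -natrD ler_nat.
have n2 : (n < 2 ^ n)%N by exact: ltn_expl.
have -> : (8 ^ n = 2 ^ n * (2 ^ n * 2 ^ n))%N by rewrite -!expnMn.
have : (2 <= 2 ^ n)%N by rewrite -[X in (X <= _)%N](expn1 2) leq_exp2l.
move: (2 ^ n)%N n2 => p n2 p2; nia.
Qed.

Lemma cell_field_decay e : `|e| = 1 -> gaussian_field f -> polylog_correlation_decay f ->
  exists c1 delta : R, [/\ 0 <= c1, 0 < delta & forall n (z z' : V) k k',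
    (maxn 1 d <= n)%N -> apart (8 ^ n) z z' ->
    `|rcov P (cell_field e (z, k)) (cell_field e (z', k'))| <= c1 * n%:R `^ (- 3 - delta)].
Proof.
move=> e1 fg [c [delta [c0 delta0 decay]]].
exists (c * ln 2 `^ (- 3 - delta)), delta; split => //.
  by rewrite mulr_ge0 ?powR_ge0// ltW.
move=> n z z' k k' dn far; rewrite /cell_field /= rcov_scale//.
have := cell_point_dist R d_gt0 D k k' far; set r := eucl_dist _ _ => hr.
have rn := exp8_apart dn hr.
have r0 : 0 < r by apply: lt_le_trans rn; rewrite exprn_gt0.
have := decay (cell_point R D z k) (cell_point R D z' k').
rewrite (rcov_covariance _ _ fg) /polylog -/r gt_eqF// lee_fin => /le_trans; apply.
rewrite -mulrA ler_wpM2l ?(ltW c0)//.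
have n0 : (0 < n)%N by apply: leq_trans dn; rewrite leq_max.
have ln2 : 0 < ln 2 :> R by rewrite ln_gt0// ltr1n.
have lnr : ln 2 * n%:R <= ln (1 + r).
  rewrite mulr_natr -lnXn// ler_ln ?posrE ?exprn_gt0//; last by rewrite addr_gt0.
  by rewrite (le_trans rn)// lerDr.
have nl : 0 < ln 2 * n%:R :> R by rewrite mulr_gt0// ltr0n.
have pN (t : R) : t `^ (- 3 - delta) = (t `^ (3 + delta))^-1.
  by rewrite -powRN; congr (_ `^ _); ring.
rewrite -powRM ?(ltW ln2)// !pN lef_pV2 ?posrE ?powR_gt0//; last exact: lt_le_trans lnr.
by apply: ge0_ler_powR; rewrite ?nnegrE ?(ltW nl)//; [rewrite addr_ge0// ltW|exact: ltW (lt_le_trans nl lnr)].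
Qed.
End transfer.

(** * Outer probabilities and small tails *)

Section outer_probability.
Context disp (Omega : measurableType disp) (R : realType) (P : probability Omega R).
Local Notation Po := (P^*)%mu.

Lemma outer_null (Q : Omega -> Prop) : {ae P, forall w, Q w} -> Po [set w | ~ Q w] = 0%E.
Proof.
move=> [B [mB PB QB]]; apply/eqP; rewrite eq_le outer_measure_ge0 andbT -PB.
by rewrite -(measurable_mu_extE P mB); apply: le_outer_measure.
Qed.

Lemma outer_series (A : nat -> set Omega) (a : nat -> R) (S : R) :
  (forall n, Po (A n) <= (a n)%:E)%E -> (forall m, \sum_(n < m) a n <= S) ->
  (Po (\bigcup_n A n) <= S%:E)%E.
Proof.
move=> hA hS; apply: le_trans (outer_measure_sigma_subadditive _ _) _.
apply: lime_le; first by apply: is_cvg_nneseries => *; exact: outer_measure_ge0.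
apply: nearW => m; rewrite (@le_trans _ _ (\sum_(0 <= n < m) (a n)%:E)%E)//.
  by apply: lee_sum => n _; exact: hA.
by rewrite sumEFin lee_fin big_mkord.
Qed.

Lemma outer_finite (A : nat -> set Omega) (m : nat) (q : R) :
  (forall n, Po (A n) <= q%:E)%E -> (Po (\big[setU/set0]_(n < m) A n) <= (m%:R * q)%:E)%E.
Proof.
move=> hA; apply: le_trans (outer_measure_subadditive _ _ _) _.
rewrite (@le_trans _ _ (\sum_(n < m) q%:E)%E)//; first by apply: lee_sum => n _; exact: hA.
by rewrite sumEFin lee_fin sumr_const card_ord -[_ *+ _]mulr_natl.
Qed.

Lemma outer_nondecreasing (A : nat -> set Omega) (q : R) :
  (forall n, measurable (A n)) -> (forall m n, (m <= n)%N -> A m `<=` A n) ->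
  (forall n, fine (P (A n)) <= q) -> (Po (\bigcup_n A n) <= q%:E)%E.
Proof.
move=> mA nA hA; have mU := bigcupT_measurable A mA.
rewrite measurable_mu_extE//.
have ndA : nondecreasing_seq A by move=> m n mn; exact/subsetPset/nA.
have := @nondecreasing_cvg_mu _ _ _ P A mA mU ndA.
move=> cv; rewrite -(cvg_lim _ cv)//; apply: lime_le; first by apply/cvg_ex; exists (P (\bigcup_n A n)).
by apply: nearW => n; rewrite /= -(fineK (fin_num_measure P _ (mA n))) lee_fin; exact: hA.
Qed.

End outer_probability.

Section power_series.
Variable R : realType.

Lemma powR_small (eta eps : R) : 0 < eta -> 0 < eps ->
  exists m0, forall m, (m0 <= m)%N -> m%:R `^ (- eta) <= eps.
Proof.
move=> eta0 eps0; exists (Num.truncn (eps `^ (- eta^-1))).+1 => m hm.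
have lem : eps `^ (- eta^-1) <= m%:R.
  by rewrite (le_trans (ltW (truncnS_gt _)))// ler_nat.
have m0 : 0 < m%:R :> R by apply: lt_le_trans lem; exact: powR_gt0.
rewrite powRN -[leRHS]invrK lef_pV2 ?posrE ?invr_gt0// ?powR_gt0//.
rewrite (@le_trans _ _ ((eps `^ (- eta^-1)) `^ eta))//.
  by rewrite -powRrM mulNr mulVf ?gt_eqF// powR_inv1// ltW.
by apply: ge0_ler_powR; rewrite ?nnegrE ?powR_ge0 ?(ltW m0)// ltW.
Qed.

Lemma sum_powR_le (eta : R) (n0 m : nat) : (0 < n0)%N -> 0 < eta ->
  \sum_(n < m) (n0 + n).+1%:R `^ (- 1 - eta) <= eta^-1 * n0%:R `^ (- eta).
Proof.
move=> n00 eta0; suff : \sum_(n < m) (n0 + n).+1%:R `^ (- 1 - eta) <=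
    eta^-1 * (n0%:R `^ (- eta) - (n0 + m)%:R `^ (- eta)).
  by move/le_trans; apply; rewrite ler_wpM2l ?invr_ge0 ?(ltW eta0)// gerBl powR_ge0.
elim: m => [|m IH]; first by rewrite big_ord0 addn0 subrr mulr0.
rewrite big_ord_recr /=.
have := @natr_powR_lb R (n0 + m) eta _ eta0; rewrite addn_gt0 n00 => /(_ isT).
rewrite -ler_pdivlMl// addnS => h.
by apply: le_trans (lerD IH h) _; rewrite -mulrDr addrA subrK.
Qed.
End power_series.

(** * Finiteness of the critical level *)

Section critical_level.
Context (R : realType) disp (Omega : measurableType disp) (P : probability Omega R).
Variables (d : nat) (D : domain) (f : site R d D -> {RV P >-> R}).
Hypothesis d_ge2 : (2 <= d)%N.
Hypothesis f_gaussian : gaussian_field f.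
Hypothesis f_continuous : continuous_field f.
Hypothesis f_sup : bounded_local_suprema f.
Hypothesis f_decay : polylog_correlation_decay f.
Local Notation Po := (P^*)%mu.
Local Notation V := 'rV[int]_d.
Let d_gt0 : (0 < d)%N. Proof. exact: leq_trans d_ge2. Qed.

Definition cascade_event (e u : R) (n : nat) (z : V) : set Omega :=
  [set w | exists K, u < cascade K.+1 n (config (cell_field f e) w) z].

Lemma cascade_event_le e u n z q : cascade_bound (cell_field f e) n u q ->
  (Po (cascade_event e u n z) <= q%:E)%E.
Proof.
move=> hq; rewrite (_ : cascade_event _ _ _ _ =
    \bigcup_K [set w | u < cascade K.+1 n (config (cell_field f e) w) z]).
  apply: outer_nondecreasing => [K|K K' KK w|K]; first exact: measurable_cascade_gt.
    exact: cascade_mono.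
  exact: hq.
by apply/seteqP; split=> w [K]; [exists K|exists K].
Qed.

Lemma cell_field_renormalisation e : `|e| = 1 -> exists C eta : R, [/\ 0 <= C, 0 < eta,
  forall u, 0 < u -> cascade_bound (cell_field f e) 0 u (C / u) &
  exists n2 : nat, forall n0, (n2 <= n0)%N -> exists U : R, forall u, U <= u ->
    forall n, (n0 <= n)%N -> cascade_bound (cell_field f e) n u (n%:R `^ (- 1 - eta))].
Proof.
move=> e1; have [C C0 hC] := local_sup_bound f_sup.
have [c1 [delta [c10 delta0 decay]]] := cell_field_decay d_gt0 e1 f_gaussian f_decay.
have tail := cell_field_tail d_gt0 e1 hC.
have [eta eta0 ren] := cascade_renormalisation d_gt0 (cell_field_gaussian e f_gaussian)
  C0 c10 delta0 tail decay.
by exists C, eta.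
Qed.

Let bad_sample := [set w | ~ continuous_sample (fun x => f x w)].

Let bad_sample0 : (Po bad_sample <= 0%:E)%E.
Proof.
rewrite [leLHS](_ : _ = 0%E)//; apply: outer_null; move: f f_continuous; case: D => // g _; exact: aeW.
Qed.

(** Percolation forces the cascade events around some [z] at all scales, whose
probabilities tend to 0. *)
Lemma no_percolation_at_low_levels : exists L : R, forall l, l <= L ->
  percolation_probability P (fun x w => f x w + l) = 0%E.
Proof.
have [C [eta [_ eta0 _ [n2 ren]]]] := cell_field_renormalisation (normr1 R).
have [U hU] := ren n2 (leqnn _).
exists (- U - 1) => l lU; pose u := - l - 1.
have /hU bound : U <= u by rewrite /u; lra.
pose A k := if (unpickle k : option V) is Some z then \bigcap_n cascade_event 1 u n z else set0.
have A0 k : (Po (A k) <= 0%:E)%E.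
  rewrite /A; case: unpickle => [z|]; last by rewrite outer_measure0.
  apply/lee_addgt0Pr => eps eps0; rewrite add0e.
  have [m0 small] := powR_small (ltr01 : 0 < 1 :> R) eps0.
  pose n := (maxn 1 (maxn n2 m0)).
  have [n1 nn2 nm0] : [/\ (1 <= n)%N, (n2 <= n)%N & (m0 <= n)%N].
    by rewrite /n; split; lia.
  apply: (@le_trans _ _ (Po (cascade_event 1 u n z))).
    by apply: le_outer_measure => w; exact.
  apply: le_trans (cascade_event_le z (bound n nn2)) _.
  rewrite lee_fin (le_trans _ (small n nm0))// ler_powR ?ler1n//; lra.
apply/eqP; rewrite eq_le outer_measure_ge0 andbT.
apply: (@le_trans _ _ (Po (bad_sample `|` \bigcup_k A k))).
  apply: le_outer_measure => w /= perc.
  have [cw|] := pselect (continuous_sample (fun x => f x w)); last by left.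
  right; have [|z hz] := percolation_cascades d_ge2 (u := u) cw _ perc; first by rewrite /u; lra.
  exists (pickle z) => //; rewrite /A pickleK => n _.
  have [K uK] := hz n; exists K; congr (_ < cascade _ _ _ _) : uK.
  by apply/funext => y; apply/funext => k; rewrite /config /= mulr1.
apply: le_trans (outer_measureU2 _ _ _) _.
rewrite -[leRHS]add0e; apply: leeD; first exact: bad_sample0.
by apply: (outer_series (a := fun=> 0)) => // m; rewrite big1.
Qed.

Let absz_shift (t : int) (m : nat) : (`|t| <= m)%N ->
  (`|(t + m%:Z)%R| < (2 * m).+1)%N /\ `|(t + m%:Z)%R|%N%:Z - m%:Z = t :> int.
Proof. by clear; lia. Qed.

(** The failure events have total outer probability at most 1/2: outside of them, the
sampled opposite field has no bad cell on the axis near the origin, and no cascade around the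
relevant points of the axis at higher scales. *)
Lemma percolation_at_high_levels : exists L : R,
  (0 < percolation_probability P (fun x w => f x w + L)%R)%E.
Proof.
have [C [eta [C0 eta0 tail [n2 ren]]]] := cell_field_renormalisation (normrN1 R).
(* 68 = 4 * 17: the 17 points at each scale must contribute at most 1/4 in total *)
have [|m0 small] := powR_small (eps := eta / 68) eta0; first by rewrite divr_gt0.
pose n1 := maxn 1 (maxn n2 m0).
have [n11 n1n2 n1m0] : [/\ (1 <= n1)%N, (n2 <= n1)%N & (m0 <= n1)%N].
  by rewrite /n1; split; lia.
have [U hU] := ren n1.+1 (leqW n1n2).
pose M := (2 * 8 ^ n1.+1).+1.
pose u := Num.max 1 (Num.max U (4 * (M%:R * C))).
have u1 : 1 <= u by rewrite le_max lexx.
have u0 : 0 < u by exact: lt_le_trans u1.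
have uU : U <= u by rewrite !le_max lexx orbT.
have uM : 4 * (M%:R * C) <= u by rewrite !le_max lexx !orbT.
pose E0 (j : nat) := cascade_event (-1) u 0 (plane d (j%:Z - (8 ^ n1.+1)%N%:Z, 0)).
pose E1 m (j : nat) := cascade_event (-1) u (n1 + m).+1
  (plane d ((8 ^ (n1 + m).+1)%N%:Z * (j%:Z - 8%:Z), 0)).
pose A0 := \big[setU/set0]_(j < M) E0 j.
pose A1 m := \big[setU/set0]_(j < 17) E1 m j.
exists u; rewrite ltNge; apply/negP => perc0.
have PA0 : (Po A0 <= (4^-1)%:E)%E.
  have site_le j : (Po (E0 j) <= (C / u)%:E)%E.
    by apply: cascade_event_le; exact: tail.
  apply: le_trans (outer_finite M site_le) _.
  by rewrite lee_fin mulrA ler_pdivrMr// ler_pdivlMl.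
have PA1 : (Po (\bigcup_m A1 m) <= (4^-1)%:E)%E.
  apply: (outer_series (a := fun m => 17%:R * (n1 + m).+1%:R `^ (- 1 - eta))) => [m|m].
    have site_le j : (Po (E1 m j) <= ((n1 + m).+1%:R `^ (- 1 - eta))%:E)%E.
      by apply: cascade_event_le; apply: hU; rewrite // ltnS leq_addr.
    exact: (outer_finite 17 site_le).
  rewrite -mulr_sumr.
  apply: (@le_trans _ _ (17%:R * (eta^-1 * (eta / 68)))).
    rewrite ler_wpM2l// (le_trans (sum_powR_le _ _ _))// ler_wpM2l ?invr_ge0 ?(ltW eta0)//.
    exact: small.
  by rewrite mulKf ?gt_eqF//; lra.
have : (1%:E <= Po (bad_sample `|` (A0 `|` (\bigcup_m A1 m `|`
   [set w | has_unbounded_component [set x | 0 <= f x w + u]%R]))))%E.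
  rewrite -(probability_setT P) -[P setT](measurable_mu_extE P measurableT).
  apply: le_outer_measure => w _.
  have [cw|] := pselect (continuous_sample (fun x => f x w)); last by left.
  right; have cfgE : config (cell_field f (-1)) w = fun z k => - f (cell_point R D z k) w.
    by apply/funext => z; apply/funext => k; rewrite /config /= mulrN1.
  have [h0|h0] := pselect (A0 w); first by left.
  have [h1|h1] := pselect ((\bigcup_m A1 m) w); first by right; left.
  right; right; apply: (no_cascade_percolates d_ge2 (n0 := n1.+1) cw).
    move=> [t tM cas]; apply: h0; rewrite /A0 -(bigcup_mkord _ E0).
    have [lt tE] := absz_shift tM.
    by exists `|(t + (8 ^ n1.+1)%N%:Z)%R|%N; rewrite // /E0 /cascade_event /= cfgE tE.
  move=> [n nn [j j8 cas]]; apply: h1; exists (n - n1.+1)%N => //.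
  have [lt jE] := absz_shift j8.
  rewrite /A1 -(bigcup_mkord _ (E1 _)); exists `|(j + 8%:Z)%R|%N => //.
  have nE : (n1 + (n - n1.+1)).+1%N = n by rewrite -addSn subnKC.
  by rewrite /E1 nE /cascade_event /= cfgE jE.
apply/negP; rewrite -ltNge.
apply: (@le_lt_trans _ _ (0%:E + ((4^-1)%:E + ((4^-1)%:E + 0%:E)))%E); last first.
  by rewrite -!EFinD lte_fin; lra.
apply: le_trans (outer_measureU2 _ _ _) _; apply: leeD; first exact: bad_sample0.
apply: le_trans (outer_measureU2 _ _ _) _; apply: leeD => //.
by apply: le_trans (outer_measureU2 _ _ _) _; apply: leeD.
Qed.

Lemma critical_level_finite : (-oo < critical_level f < +oo)%E.
Proof.
apply/andP; split.
  have [L hL] := no_percolation_at_low_levels.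
  apply: (@lt_le_trans _ _ L%:E); first exact: ltNyr.
  apply: le_ereal_inf_tmp => _ [l /= perc <-]; rewrite lee_fin leNgt.
  by apply/negP => lL; move: perc; rewrite (hL l (ltW lL)) ltxx.
have [L hL] := percolation_at_high_levels.
apply: (@le_lt_trans _ _ L%:E); last exact: ltry.
by apply: ereal_inf_lbound; exists L.
Qed.
End critical_level.

Theorem theorem3p1 (R : realType) (disp : measure_display)
    (Omega : measurableType disp) (P : probability Omega R)
    (d : nat) (D : domain) (f : site R d D -> {RV P >-> R})
    (d_ge2 : (2 <= d)%N)
    (f_gaussian : gaussian_field f)
    (f_continuous : continuous_field f)
    (f_sup : bounded_local_suprema f)
    (f_decay : polylog_correlation_decay f) :
  (-oo < critical_level f < +oo)%E.
Proof. exact: critical_level_finite. Qed.
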